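(* Let $a>0$ and $r>0$. Assume that $(\mathcal{X}_t)_{t\geq 0}$ is a super-Brownian motion (with branching mechanism $\psi_0(u)=2u^2$) that starts from $r\delta_a$ under the probability measure $\mathbb{P}_{r\delta_a}$. Set $$\Sigma=\int_0^\infty dt\,\langle \mathcal{X}_t,1 \rangle,$$ and write $\mathcal{R}^{\mathcal{X}}$ for the range of $\mathcal{X}$. Then, for every $\mu>0$, $$\mathbb{E}_{r\delta_a}\Big[e^{-\mu \Sigma}\,\Big|\,\min\mathcal{R}^{\mathcal{X}}=0\Big]= a^3(2\mu)^{3/4} \,\frac{\cosh((2\mu)^{1/4}a)}{\sinh^3((2\mu)^{1/4}a)}\,\exp\Big(-r\Big(\sqrt{\frac{\mu}{2}}\Big(3 \coth^2((2\mu)^{1/4}a) -2\Big)-\frac{3}{2a^2}\Big)\Big).$$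
   Context: Super-Brownian motion in dimension one with branching mechanism $\psi_0(u)=2u^2$ is the Markov process $(\mathcal{X}_t)_{t\ge0}$ with values in the finite measures on $\mathbb{R}$ such that, for every bounded nonnegative continuous $f$, $\mathbb{E}_\mu[\exp(-\langle\mathcal{X}_t,f\rangle)]=\exp(-\langle\mu,v_t\rangle)$, where $v$ is the nonnegative solution of $\partial_tv_t=\frac12v_t''-2v_t^2$, $v_0=f$. The range $\mathcal{R}^{\mathcal{X}}$ is the closure of the union over $t\ge0$ of the topological supports of $\mathcal{X}_t$. The conditioning on the null event $\{\min\mathcal{R}^{\mathcal{X}}=0\}$ is understood as the limit as $\varepsilon\downarrow0$ of conditioning on $\{-\varepsilon<\min\mathcal{R}^{\mathcal{X}}\le0\}$. *)

(* Defs.v *)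
From HB Require Import structures.
From mathcomp Require Import all_boot all_order all_algebra.
From mathcomp Require Import all_classical all_reals all_analysis.
From mathcomp Require Import measurable_realfun.

Set Implicit Arguments.
Unset Strict Implicit.
Unset Printing Implicit Defensive.

Import Order.TTheory GRing.Theory Num.Theory.
Import numFieldNormedType.Exports.

Local Open Scope classical_set_scope.
Local Open Scope ring_scope.

Section hyperbolic.
Context {R : realType}.
Implicit Type x : R.

Definition cosh x : R := (expR x + expR (- x)) / 2.
Definition sinh x : R := (expR x - expR (- x)) / 2.
Definition coth x : R := cosh x / sinh x.

End hyperbolic.

Notation finmeas R := {finite_measure set (measurableTypeR R) -> \bar R}.

Section measures_on_the_line.
Context {R : realType}.

Definition bounded_continuous (f : R -> R) : Prop :=
  continuous f /\ [bounded f x | x in [set: R]].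

Definition pairing (m : finmeas R) (f : R -> R) : \bar R :=
  (\int[m]_x (f x)%:E)%E.

Definition weak_cvg (F : set_system R) (m : R -> finmeas R) (l : finmeas R) :
    Prop :=
  forall f, bounded_continuous f -> pairing (m s) f @[s --> F] --> pairing l f.

Definition supp (m : finmeas R) : set R :=
  [set x | forall U : set R, open U -> U x -> (0 < m U)%E].

Definition is_min (S : set R) (m : R) : Prop := S m /\ lbound S m.

End measures_on_the_line.

Section super_Brownian_motion.
Context {R : realType}.

Definition psi0 (u : R) : R := 2 * u ^+ 2.

(* Time comes first: [v t] is the spatial profile at time [t]. The values of
   [v] at negative times are irrelevant. *)
Definition log_laplace_solution (f : R -> R) (v : R -> R -> R) : Prop :=
  [/\ forall t x : R, 0 <= t -> 0 <= v t x,
      {within [set p : R * R | 0 <= p.1], continuous (fun p => v p.1 p.2)},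
      forall x, v 0 x = f x
    & forall t x : R, 0 < t ->
      [/\ derivable (v ^~ x) t 1,
          derivable (v t) x 1,
          derivable (derive1 (v t)) x 1
        & derive1 (v ^~ x) t = 2^-1 * derive1 (derive1 (v t)) x - psi0 (v t x)]].

Context {d : measure_display} {Omega : measurableType d}.

(* Processes are indexed by all reals, but only times [0 <= t] ever matter. *)
Definition natural_filtration (X : R -> Omega -> finmeas R) (t : R) :
    set_system Omega :=
  <<s \bigcup_(u in `[0, t])
        \bigcup_(B in measurable)
          preimage_set_system [set: Omega] (fun w => X u w B) measurable >>.

(* [sbm_markov] is the Markov property with the transition semigroup given by
   its Laplace functional:
     E[exp(- <X_(t+s), f>) | F_t] = exp(- <X_t, v_s>)  almost surely,
   tested against the events of [F_t]. As f ranges over the bounded nonnegative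
   continuous functions this determines the conditional law of [X_(t+s)].
   [sbm_rcont] and [sbm_llim] fix a version of the process whose paths are
   cadlag for the weak topology; without path regularity the range depends on
   the version. *)
Record is_sbm (P : probability Omega R)
    (m0 : {measure set (measurableTypeR R) -> \bar R})
    (X : R -> Omega -> finmeas R) : Prop := IsSBM {
  sbm_measurable : forall (t : R) (B : set (measurableTypeR R)),
    0 <= t -> measurable B ->
    measurable_fun [set: Omega] (fun w => X t w B) ;
  sbm_rcont : forall w (t : R), 0 <= t -> weak_cvg t^'+ (X ^~ w) (X t w) ;
  sbm_llim : forall w (t : R), 0 < t -> exists l, weak_cvg t^'- (X ^~ w) l ;
  sbm_start : {ae P, forall w, forall B, measurable B -> X 0 w B = m0 B} ;
  sbm_markov : forall f, bounded_continuous f -> (forall x, 0 <= f x) ->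
    exists2 v, log_laplace_solution f v &
      forall (s t : R) A, 0 <= s -> 0 <= t -> natural_filtration X t A ->
        (\int[P]_(w in A) expeR (- pairing (X (t + s)%R w) f) =
         \int[P]_(w in A) expeR (- pairing (X t w) (v s)))%E }.

Definition sbm_range (X : R -> Omega -> finmeas R) (w : Omega) : set R :=
  closure (\bigcup_(t in `[0, +oo[) supp (X t w)).

Definition total_mass (X : R -> Omega -> finmeas R) (w : Omega) : \bar R :=
  (\int[lebesgue_measure]_(t in `[0%R, +oo[) pairing (X t w) (cst 1%R))%E.

Definition min_range_in (X : R -> Omega -> finmeas R) (I : set R) :
    set Omega :=
  [set w | exists2 m, is_min (sbm_range X w) m & I m].

(* Only meaningful when [A] is an event of positive probability; it is 0 by
   convention if [P A = 0]. *)
Definition cond_expectation (P : probability Omega R) (A : set Omega)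
    (Y : Omega -> \bar R) : R :=
  fine (\int[P]_(w in A) Y w)%E / fine (P A).

End super_Brownian_motion.

(* Main.v *)
Require Import Defs.
From HB Require Import structures.
From mathcomp Require Import all_boot all_order all_algebra.
From mathcomp Require Import all_classical all_reals all_analysis.
From mathcomp Require Import measurable_realfun.
From mathcomp Require Import ring lra.

(** Let [N y] be the event that the range lies in [[y, +oo[] and
    [U c y = 3/2 kap(a - y)^2 - c^2], where [kap x = c coth(c x)] and
    [mu = c^4/2] ([kap x = 1/x] when [c = 0]); [U] solves
    [U''/2 = 2 U^2 - mu] and blows up at [y = a].  The point is that
    [E(exp(- mu Sigma); N y) = exp(- r U c y)]; the theorem follows by applying
    it at [y = 0] and [y = - eps], with [mu] and with [0], and taking the
    quotient of the derivatives.

    For a smooth bounded [w > 0] put [phi = 2 w^2 - w''/2].  A maximum principle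
    shows that the log-Laplace solution started from [w] is
    [w - h phi + o(h)], uniformly in space, so iterating the Markov property
    over a partition of [[0, T]] gives
    [E exp(- <X_T, w> - \int_0^T <X_t, phi> dt) = exp(- r w(a))].
    Composing [3/2 kap^2 - c^2] with a softplus regularisation of
    [x |-> max(x - y, 0)] of width [dl] produces [w] with [phi >= mu],
    [phi -> mu] on [[y + eta, +oo[] and [phi -> +oo] on [[-oo, y]] as
    [dl -> 0]; letting [dl -> 0] and then [T -> +oo] bounds the expectation on
    [N y] from both sides. *)

Set Implicit Arguments.
Unset Strict Implicit.
Unset Printing Implicit Defensive.

Import Order.TTheory GRing.Theory Num.Theory.
Import numFieldNormedType.Exports.

Local Open Scope classical_set_scope.
Local Open Scope ring_scope.

(** * Comparison for the log-Laplace equation *)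

Section parabolic_maximum_principle.
Context {R : realType}.
Implicit Types (f : R -> R) (D : R -> R -> R).

(** The process supplies, for each bounded nonnegative continuous [f], some log-Laplace solution
    about which only the equation, continuity and positivity are known. Every estimate must
    therefore hold for an arbitrary classical solution, hence a comparison principle proved for all
    of them. Only bounded test functions may be fed to the Markov property, hence the smoothing of
    the singular profile [U] before it is used. The choice of [phi] comes from the equation with a
    source: [w] is a stationary solution of [dv/dt = v''/2 - 2 v^2 + phi] exactly when
    [phi = 2 w^2 - w''/2]. The Riemann sums along the path play the part of that source. Keeping
    [kap] abstract lets one argument serve twice: [c > 0] gives the numerator of the conditional
    expectation and [c = 0] its denominator, the plain probability. Both vanish as [eps] tends to 0,
    which is why derivatives appear. Since [U' = 3 kap (c^2 - kap^2)], the factor [3 r] cancels in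
    the quotient, and the denominator leaves the factor [a^3]. *)

Lemma is_derive_quotient f (x df : R) : is_derive x 1 f df ->
  h^-1 * (f (h + x) - f x) @[h --> 0^'] --> df.
Proof.
move=> [dfx <-]; move: dfx; rewrite /derivable /derive => dfx.
have -> : (fun h : R => h^-1 * (f (h + x) - f x)) =
    (fun h : R => h^-1 *: ((f \o shift x) (h *: (1 : R)) - f x)).
  by apply/funext => h /=; rewrite [h *: 1]mulr1.
by [].
Qed.

Lemma is_derive_left_max f (t df : R) : 0 < t -> is_derive t 1 f df ->
  (forall s, 0 < s < t -> f s <= f t) -> 0 <= df.
Proof.
move=> t0 /is_derive_quotient fdf fmax; rewrite leNgt; apply/negP => df0.
have /fdf/nbhs_ballP[e /= e0 He] : nbhs df [set y : R | y < 0].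
  by apply: lt_nbhsl.
pose m := Num.min e t; have m0 : 0 < m by rewrite lt_min e0 t0.
have me : m <= e by rewrite ge_min lexx.
have mt : m <= t by rewrite ge_min lexx orbT.
have /= := He (- (m / 2)).
rewrite /ball/= sub0r opprK gtr0_norm; last by lra.
move=> /(_ ltac:(lra)); rewrite oppr_eq0 => /(_ ltac:(lra)).
apply/negP; rewrite -leNgt.
have : f (- (m / 2) + t) <= f t by apply: fmax; lra.
rewrite -subr_le0 => h; apply: mulr_le0 => //.
by rewrite invr_le0; lra.
Qed.

(** If [f2] were positive, [f1] would pass from 0 at [x] to positive values just to the right, and
    the mean value theorem would push [f] above its maximum. Differentiability of [f1] at the single
    point [x] is enough for this. *)
Lemma is_derive2_max f f1 (a b x f2 : R) : a < x < b ->
  (forall y, a < y < b -> is_derive y 1 f (f1 y)) -> is_derive x 1 f1 f2 ->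
  (forall y, a < y < b -> f y <= f x) -> f2 <= 0.
Proof.
move=> /andP[ax xb] df df1 fmax.
have ab : a <= b by lra.
have fx0 : f1 x = 0.
  have := @derive1_at_max R f a b x ab.
  move=> /(_ _)[|||_ <-].
  - by move=> t; rewrite in_itv/= => /df[].
  - by rewrite in_itv/= ax.
  - by move=> t; rewrite in_itv/= => /fmax.
  - by have [|_ <-] := df x; first by rewrite ax.
rewrite leNgt; apply/negP => f20.
move/is_derive_quotient : (df1) => q.
have /q/nbhs_ballP[e /= e0 He] : nbhs f2 [set y : R | 0 < y].
  by apply: lt_nbhsr.
pose m := Num.min e (b - x); have m0 : 0 < m by rewrite lt_min e0; lra.
have me : m <= e by rewrite ge_min lexx.
have mt : m <= b - x by rewrite ge_min lexx orbT.
have pos y : x < y < x + m / 2 -> 0 < f1 y.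
  move=> /andP[xy ym].
  have /= := He (y - x); rewrite /ball/= sub0r normrN gtr0_norm; last lra.
  move=> /(_ ltac:(lra)) /(_ ltac:(lra)).
  by rewrite subrK fx0 subr0 pmulr_rgt0// invr_gt0; lra.
have dfi y : y \in `]x, (x + m / 2)[ -> is_derive y 1 f (f1 y).
  by rewrite in_itv/= => yi; apply: df; lra.
have [|c ci] := @MVT R f f1 x (x + m / 2) ltac:(lra) dfi.
  apply: derivable_within_continuous => y.
  by rewrite in_itv/= => yi; have [] := df y ltac:(lra).
have := fmax (x + m / 2) ltac:(lra).
move: ci; rewrite in_itv/= => /pos c0 h1 h2.
have : 0 < f1 c * (x + m / 2 - x) by apply: mulr_gt0 => //; lra.
lra.
Qed.

(** A positive value forces a positive maximum on the compact box, at a positive time and an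
    interior point; there the time derivative is nonnegative (the maximum may sit at the final time)
    and the second space derivative nonpositive. The contradiction is asked for only where [D] is
    positive, because positivity is what gives the quadratic terms a sign in the applications. *)
Lemma parabolic_max D (h a b : R) :
  {within `[0, h] `*` `[a, b], continuous (fun p : R * R => D p.1 p.2)} ->
  (forall x, a <= x <= b -> D 0 x <= 0) ->
  (forall t, 0 <= t <= h -> D t a <= 0 /\ D t b <= 0) ->
  (forall t x, 0 < t <= h -> a < x < b -> 0 < D t x ->
     exists dt (d1 : R -> R) d2,
       [/\ is_derive t 1 (D ^~ x) dt,
           forall y, a < y < b -> is_derive y 1 (D t) (d1 y),
           is_derive x 1 d1 d2 & (0 <= dt -> d2 <= 0 -> False)]) ->
  forall t x, 0 <= t <= h -> a <= x <= b -> D t x <= 0.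
Proof.
move=> cD D0 Dab DI t0 x0 t0h x0ab; rewrite leNgt; apply/negP => Dpos.
have [||[t x]] := @compact_EVT_max _ R (fun p : R * R => D p.1 p.2)
    (`[0, h] `*` `[a, b]) _ _ cD.
- by exists (t0, x0); split => /=; rewrite in_itv.
- by apply: compact_setX; exact: segment_compact.
rewrite inE/= !in_itv/= => -[/= tI xI] tmax.
have tmax' s y : 0 <= s <= h -> a <= y <= b -> D s y <= D t x.
  move=> sI yI; apply: (tmax (s, y)).
  by rewrite inE; split; rewrite /= in_itv.
have Dtx : 0 < D t x by exact: lt_le_trans (tmax' _ _ t0h x0ab).
have t_gt0 : 0 < t.
  rewrite lt_neqAle; case/andP: (tI) => -> _; rewrite andbT.
  by apply/eqP => t0'; move: Dtx; rewrite -t0' ltNge D0.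
have [Dta Dtb] := Dab _ tI.
have xab : a < x < b.
  rewrite !lt_neqAle; case/andP: (xI) => -> ->; rewrite !andbT.
  apply/andP; split; apply/eqP => xe.
    by move: Dtx; rewrite -xe ltNge Dta.
  by move: Dtx; rewrite xe ltNge Dtb.
have [|dt [d1 [d2 [H1 H2 H3]]]] := DI t x _ xab Dtx.
  by case/andP: tI => _ ->; rewrite t_gt0.
apply.
  by apply: is_derive_left_max t_gt0 H1 _ => s sI; apply: tmax' => //; lra.
by apply: is_derive2_max xab H2 H3 _ => y yI; apply: tmax'; lra.
Qed.

End parabolic_maximum_principle.

Section pointwise_derivation_rules.
Context {R : realType}.
Implicit Types f g : R -> R.

(* [is_derive] is a type class: hiding it keeps instance resolution from
   closing side goals with derivatives in another form. *)
Definition der f (x df : R) : Prop := is_derive x 1 f df.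

Lemma der_eq f (x a b : R) : der f x a -> a = b -> is_derive x 1 f b.
Proof. by move=> + <-. Qed.

Lemma der_cst (c x : R) : der (fun=> c) x 0.
Proof. exact: is_derive_cst. Qed.

Lemma der_id (x : R) : der (fun y => y) x 1.
Proof. exact: is_derive_id. Qed.

Lemma derD f g (x df dg : R) : der f x df -> der g x dg ->
  der (fun y => f y + g y) x (df + dg).
Proof. exact: is_deriveD. Qed.

Lemma derN f (x df : R) : der f x df -> der (fun y => - f y) x (- df).
Proof. exact: is_deriveN. Qed.

Lemma derB f g (x df dg : R) : der f x df -> der g x dg ->
  der (fun y => f y - g y) x (df - dg).
Proof. exact: is_deriveB. Qed.

Lemma derM f g (x df dg : R) : der f x df -> der g x dg ->
  der (fun y => f y * g y) x (f x * dg + g x * df).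
Proof. exact: is_deriveM. Qed.

Lemma derZ f (c x df : R) : der f x df -> der (fun y => c * f y) x (c * df).
Proof. exact: is_deriveZ. Qed.

Lemma derX f n (x df : R) : der f x df ->
  der (fun y => f y ^+ n) x (n%:R * f x ^+ n.-1 * df).
Proof.
move=> dfx; have -> : (fun y => f y ^+ n) = f ^+ n.
  by apply/funext => y; rewrite fctE.
exact: is_deriveX.
Qed.

Lemma derV f (x df : R) : f x != 0 -> der f x df ->
  der (fun y => (f y)^-1) x (- (df / f x ^+ 2)).
Proof.
move=> fx dfx; have := is_deriveV fx dfx.
by rewrite /GRing.scale/= mulNr mulrC.
Qed.

Lemma der_comp f g (x a b : R) : der f (g x) a -> der g x b ->
  der (fun y => f (g y)) x (a * b).
Proof. exact: is_derive1_comp. Qed.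

Lemma der_continuous f x df : der f x df -> {for x, continuous f}.
Proof.
by move=> [dfx _]; apply: differentiable_continuous; exact/derivable1_diffP.
Qed.

End pointwise_derivation_rules.

Section comparison.
Context {R : realType}.

(** The time derivative and the second space derivative are named because the differential
    inequalities mention them; the first space derivative stays existential. *)
Definition classical_on (h : R) (z zt z2 : R -> R -> R) : Prop :=
  {within [set p : R * R | 0 <= p.1], continuous (fun p => z p.1 p.2)} /\
  forall t, 0 < t <= h -> exists z1 : R -> R, forall x,
    [/\ is_derive t 1 (z ^~ x) (zt t x), is_derive x 1 (z t) (z1 x)
      & is_derive x 1 z1 (z2 t x)].

Lemma log_laplace_solution_classical f v (h : R) : log_laplace_solution f v ->
  exists vt v2, classical_on h v vt v2 /\
    forall t x, 0 < t -> vt t x = 2^-1 * v2 t x - psi0 (v t x).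
Proof.
move=> [_ vc _ vd].
exists (fun t x => derive1 (v ^~ x) t), (fun t => derive1 (derive1 (v t))).
split; last by move=> t x /(vd t x)[].
split=> // t /andP[t0 _]; exists (derive1 (v t)) => x.
have [d1 d2 d3 _] := vd t x t0.
by split; [exact: (DeriveDef d1 (esym (derive1E _ _)))|
  exact: (DeriveDef d2 (esym (derive1E _ _)))|
  exact: (DeriveDef d3 (esym (derive1E _ _)))].
Qed.

(** With [s = 1] or [s = -1] the pole, placed by [al], is approached from the right or from the
    left, so one family covers both ends of an interval. *)
Let barrier_q (s al y : R) : R := (s * y + al)^-1.

Let barrier (s al y : R) : R := 3 / 2 * barrier_q s al y ^+ 2.

Let der_barrier_q s al y : s * y + al != 0 ->
  der (barrier_q s al) y (- s * barrier_q s al y ^+ 2).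
Proof.
move=> h; apply: der_eq.
  by apply: derV; [exact: h|]; apply: derD; [apply: derZ; exact: der_id|exact: der_cst].
rewrite /barrier_q exprVn /= mulr1 addr0.
by rewrite mulNr.
Qed.

Let der_barrier s al y : s * y + al != 0 ->
  der (barrier s al) y (- 3 * s * barrier_q s al y ^+ 3).
Proof.
move=> h; apply: der_eq.
  by apply: derZ; apply: derX; exact: der_barrier_q.
by rewrite /=; field.
Qed.

Let der_barrier1 s al y : s ^+ 2 = 1 -> s * y + al != 0 ->
  der (fun y => - 3 * s * barrier_q s al y ^+ 3) y (9 * barrier_q s al y ^+ 4).
Proof.
move=> s2 h; apply: der_eq.
  by apply: derZ; apply: derX; exact: der_barrier_q.
have -> : 9 * barrier_q s al y ^+ 4 = 9 * s ^+ 2 * barrier_q s al y ^+ 4.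
  by rewrite s2 mulr1.
by rewrite /=; ring.
Qed.

(** Each barrier [b = 3/2 a] satisfies [b''/2 = 2 b^2]. As squares are superadditive on nonnegative
    numbers, [(Z + b1 + b2)^2 >= Z^2 + b1^2 + b2^2], so adding both barriers to a supersolution
    leaves a supersolution. *)
Let upper_absurd (a1 a2 V Z V2 Z2 VT ZT : R) : 0 <= a1 -> 0 <= a2 -> 0 <= Z ->
  0 < V - Z - (3 / 2 * a1 + 3 / 2 * a2) ->
  2^-1 * Z2 - 2 * Z ^+ 2 <= ZT -> VT = 2^-1 * V2 - 2 * V ^+ 2 ->
  0 <= VT - ZT - (0 + 0) -> V2 - Z2 - (9 * a1 ^+ 2 + 9 * a2 ^+ 2) <= 0 -> False.
Proof.
move=> a10 a20 Z0 VZ H2 H3 H4 H5.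
have : (Z + 3 / 2 * (a1 + a2)) ^+ 2 < V ^+ 2.
  by clear H2 H3 H4 H5; rewrite ltr_sqr ?nnegrE; lra.
have := mulr_ge0 a10 a20; have := mulr_ge0 Z0 a10; have := mulr_ge0 Z0 a20.
by rewrite -subr_gt0 => ? ? ? ?; nra.
Qed.

(** The corrector [k (x - x0)^2 + k t] solves the heat equation exactly: half its second space
    derivative and its time derivative are both [k]. Only the strict inequality [V^2 < Z^2]
    remains. *)
Let lower_absurd (kt kx V Z V2 Z2 VT ZT k : R) : 0 < kt -> 0 <= kx ->
  0 < Z - V - (kx + kt) -> 0 <= V ->
  ZT <= 2^-1 * Z2 - 2 * Z ^+ 2 -> VT = 2^-1 * V2 - 2 * V ^+ 2 ->
  0 <= ZT - VT - k -> Z2 - V2 - 2 * k <= 0 -> False.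
Proof.
move=> kt0 kx0 VZ V0 H2 H3 H4 H5.
have : V ^+ 2 < Z ^+ 2 by clear H2 H3 H4 H5; rewrite ltr_sqr ?nnegrE; lra.
by lra.
Qed.

Let within_continuousD (A : set (R * R)) (f g : R * R -> R) :
  {within A, continuous f} -> {within A, continuous g} ->
  {within A, continuous (fun p => f p + g p)}.
Proof. by move=> cf cg p; exact: continuousD (cf p) (cg p). Qed.

Let within_continuousB (A : set (R * R)) (f g : R * R -> R) :
  {within A, continuous f} -> {within A, continuous g} ->
  {within A, continuous (fun p => f p - g p)}.
Proof. by move=> cf cg p; exact: continuousB (cf p) (cg p). Qed.

Let within_box (z : R -> R -> R) (h a b : R) :
  {within [set p : R * R | 0 <= p.1], continuous (fun p => z p.1 p.2)} ->
  {within `[0, h] `*` `[a, b], continuous (fun p : R * R => z p.1 p.2)}.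
Proof.
apply: continuous_subspaceW => -[t x] [/=]; rewrite in_itv/=.
by move=> /andP[].
Qed.

Let within_snd (k : R -> R) (h a b : R) :
  (forall y, a <= y <= b -> exists d, der k y d) ->
  {within `[0, h] `*` `[a, b], continuous (fun p : R * R => k p.2)}.
Proof.
move=> dk; apply: continuous_in_subspaceT => -[t x].
rewrite inE => -[/= _]; rewrite in_itv/= => /dk[d /der_continuous ck].
apply: (@continuous_comp _ _ _ snd k); last exact: ck.
exact: cvg_snd.
Qed.

(* The boundary blow-up of the solutions [3 / (2 x ^+ 2)] of [u''/2 = 2 u^2]
   (Keller-Osserman) makes a growth condition on [v] unnecessary. *)
Lemma upper_comparison f v (z zt z2 : R -> R -> R) (h : R) :
  log_laplace_solution f v -> classical_on h z zt z2 ->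
  (forall t x, 0 <= t <= h -> 0 <= z t x) ->
  (forall t x, 0 < t <= h -> 2^-1 * z2 t x - psi0 (z t x) <= zt t x) ->
  (forall x, f x <= z 0 x) ->
  forall t x, 0 <= t <= h -> v t x <= z t x.
Proof.
move=> vsol [zc zd] z0 zsup fz t0 x0 t0h.
have [v_ge0 _ v0 _] := vsol.
have [vt [v2 [[vc vd] veq]]] := log_laplace_solution_classical h vsol.
apply/ler_addgt0Pr => e e0.
(* At the centre [x0] each barrier is at most [3/2 L^-2]; as [L >= 1], their sum is at most [3 / L],
   hence at most [e]. *)
pose L := 3 / e + 1.
have eL : 0 < 3 / e by apply: divr_gt0.
have L1 : 1 <= L by rewrite /L; lra.
have Le : 3 <= e * L.
  by rewrite /L mulrDr mulr1 mulrCA divff ?gt_eqF//; lra.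
pose a := x0 - L; pose b := x0 + L.
have ab : a <= b by rewrite /a /b; lra.
have h0 : 0 <= h by case/andP: t0h => /le_trans; apply.
have [||[tM xM] _ vM] := @compact_EVT_max _ R (fun p : R * R => v p.1 p.2)
    (`[0, h] `*` `[a, b]) _ _ (within_box vc).
- by exists (0, a); split; rewrite /= in_itv/= lexx.
- by apply: compact_setX; exact: segment_compact.
pose M := Num.max 0 (v tM xM).
have M0 : 0 <= M by rewrite /M le_max lexx.
have {}vM t x : 0 <= t <= h -> a <= x <= b -> v t x <= M.
  move=> tI xI; rewrite /M le_max; apply/orP; right; apply: (vM (t, x)).
  by rewrite inE; split; rewrite /= in_itv.
(* The poles sit at distance [tau] outside the interval, so each barrier equals [3/2 (1 + M)^2] at
   its own end and dominates [v] there. The bound [M] belongs to the box, which is fixed before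
   [tau]. *)
pose tau := (1 + M)^-1.
have tau0 : 0 < tau by rewrite invr_gt0; lra.
pose B1 := barrier 1 (tau - a); pose B2 := barrier (- 1) (b + tau).
have nz1 y : a <= y <= b -> 1 * y + (tau - a) != 0.
  by move=> yI; rewrite gt_eqF//; lra.
have nz2 y : a <= y <= b -> -1 * y + (b + tau) != 0.
  by move=> yI; rewrite gt_eqF//; lra.
have B1ge0 y : 0 <= B1 y.
  by rewrite /B1 /barrier mulr_ge0 ?sqr_ge0//; lra.
have B2ge0 y : 0 <= B2 y.
  by rewrite /B2 /barrier mulr_ge0 ?sqr_ge0//; lra.
have tauM : M <= 3 / 2 * tau^-1 ^+ 2 by rewrite /tau invrK; nra.
have B1a : M <= B1 a.
  by rewrite /B1 /barrier /barrier_q (_ : 1 * a + _ = tau)//; ring.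
have B2b : M <= B2 b.
  by rewrite /B2 /barrier /barrier_q (_ : -1 * b + _ = tau)//; ring.
suff : v t0 x0 - z t0 x0 - (B1 x0 + B2 x0) <= 0.
  suff : B1 x0 + B2 x0 <= e by lra.
  rewrite /B1 /B2 /barrier /barrier_q.
  rewrite (_ : 1 * x0 + _ = L + tau); last by rewrite /a; ring.
  rewrite (_ : - 1 * x0 + _ = L + tau); last by rewrite /b; ring.
  have q0 : 0 < (L + tau)^-1 by rewrite invr_gt0; lra.
  have : (L + tau)^-1 * (L + tau) = 1 by rewrite mulVf// gt_eqF//; lra.
  set q := (L + tau)^-1 in q0 * => q1.
  have qL : q * L <= 1 by nra.
  have : 3 * q <= e by rewrite -(ler_pM2r (_ : 0 < L)) //; nra.
  have : q <= 1 by nra.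
  by nra.
apply: (@parabolic_max R (fun t x => v t x - z t x - (B1 x + B2 x)) h a b)
  => //; last by rewrite /a /b; lra.
- apply: within_continuousB; first apply: within_continuousB.
  + exact: within_box vc.
  + exact: within_box zc.
  + apply: within_continuousD.
    * by apply: (@within_snd B1) => y yI; eexists; apply/der_barrier/nz1.
    * by apply: (@within_snd B2) => y yI; eexists; apply/der_barrier/nz2.
- by move=> x xI; have := fz x; rewrite v0; have := B1ge0 x; have := B2ge0 x; lra.
- move=> t tI; split.
  + have := vM t a tI ltac:(lra); have := z0 t a tI; have := B2ge0 a; lra.
  + have := vM t b tI ltac:(lra); have := z0 t b tI; have := B1ge0 b; lra.
- move=> t x tI xI Dpos.
  have [v1 Hv] := vd t tI; have [z1 Hz] := zd t tI.
  exists (vt t x - zt t x - (0 + 0)).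
  exists (fun y => v1 y - z1 y -
    (- 3 * 1 * barrier_q 1 (tau - a) y ^+ 3 +
     - 3 * (-1) * barrier_q (-1) (b + tau) y ^+ 3)).
  exists (v2 t x - z2 t x -
    (9 * barrier_q 1 (tau - a) x ^+ 4 + 9 * barrier_q (-1) (b + tau) x ^+ 4)).
  split.
  + have [Hv1 _ _] := Hv x; have [Hz1 _ _] := Hz x.
    by apply: derB; [exact: derB|apply: derD; exact: der_cst].
  + move=> y yI; have [_ Hv1 _] := Hv y; have [_ Hz1 _] := Hz y.
    apply: derB; first exact: derB.
    by apply: derD; apply: der_barrier; [apply: nz1|apply: nz2]; lra.
  + have [_ _ Hv1] := Hv x; have [_ _ Hz1] := Hz x.
    apply: derB; first exact: derB.
    apply: derD; apply: der_barrier1; rewrite ?expr1n ?sqrrN ?expr1n//.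
      by apply: nz1; lra.
    by apply: nz2; lra.
  + have := veq t x ltac:(lra); have := zsup t x tI; have := z0 t x ltac:(lra).
    move: Dpos; rewrite /psi0 /B1 /B2 /barrier.
    set q1 := barrier_q _ _ _; set q2 := barrier_q _ _ _.
    set V := v t x; set Z := z t x; set V2 := v2 t x; set Z2 := z2 t x.
    set VT := vt t x; set ZT := zt t x.
    move=> H1 Z0 H2 H3 H4 H5.
    have Q1 := sqr_ge0 q1; have Q2 := sqr_ge0 q2.
    rewrite (_ : q1 ^+ 4 = (q1 ^+ 2) ^+ 2) in H5; last by ring.
    rewrite (_ : q2 ^+ 4 = (q2 ^+ 2) ^+ 2) in H5; last by ring.
    exact: (upper_absurd Q1 Q2 Z0 H1 H2 H3 H4 H5).
Qed.

(** As [v] is nonnegative and [z] is at most [M], the difference [z - v] is bounded above by [M]; a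
    small multiple of [(x - x0)^2 + t] therefore dominates it at the ends of a long enough interval,
    while costing at most [e] at [x0]. *)
Lemma lower_comparison f v (z zt z2 : R -> R -> R) (h M : R) :
  log_laplace_solution f v -> classical_on h z zt z2 ->
  (forall t x, 0 <= t <= h -> z t x <= M) ->
  (forall t x, 0 < t <= h -> zt t x <= 2^-1 * z2 t x - psi0 (z t x)) ->
  (forall x, z 0 x <= f x) ->
  forall t x, 0 <= t <= h -> z t x <= v t x.
Proof.
move=> vsol [zc zd] zM zsub zf t0 x0 t0h.
have [v_ge0 _ v0 _] := vsol.
have [vt [v2 [[vc vd] veq]]] := log_laplace_solution_classical h vsol.
have h0 : 0 <= h by case/andP: t0h => /le_trans; apply.
apply/ler_addgt0Pr => e e0.
pose k := e / (1 + h).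
have k0 : 0 < k by apply: divr_gt0; lra.
have kh : k * (1 + h) = e by rewrite /k divfK// gt_eqF//; lra.
pose L := (Num.max 0 M) / k + 1.
have M0 : 0 <= Num.max 0 M / k by rewrite divr_ge0 ?le_max ?lexx// ltW.
have L1 : 1 <= L by rewrite /L; lra.
have kL : M <= k * L ^+ 2.
  have : Num.max 0 M <= k * L.
    by rewrite /L mulrDr mulr1 mulrCA divff ?gt_eqF//; lra.
  have : M <= Num.max 0 M by rewrite le_max lexx orbT.
  have : 0 <= k * L * (L - 1) by apply: mulr_ge0; [apply: mulr_ge0|]; lra.
  rewrite expr2 mulrA mulrBr mulr1; lra.
pose a := x0 - L; pose b := x0 + L.
suff : z t0 x0 - v t0 x0 - (k * (x0 - x0) ^+ 2 + k * t0) <= 0.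
  rewrite subrr expr0n/= mulr0 add0r.
  have : k * t0 <= e by rewrite -kh; apply: ler_wpM2l; [exact: ltW|lra].
  by lra.
apply: (@parabolic_max R
  (fun t x => z t x - v t x - (k * (x - x0) ^+ 2 + k * t)) h a b) => //;
  last by rewrite /a /b; lra.
- apply: within_continuousB; first apply: within_continuousB.
  + exact: within_box zc.
  + exact: within_box vc.
  + apply: within_continuousD.
    * apply: (@within_snd (fun x => k * (x - x0) ^+ 2)) => y yI; eexists.
      by apply: derZ; apply: derX; apply: derB; [exact: der_id|exact: der_cst].
    * apply: continuous_subspaceT => -[t x].
      by apply: cvgM; [exact: cvg_cst|exact: cvg_fst].
- move=> x xI; have := zf x; rewrite v0 mulr0 addr0.
  have : 0 <= k * (x - x0) ^+ 2 by rewrite mulr_ge0 ?sqr_ge0// ltW.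
  by lra.
- move=> t tI; have kt : 0 <= k * t by rewrite mulr_ge0 ?(ltW k0)//; lra.
  split.
  + rewrite (_ : a - x0 = - L) ?sqrrN; last by rewrite /a; ring.
    have := zM t a tI; have := v_ge0 t a ltac:(lra); lra.
  + rewrite (_ : b - x0 = L); last by rewrite /b; ring.
    have := zM t b tI; have := v_ge0 t b ltac:(lra); lra.
- move=> t x tI xI Dpos.
  have [v1 Hv] := vd t tI; have [z1 Hz] := zd t tI.
  exists (zt t x - vt t x - k).
  exists (fun y => z1 y - v1 y - 2 * k * (y - x0)).
  exists (z2 t x - v2 t x - 2 * k).
  split.
  + have [Hv1 _ _] := Hv x; have [Hz1 _ _] := Hz x.
    apply: derB; first exact: derB.
    apply: der_eq; first by apply: derD; [exact: der_cst|apply: derZ; exact: der_id].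
    by ring.
  + move=> y yI; have [_ Hv1 _] := Hv y; have [_ Hz1 _] := Hz y.
    apply: derB; first exact: derB.
    apply: der_eq.
      apply: derD; last exact: der_cst.
      by apply: derZ; apply: derX; apply: derB; [exact: der_id|exact: der_cst].
    by rewrite /=; ring.
  + have [_ _ Hv1] := Hv x; have [_ _ Hz1] := Hz x.
    apply: derB; first exact: derB.
    apply: der_eq.
      by apply: derZ; apply: derB; [exact: der_id|exact: der_cst].
    by ring.
  + have := veq t x ltac:(lra); have := zsub t x tI.
    have := v_ge0 t x ltac:(lra); move: Dpos; rewrite /psi0.
    have : 0 <= k * (x - x0) ^+ 2 by rewrite mulr_ge0 ?sqr_ge0// ltW.
    have : 0 < k * t by rewrite mulr_gt0//; lra.
    set V := v t x; set Z := z t x; set V2 := v2 t x; set Z2 := z2 t x.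
    set VT := vt t x; set ZT := zt t x.
    move=> H0 H1 H2 H3 H4 H5 H6 H7.
    exact: (lower_absurd H0 H1 H2 H3 H4 H5 H6 H7).
Qed.

End comparison.

(** * Small-time behaviour of log-Laplace solutions *)

Section small_time.
Context {R : realType}.

(** The bound is the space-independent solution of [y' = - 2 y^2] started from [l]. It is below
    [1 / (2 t)] whatever [l] is, which later makes the mass at time [T] negligible. *)
Lemma log_laplace_solution_decay f v (l : R) : log_laplace_solution f v ->
  0 <= l -> (forall x, f x <= l) ->
  forall t x, 0 <= t -> v t x <= l / (1 + 2 * l * t).
Proof.
move=> vsol l0 fl t x t0.
have den s : 0 <= s -> 1 + 2 * l * s != 0.
  by move=> s0; rewrite gt_eqF// ltr_pwDl// !mulr_ge0.
have dz s : 0 <= s -> der (fun s => l / (1 + 2 * l * s)) s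
    (- 2 * (l / (1 + 2 * l * s)) ^+ 2).
  move=> s0; apply: der_eq.
    apply: derZ; apply: derV; first exact: den.
    by apply: derD; [exact: der_cst|apply: derZ; exact: der_id].
  by have := den _ s0 => ?; field.
apply: (@upper_comparison R f v (fun s _ => l / (1 + 2 * l * s))
  (fun s _ => - 2 * (l / (1 + 2 * l * s)) ^+ 2) (fun _ _ => 0) t) => //.
- split.
    apply: continuous_in_subspaceT => -[s y]; rewrite inE/= => s0.
    apply: (@continuous_comp _ _ _ fst (fun s => l / (1 + 2 * l * s))).
      exact: cvg_fst.
    exact: der_continuous (dz _ s0).
  move=> s /andP[s0 _]; exists (fun=> 0) => y; split.
  + exact: dz (ltW s0).
  + exact: der_cst.
  + exact: der_cst.
- move=> s _ /andP[s0 _]; rewrite divr_ge0// addr_ge0// !mulr_ge0//.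
- by move=> s _ _; rewrite /psi0 mulr0 sub0r mulNr.
- by move=> y; rewrite mulr0 addr0 divr1.
- by rewrite t0 lexx.
Qed.

Lemma log_laplace_solution_le f v (l : R) : log_laplace_solution f v ->
  0 <= l -> (forall x, f x <= l) -> forall t x, 0 <= t -> v t x <= l.
Proof.
move=> vsol l0 fl t x t0.
apply: le_trans (log_laplace_solution_decay vsol l0 fl x t0) _.
have p : 0 <= l * t by rewrite mulr_ge0.
rewrite ler_pdivrMr; last by lra.
by rewrite ler_peMr//; lra.
Qed.

Let affine_classical (w w1 w2 phi phi1 phi2 : R -> R) (c h : R) :
  (forall x, der w x (w1 x)) -> (forall x, der w1 x (w2 x)) ->
  (forall x, der phi x (phi1 x)) -> (forall x, der phi1 x (phi2 x)) ->
  classical_on h (fun t x => w x + t * (c - phi x)) (fun t x => c - phi x)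
    (fun t x => w2 x + t * (0 - phi2 x)).
Proof.
move=> dw dw1 dp dp1; split.
  apply: continuous_subspaceT => -[t x].
  have csnd k d : der k x d -> (fun p : R * R => k p.2) @ (t, x) --> k x.
    move=> /der_continuous ck.
    by apply: (@cvg_comp _ _ _ snd k); [exact: cvg_snd|exact: ck].
  apply: cvgD; first exact: csnd.
  apply: cvgM; first exact: cvg_fst.
  by apply: cvgB; [exact: cvg_cst|exact: csnd].
move=> t _; exists (fun x => w1 x + t * (0 - phi1 x)) => x; split.
- apply: der_eq.
    apply: derD; first exact: der_cst.
    by apply: derM; [exact: der_id|exact: der_cst].
  by rewrite mulr0 mulr1 !add0r.
- apply: derD; first exact: dw.
  by apply: derZ; apply: derB; [exact: der_cst|exact: dp].
- apply: derD; first exact: dw1.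
  by apply: derZ; apply: derB; [exact: der_cst|exact: dp1].
Qed.

(** At [t = 0] the left side is [- phi], leaving a slack of exactly [e]. The terms of order [t]
    consume at most [t (M/2 + 4 M^2)] of it, and the square of [t (e - phi)] has the favourable
    sign. *)
Let super_alg (w w2 phi phi2 M t e : R) :
  0 <= w <= M -> 0 <= phi <= M -> `|phi2| <= M -> 0 <= t -> 0 <= e ->
  t * (2^-1 * M + 4 * M ^+ 2) <= e -> phi = 2 * w ^+ 2 - 2^-1 * w2 ->
  2^-1 * (w2 + t * (0 - phi2)) - 2 * (w + t * (e - phi)) ^+ 2 <= e - phi.
Proof.
rewrite ler_norml => /andP[w0 wM] /andP[p0 pM] /andP[q1 q2] t0 e0 tM pe.
have -> : w2 = 2 * (2 * w ^+ 2 - phi) by lra.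
have H1 : 0 <= t * (M + phi2) by rewrite mulr_ge0//; lra.
have H2 : 0 <= t * w * e by rewrite !mulr_ge0.
have H3 : 0 <= (t * (e - phi)) ^+ 2 by rewrite sqr_ge0.
have H4 : t * (w * phi) <= t * (M * M).
  by rewrite ler_wpM2l//; apply: ler_pM.
move: tM; rewrite mulrDr; nra.
Qed.

(** The mirror of [super_alg]; here the square has the unfavourable sign, and [t <= 1] reduces
    [t^2 (e + M)^2] to order [t]. *)
Let sub_alg (w w2 phi phi2 M t e : R) :
  0 <= w <= M -> 0 <= phi <= M -> `|phi2| <= M -> 0 <= t <= 1 -> 0 <= e ->
  t * (2^-1 * M + 2 * (e + M) ^+ 2) <= e -> phi = 2 * w ^+ 2 - 2^-1 * w2 ->
  - e - phi <= 2^-1 * (w2 + t * (0 - phi2)) - 2 * (w + t * (- e - phi)) ^+ 2.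
Proof.
rewrite ler_norml => /andP[w0 wM] /andP[p0 pM] /andP[q1 q2] /andP[t0 t1] e0 tM pe.
have -> : w2 = 2 * (2 * w ^+ 2 - phi) by lra.
have H1 : 0 <= t * (M - phi2) by rewrite mulr_ge0//; lra.
have H2 : 0 <= t * w * e by rewrite !mulr_ge0.
have H4 : 0 <= t * w * phi by rewrite !mulr_ge0.
have H3 : t ^+ 2 * (e + phi) ^+ 2 <= t * (e + M) ^+ 2.
  apply: ler_pM; rewrite ?sqr_ge0//; first by nra.
  by rewrite ler_sqr ?nnegrE; lra.
move: tM; rewrite mulrDr.
have -> : (w + t * (- e - phi)) ^+ 2 = w ^+ 2 - 2 * (t * w * e) -
  2 * (t * w * phi) + t ^+ 2 * (e + phi) ^+ 2 by ring.
by nra.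
Qed.

(* First-order Taylor expansion in time, from the barriers
   [w - t phi +- e t]. *)
Lemma small_time_expansion (w w1 w2 phi phi1 phi2 : R -> R) (M C : R) :
  (forall x, der w x (w1 x)) -> (forall x, der w1 x (w2 x)) ->
  (forall x, der phi x (phi1 x)) -> (forall x, der phi1 x (phi2 x)) ->
  (forall x, 0 <= w x <= M) -> (forall x, 0 <= phi x <= M) ->
  (forall x, `|phi2 x| <= M) -> 0 <= C -> (forall x, phi x <= C * w x) ->
  (forall x, phi x = psi0 (w x) - 2^-1 * w2 x) ->
  forall e, 0 < e -> exists2 h0, 0 < h0 & forall v,
    log_laplace_solution w v -> forall h x, 0 <= h <= h0 ->
    `|v h x - (w x - h * phi x)| <= e * h.
Proof.
move=> dw dw1 dp dp1 wM pM p2M C0 pC pe e e0.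
have M0 : 0 <= M by have := wM 0; lra.
(* The first terms are the slacks of [super_alg] and [sub_alg]. The last one yields [t <= 1] and
   [t C <= 1]; the latter, with [phi <= C w], keeps the upper barrier [w + t (e - phi)] nonnegative,
   as [upper_comparison] demands. *)
pose K := 2^-1 * M + 4 * M ^+ 2 + 2 * (e + M) ^+ 2 + e * (1 + C).
have sM : 0 <= M ^+ 2 by exact: sqr_ge0.
have seM : 0 <= (e + M) ^+ 2 by exact: sqr_ge0.
have eC : 0 <= e * C by rewrite mulr_ge0// ltW.
have K0 : 0 < K by rewrite /K; lra.
pose h0 := e / K.
have h00 : 0 < h0 by rewrite divr_gt0.
have h0K : h0 * K = e by rewrite /h0 divfK// gt_eqF.
exists h0 => // v vsol h x hI.
have small t k : 0 <= t <= h -> 0 <= k <= K -> t * k <= e.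
  move=> tI kI; rewrite -h0K; apply: ler_pM; lra.
have t1 t : 0 <= t <= h -> t <= 1.
  move=> tI; have := small t e tI; rewrite /K => /(_ ltac:(lra)).
  by rewrite ger_pMl.
have tC t : 0 <= t <= h -> t * C <= 1.
  move=> tI; have := small t (C * e) tI; rewrite /K => /(_ ltac:(lra)).
  by rewrite mulrA ger_pMl.
have hh : 0 <= h <= h by lra.
have up : v h x <= w x + h * (e - phi x).
  apply: (upper_comparison vsol (affine_classical e h dw dw1 dp dp1)) => //.
  - move=> t y tI.
    have := tC t tI; have := pC y; have := wM y => w0 pCy tC1.
    have : t * phi y <= w y.
      apply: (@le_trans _ _ (t * (C * w y))); first by rewrite ler_wpM2l//; lra.
      by rewrite mulrA ler_piMl//; lra.
    have : 0 <= t * e by rewrite mulr_ge0//; lra.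
    by rewrite mulrBr; lra.
  - move=> t y tI; rewrite /psi0.
    apply: (super_alg (wM y) (pM y) (p2M y)); rewrite ?pe//; first by lra.
      by lra.
    by apply: small; rewrite /K; lra.
  - by move=> y; rewrite mul0r addr0.
have lo : w x + h * (- e - phi x) <= v h x.
  apply: (lower_comparison (M := M) vsol
    (affine_classical (- e) h dw dw1 dp dp1)) => //.
  - move=> t y tI; have := wM y; have := pM y => H1 H2.
    have : 0 <= t * (e + phi y) by rewrite mulr_ge0//; lra.
    by rewrite mulrDr mulrBr mulrN; lra.
  - move=> t y tI; rewrite /psi0.
    apply: (sub_alg (wM y) (pM y) (p2M y)); rewrite ?pe//.
    + by have := t1 t; lra.
    + by lra.
    + by apply: small; rewrite /K; lra.
  - by move=> y; rewrite mul0r addr0.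
rewrite ler_norml; move: up lo; rewrite !mulrBr mulrN [e * h]mulrC; lra.
Qed.

End small_time.

(** * Regularised singular solutions *)

Section smooth_bounded_functions.
Context {R : realType}.
Implicit Types f g : R -> R.

(** Stability under sums and products delivers a bound on the second derivative of [phi] without
    that derivative ever being written out. *)
Fixpoint smooth_bounded (n : nat) f : Prop :=
  (exists M, forall x, `|f x| <= M) /\
  if n is n'.+1 then
    exists2 f1, (forall x, der f x (f1 x)) & smooth_bounded n' f1
  else True.

Lemma smooth_bounded_bound n f : smooth_bounded n f ->
  exists M, forall x, `|f x| <= M.
Proof. by case: n => [|n] []. Qed.

Lemma smooth_boundedW n f : smooth_bounded n.+1 f -> smooth_bounded n f.
Proof.
elim: n f => [f []//|n IH f [Mf [f1 df f1S]]].
by split=> //; exists f1 => //; exact: IH.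
Qed.

Lemma smooth_bounded_cst n (c : R) : smooth_bounded n (fun=> c).
Proof.
elim: n c => [|n IH] c; split=> //; try by exists `|c|.
by exists (fun=> 0) => // x; exact: der_cst.
Qed.

Lemma smooth_boundedD n f g : smooth_bounded n f -> smooth_bounded n g ->
  smooth_bounded n (fun x => f x + g x).
Proof.
have bD F G : (exists M, forall x : R, `|F x| <= M) ->
    (exists M, forall x, `|G x| <= M) ->
    exists M, forall x : R, `|F x + G x| <= M :> R.
  move=> [M FM] [N GN]; exists (M + N) => x.
  by apply: le_trans (ler_normD _ _) _; exact: lerD.
elim: n f g => [|n IH] f g.
  by move=> [bf _] [bg _]; split=> //; exact: bD.
move=> [bf [f1 df f1S]] [bg [g1 dg g1S]]; split; first exact: bD.
by exists (fun x => f1 x + g1 x) => [x|]; [exact: derD|exact: IH].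
Qed.

Lemma smooth_boundedM n f g : smooth_bounded n f -> smooth_bounded n g ->
  smooth_bounded n (fun x => f x * g x).
Proof.
have bM F G : (exists M, forall x : R, `|F x| <= M) ->
    (exists M, forall x, `|G x| <= M) ->
    exists M, forall x : R, `|F x * G x| <= M :> R.
  move=> [M FM] [N GN]; exists (M * N) => x.
  by rewrite normrM; apply: ler_pM.
elim: n f g => [|n IH] f g.
  by move=> [bf _] [bg _]; split=> //; exact: bM.
move=> fS gS; have fS' := smooth_boundedW fS; have gS' := smooth_boundedW gS.
move: fS gS => [bf [f1 df f1S]] [bg [g1 dg g1S]]; split; first exact: bM.
exists (fun x => f x * g1 x + g x * f1 x) => [x|]; first exact: derM.
by apply: smooth_boundedD; exact: IH.
Qed.

End smooth_bounded_functions.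

Section singular_solutions.
Context {R : realType}.

(** The last clause ranges over every solution started from [w], with one [h0] for all of them,
    because the solution handed over by the Markov property is not otherwise identified. *)
Definition expandable (w phi : R -> R) : Prop :=
  [/\ continuous w, continuous phi,
      exists M, forall x, 0 <= w x <= M /\ 0 <= phi x <= M
    & forall e, 0 < e -> exists2 h0, 0 < h0 & forall v,
        log_laplace_solution w v -> forall h x, 0 <= h <= h0 ->
        `|v h x - (w x - h * phi x)| <= e * h].

(* [u = 3/2 kap^2 - c^2] is then a solution of [u''/2 = 2 u^2 - c^4/2] that
   blows up at 0. *)
Definition singular_riccati (c : R) (kap : R -> R) : Prop :=
  [/\ 0 <= c, forall x, 0 < x -> der kap x (c ^+ 2 - kap x ^+ 2),
      forall x, 0 < x -> c <= kap x & forall x, 0 < x -> x^-1 <= kap x].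

Variables (c : R) (kap : R -> R).
Hypothesis kapP : singular_riccati c kap.

(** The derivative [c^2 - kap^2] is nonpositive because [kap >= c >= 0]. *)
Lemma singular_riccati_nonincreasing x y : 0 < x -> x <= y -> kap y <= kap x.
Proof.
have [c0 dk ck _] := kapP.
move=> x0; rewrite le_eqVlt => /predU1P[->//|xy].
have [||z] := @MVT R kap (fun x => c ^+ 2 - kap x ^+ 2) x y xy.
- by move=> z; rewrite in_itv/= => /andP[xz _]; apply: dk; lra.
- apply: derivable_within_continuous => z.
  by rewrite in_itv/= => zI; have [] := dk z ltac:(lra).
rewrite in_itv/= => /andP[xz zy] kE.
rewrite -subr_le0 kE mulr_le0_ge0//; last by lra.
by rewrite subr_le0 ler_sqr ?nnegrE ?ck//; [lra|apply: le_trans (ck z _); lra].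
Qed.

Variables (y dl : R).
Hypothesis dl01 : 0 < dl <= 1.

(* [g] is the softplus function shifted up by [dl] and [1 - q] its derivative,
   so that [(kap \o g)' = (c^2 - (kap \o g)^2) (1 - q)]: everything below is a
   polynomial in [kap \o g] and [q]. *)
Let q (x : R) : R := (1 + expR ((x - y) / dl))^-1.
Let g (x : R) : R := dl + dl * ln (1 + expR ((x - y) / dl)).
Let p (x : R) : R := kap (g x).

Let dl0 : 0 < dl. Proof. by case/andP: dl01. Qed.

Let E_gt0 x : 0 < 1 + expR ((x - y) / dl).
Proof. by rewrite addr_gt0// expR_gt0. Qed.

Let q_gt0 x : 0 < q x. Proof. by rewrite invr_gt0. Qed.

Let q_lt1 x : q x < 1.
Proof. by rewrite invf_lt1// ltrDl expR_gt0. Qed.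

Let dE x : der (fun x => 1 + expR ((x - y) / dl)) x (expR ((x - y) / dl) / dl).
Proof.
apply: der_eq.
  apply: derD; first exact: der_cst.
  apply: (@der_comp R expR (fun x => (x - y) / dl)); first exact: is_derive_expR.
  by apply: derM; [apply: derB; [exact: der_id|exact: der_cst]|exact: der_cst].
by rewrite mulr0 subr0 mulr1 !add0r.
Qed.

Let dq x : der q x (- (q x * (1 - q x) * dl^-1)).
Proof.
have E0 := gt_eqF (E_gt0 x).
apply: der_eq; first by apply: derV; [rewrite E0|exact: dE].
have -> : q x = (1 + expR ((x - y) / dl))^-1 by [].
field; rewrite E0 andbT; exact: lt0r_neq0.
Qed.

Let dg x : der g x (1 - q x).
Proof.
have E0 := gt_eqF (E_gt0 x).
apply: der_eq.
  apply: derD; first exact: der_cst.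
  apply: derZ.
  apply: (@der_comp R (@ln R) (fun x => 1 + expR ((x - y) / dl))).
    exact: is_derive1_ln.
  exact: dE.
have -> : q x = (1 + expR ((x - y) / dl))^-1 by [].
field; rewrite E0 ?andbT/=; exact: lt0r_neq0.
Qed.

Let softplus_ge0 x : 0 <= ln (1 + expR ((x - y) / dl)).
Proof. by rewrite ln_ge0// lerDl expR_ge0. Qed.

Let g_ge_dl x : dl <= g x.
Proof. by rewrite /g lerDl mulr_ge0// ltW. Qed.

Let g_gt0 x : 0 < g x. Proof. exact: lt_le_trans (g_ge_dl x). Qed.

Let g_ge x : x - y <= g x.
Proof.
have : (x - y) / dl <= ln (1 + expR ((x - y) / dl)).
  by rewrite -{1}[(x - y) / dl]expRK ler_ln ?posrE ?expR_gt0// lerDr.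
rewrite ler_pdivrMr// mulrC => h; apply: (le_trans h).
by rewrite /g lerDr ltW.
Qed.

Let g_le_ge x : y <= x -> g x <= x - y + 2 * dl.
Proof.
move=> yx.
have : ln (1 + expR ((x - y) / dl)) <= (x - y) / dl + 1.
  rewrite -[leRHS]expRK ler_ln ?posrE ?expR_gt0// expRD.
  have : 1 <= expR ((x - y) / dl).
    by rewrite -expR0 ler_expR divr_ge0 ?subr_ge0// ltW.
  have : 2 <= expR 1 :> R by rewrite -[2]/(1 + 1); exact: expR_ge1Dx.
  by nra.
rewrite -(ler_pM2l dl0) mulrDr mulr1 mulrCA divff ?lt0r_neq0// mulr1.
by rewrite /g; lra.
Qed.

Let g_le_le x : x <= y -> g x <= 2 * dl.
Proof.
move=> xy.
have : ln (1 + expR ((x - y) / dl)) <= 1.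
  rewrite -[leRHS]expRK ler_ln ?posrE ?expR_gt0//.
  have : expR ((x - y) / dl) <= 1.
    by rewrite -expR0 ler_expR ler_pdivrMr// mul0r subr_le0.
  have : 2 <= expR 1 :> R by rewrite -[2]/(1 + 1); exact: expR_ge1Dx.
  by lra.
rewrite -(ler_pM2l dl0) mulr1 /g; lra.
Qed.

Let c0 : 0 <= c. Proof. by case: kapP. Qed.

Let p_ge x : c <= p x. Proof. by case: kapP => _ _ + _; exact. Qed.

Let p_geV x : (g x)^-1 <= p x. Proof. by case: kapP => _ _ _; exact. Qed.

Let dp x : der p x ((c ^+ 2 - p x ^+ 2) * (1 - q x)).
Proof.
apply: (@der_comp R kap g); last exact: dg.
by case: kapP => _ + _ _; exact.
Qed.

(** The shift by [dl] in [g] keeps the argument of [kap] at distance at least [dl] from the pole, so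
    [P] bounds [p] on the whole line. *)
Let P := kap dl.

Let p_le x : p x <= P.
Proof. exact: singular_riccati_nonincreasing. Qed.

Let smooth_q n : smooth_bounded n q.
Proof.
have bq : exists M, forall x, `|q x| <= M.
  by exists 1 => x; rewrite gtr0_norm// ltW.
elim: n => [|n IH]; split=> //.
exists (fun x => -1 * (q x * (1 + -1 * q x) * dl^-1)) => [x|].
  by apply: der_eq; [exact: dq|rewrite !mulN1r].
apply: smooth_boundedM; first exact: smooth_bounded_cst.
apply: smooth_boundedM; last exact: smooth_bounded_cst.
apply: smooth_boundedM => //.
apply: smooth_boundedD; first exact: smooth_bounded_cst.
by apply: smooth_boundedM => //; exact: smooth_bounded_cst.
Qed.

Let smooth_p n : smooth_bounded n p.
Proof.
have bp : exists M, forall x, `|p x| <= M.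
  exists P => x; rewrite ger0_norm//; exact: le_trans (p_ge x).
elim: n => [|n IH]; split=> //.
exists (fun x => (c ^+ 2 + -1 * (p x * p x)) * (1 + -1 * q x)) => [x|].
  by apply: der_eq; [exact: dp|rewrite !mulN1r expr2].
apply: smooth_boundedM; apply: smooth_boundedD; try exact: smooth_bounded_cst.
- apply: smooth_boundedM; first exact: smooth_bounded_cst.
  exact: smooth_boundedM.
- by apply: smooth_boundedM; [exact: smooth_bounded_cst|exact: smooth_q].
Qed.

Let w x := 3 / 2 * p x ^+ 2 - c ^+ 2.

(** This is [2 w^2 - w''/2] by the chain rule, with [U'' = 4 U^2 - c^4], [g' = 1 - q] and
    [g'' = q (1 - q) / dl]. Apart from the last, nonnegative term it is a convex combination of
    [2 w^2] and [mu = c^4 / 2], with weight [(1 - q)^2] on [mu]. *)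
Let phi x := 2 * w x ^+ 2 - (2 * w x ^+ 2 - c ^+ 4 / 2) * (1 - q x) ^+ 2 +
  3 / 2 * p x * (p x ^+ 2 - c ^+ 2) * (q x * (1 - q x)) / dl.

Let w1 x := 3 * p x * (c ^+ 2 - p x ^+ 2) * (1 - q x).

Let w2 x := (4 * w x ^+ 2 - c ^+ 4) * (1 - q x) ^+ 2 +
  3 * p x * (c ^+ 2 - p x ^+ 2) * (q x * (1 - q x)) / dl.

Let dw x : der w x (w1 x).
Proof.
apply: der_eq.
  by apply: derB; [apply: derZ; apply: derX; exact: dp|exact: der_cst].
by rewrite /w1 /=; field.
Qed.

Let dw1 x : der w1 x (w2 x).
Proof.
apply: der_eq.
  apply: derM.
    apply: derM; first by apply: derZ; exact: dp.
    by apply: derB; [exact: der_cst|apply: derX; exact: dp].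
  by apply: derB; [exact: der_cst|exact: dq].
by rewrite /w2 /w /=; field; exact: lt0r_neq0.
Qed.

Let phiE x : phi x = psi0 (w x) - 2^-1 * w2 x.
Proof. by rewrite /phi /psi0 /w2; field; exact: lt0r_neq0. Qed.

Let smooth_phi n : smooth_bounded n phi.
Proof.
have sc := @smooth_bounded_cst R n.
have sw : smooth_bounded n w.
  rewrite /w; have -> : (fun x => 3 / 2 * p x ^+ 2 - c ^+ 2) =
      (fun x => 3 / 2 * (p x * p x) + - c ^+ 2) by apply/funext => x; rewrite expr2.
  apply: smooth_boundedD => //; apply: smooth_boundedM => //.
  exact: smooth_boundedM.
have s1q : smooth_bounded n (fun x => 1 + -1 * q x).
  by apply: smooth_boundedD => //; exact: smooth_boundedM.
have -> : phi = (fun x => (2 * (w x * w x) + -1 * ((2 * (w x * w x) + - (c ^+ 4 / 2)) *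
    ((1 + -1 * q x) * (1 + -1 * q x)))) +
    3 / 2 * p x * (p x * p x + - c ^+ 2) * (q x * (1 + -1 * q x)) * dl^-1).
  by apply/funext => x; rewrite /phi !mulN1r !expr2.
by repeat (first [apply: sc | exact: s1q | exact: sw | exact: smooth_p
  | exact: smooth_q | apply: smooth_boundedD | apply: smooth_boundedM]).
Qed.

(** All three come from [p >= c]. The first gives [2 w^2 >= mu], the second makes [w] large near the
    pole, the third controls the last term of [phi] by a multiple of [w]. *)
Let w_ge x : c ^+ 2 / 2 <= w x /\ p x ^+ 2 / 2 <= w x /\
  3 / 2 * (p x ^+ 2 - c ^+ 2) <= w x.
Proof.
have : c ^+ 2 <= p x ^+ 2.
  by rewrite ler_sqr ?nnegrE// (le_trans c0).
by rewrite /w; have := sqr_ge0 c; lra.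
Qed.

Let p_ge0 x : 0 <= p x. Proof. exact: le_trans (p_ge x). Qed.

Let pc2 x : 0 <= p x ^+ 2 - c ^+ 2.
Proof. by rewrite subr_ge0 ler_sqr ?nnegrE. Qed.

Let w_ge0 x : 0 <= w x.
Proof. by have [h _] := w_ge x; apply: le_trans h; rewrite divr_ge0 ?sqr_ge0. Qed.

Let w2_ge x : c ^+ 4 / 2 <= 2 * w x ^+ 2.
Proof.
have [h _] := w_ge x.
have : (c ^+ 2 / 2) ^+ 2 <= w x ^+ 2.
  by rewrite ler_sqr ?nnegrE// divr_ge0 ?sqr_ge0.
rewrite (_ : (c ^+ 2 / 2) ^+ 2 = c ^+ 4 / 4); last by field.
by lra.
Qed.

Let r x := 3 / 2 * p x * (p x ^+ 2 - c ^+ 2) * (q x * (1 - q x)) / dl.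

Let r_ge0 x : 0 <= r x.
Proof.
rewrite /r; apply: divr_ge0; last exact: ltW.
apply: mulr_ge0; last by rewrite mulr_ge0 ?subr_ge0 ?ltW.
by rewrite !mulr_ge0//; lra.
Qed.

Let phi_ge x : c ^+ 4 / 2 <= phi x.
Proof.
rewrite /phi -/(r x); have := r_ge0 x; have := w2_ge x.
have := q_gt0 x; have := q_lt1 x; move: (q x) => Q Q1 Q0.
have : 0 <= (1 - Q) ^+ 2 <= 1 by rewrite sqr_ge0 expr_le1//; lra.
move: ((1 - Q) ^+ 2) (2 * w x ^+ 2) (c ^+ 4 / 2) (r x) => *; nra.
Qed.

(** The excess of [phi] over [mu] is proportional to [q], since [1 - (1 - q)^2 <= 2 q]; it
    disappears where [q / dl] is small. *)
Let phi_le x : phi x <= c ^+ 4 / 2 + 4 * w x ^+ 2 * q x +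
  3 / 2 * p x * (p x ^+ 2 - c ^+ 2) * (q x / dl).
Proof.
rewrite /phi; have := w2_ge x; have := q_gt0 x; have := q_lt1 x.
set A := 3 / 2 * p x * _; move=> q1 q0 H.
have A0 : 0 <= A by rewrite /A !mulr_ge0//; lra.
have H1 : A * (q x * (1 - q x)) / dl <= A * (q x / dl).
  have -> : A * (q x * (1 - q x)) / dl = A * (q x / dl) * (1 - q x) by ring.
  apply: ler_piMr; last lra.
  by rewrite mulr_ge0// divr_ge0// ltW.
have c4 : 0 <= c ^+ 4 by rewrite exprn_ge0.
have : (2 * w x ^+ 2 - c ^+ 4 / 2) * (1 - (1 - q x) ^+ 2) <=
    4 * w x ^+ 2 * q x.
  have D0 : 0 <= 2 * w x ^+ 2 - c ^+ 4 / 2 by rewrite subr_ge0.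
  apply: (@le_trans _ _ ((2 * w x ^+ 2 - c ^+ 4 / 2) * (2 * q x))).
    by apply: ler_wpM2l => //; have := sqr_ge0 (q x); lra.
  by rewrite mulrA; apply: ler_wpM2r; [exact: ltW|lra].
move: H1; rewrite mulrBr mulr1; lra.
Qed.

(** This is the bound of [phi] by a multiple of [w] required by [small_time_expansion]. The multiple
    may blow up with [dl], as the expansion is used at fixed [dl]. *)
Let phi_leC x : phi x <= (6 * P ^+ 2 + P / dl) * w x.
Proof.
have W2 : 2 * w x ^+ 2 <= 3 * P ^+ 2 * w x.
  have -> : 2 * w x ^+ 2 = 2 * w x * w x by rewrite expr2 mulrA.
  apply: ler_wpM2r => //.
  have : p x ^+ 2 <= P ^+ 2.
    by rewrite ler_sqr ?nnegrE// (le_trans (p_ge0 x)).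
  by rewrite /w; have := sqr_ge0 c; lra.
have : r x <= P / dl * w x.
  rewrite /r; have [_ [_ h]] := w_ge x.
  have -> : 3 / 2 * p x * (p x ^+ 2 - c ^+ 2) * (q x * (1 - q x)) / dl =
    (p x / dl) * (3 / 2 * (p x ^+ 2 - c ^+ 2) * (q x * (1 - q x))) by ring.
  apply: ler_pM.
  - by rewrite divr_ge0// ltW.
  - rewrite mulr_ge0//; first by rewrite mulr_ge0//; lra.
    by rewrite mulr_ge0 ?subr_ge0 ?ltW.
  - by apply: ler_wpM2r; [rewrite invr_ge0 ltW|exact: p_le].
  - apply: le_trans h; apply: ler_piMr; first by rewrite mulr_ge0//; lra.
    by have := q_gt0 x; have := q_lt1 x; move: (q x) => Q *; nra.
rewrite /phi -/(r x) mulrDl.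
have : 0 <= (2 * w x ^+ 2 - c ^+ 4 / 2) * (1 - q x) ^+ 2.
  by rewrite mulr_ge0 ?sqr_ge0// subr_ge0.
have : 0 <= P ^+ 2 * w x by rewrite mulr_ge0 ?sqr_ge0.
lra.
Qed.

Let expandable_w_phi : expandable w phi.
Proof.
have [M phiM] := smooth_bounded_bound (smooth_phi 2).
have phi0 x : 0 <= phi x.
  by apply: le_trans (phi_ge x); rewrite divr_ge0// exprn_ge0.
have [_ [phi1 dphi [_ [phi2 dphi1 [[M2 phi2M] _]]]]] := smooth_phi 2.
pose N := M + M2 + 3 / 2 * P ^+ 2.
have M0 : 0 <= M by apply: le_trans (phiM 0).
have M20 : 0 <= M2 by apply: le_trans (phi2M 0).
have P20 : 0 <= P ^+ 2 by exact: sqr_ge0.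
have P0 : 0 <= P by exact: le_trans (p_ge0 0) (p_le 0).
have wN x : 0 <= w x <= N.
  rewrite w_ge0/=; have : p x ^+ 2 <= P ^+ 2 by rewrite ler_sqr ?nnegrE.
  by rewrite /w /N; have := sqr_ge0 c; lra.
have phiN x : 0 <= phi x <= N.
  rewrite phi0/=; have := ler_norm (phi x); have := phiM x; rewrite /N; lra.
split.
- by move=> x; exact: der_continuous (dw x).
- by move=> x; exact: der_continuous (dphi x).
- by exists N.
- apply: (small_time_expansion dw dw1 dphi dphi1 wN phiN _ _ phi_leC phiE).
    by move=> x; have := phi2M x; rewrite /N; lra.
  by rewrite addr_ge0 ?mulr_ge0 ?invr_ge0// ltW.
Qed.

(** With [u = eta / dl], splitting [u] into halves gives [e^u >= (1 + u/2)^2 >= u^2 / 4]. Quadratic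
    decay of [q] in [dl] suffices: after division by [dl] a factor [dl] is left. *)
Let q_le eta x : 0 < eta -> y + eta <= x -> q x / dl <= 4 * dl / eta ^+ 2.
Proof.
move=> eta0 yx.
have e2 : 0 < eta ^+ 2 by rewrite exprn_gt0.
have H : (eta / dl) ^+ 2 / 4 <= 1 + expR ((x - y) / dl).
  have le : eta / dl <= (x - y) / dl.
    by apply: ler_wpM2r; [rewrite invr_ge0 ltW|lra].
  have ed0 : 0 <= eta / dl by rewrite divr_ge0// ltW.
  apply: (@le_trans _ _ (expR (eta / dl))); last first.
    by rewrite -[leLHS]add0r lerD// ler_expR.
  have -> : eta / dl = eta / dl / 2 + eta / dl / 2 by field; exact: lt0r_neq0.
  rewrite expRD; have := expR_ge1Dx (eta / dl / 2).
  move: (eta / dl) (expR _) ed0 => u E u0 uE; nra.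
have H' : 0 < (eta / dl) ^+ 2 / 4 by rewrite divr_gt0// exprn_gt0// divr_gt0.
have : q x <= ((eta / dl) ^+ 2 / 4)^-1 by rewrite /q lef_pV2 ?posrE.
rewrite -(ler_pM2r (_ : 0 < dl^-1)) ?invr_gt0// => h; apply: (le_trans h).
rewrite le_eqVlt; apply/orP; left; apply/eqP; field.
by rewrite !lt0r_neq0.
Qed.

(** The second and third bounds on [phi] serve the lower estimate, where mass left of [y] must be
    heavily penalised. The fourth serves the upper one: right of [y + eta], [w] is bounded
    independently of [dl] and [phi] exceeds [mu] by a multiple of [dl]. The last identifies the
    limit of [w] as [dl] tends to 0. *)
Lemma singular_test_functions : exists w phi, [/\ expandable w phi,
    forall x, c ^+ 4 / 2 <= phi x,
    forall x, x <= y -> (64 * dl)^-1 <= phi x,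
    forall eta x, 0 < eta -> y + eta <= x -> w x <= 3 / 2 * kap eta ^+ 2 /\
      phi x <= c ^+ 4 / 2 +
        (9 * kap eta ^+ 4 + 3 / 2 * kap eta ^+ 3) * (4 * dl / eta ^+ 2)
  & forall x, y < x -> 3 / 2 * kap (x - y + 2 * dl) ^+ 2 - c ^+ 2 <= w x <=
      3 / 2 * kap (x - y) ^+ 2 - c ^+ 2].
Proof.
exists w, phi; split.
- exact: expandable_w_phi.
- exact: phi_ge.
- move=> x xy.
  (* Left of [y], [g <= 2 dl] gives [p >= 1 / (2 dl)], so [w >= p^2 / 2 >= 1 / (8 dl)] as [dl <= 1].
     With [q >= 1/2] at least [3/2 w^2] survives in [phi], whence the constant 64. *)
  have q12 : 2^-1 <= q x.
    rewrite /q lef_pV2 ?posrE//.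
    have : expR ((x - y) / dl) <= 1.
      by rewrite -expR0 ler_expR ler_pdivrMr// mul0r subr_le0.
    by lra.
  have pdl : (2 * dl)^-1 <= p x.
    apply: le_trans (p_geV x); rewrite lef_pV2 ?posrE//; last exact: mulr_gt0.
    exact: g_le_le.
  have [_ [pw _]] := w_ge x.
  have i1 : 1 <= dl^-1 by rewrite invf_ge1//; case/andP: dl01.
  have iw : dl^-1 / 8 <= w x.
    apply: le_trans pw.
    have : (2 * dl)^-1 ^+ 2 <= p x ^+ 2.
      by rewrite ler_sqr ?nnegrE// invr_ge0 mulr_ge0// ltW.
    by rewrite invfM; nra.
  have : 3 / 2 * w x ^+ 2 <= phi x.
    rewrite /phi -/(r x); have := r_ge0 x; have := w2_ge x.
    have := q_lt1 x; move: (q x) q12 => Q Q1 Q0.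
    have : 0 <= (1 - Q) ^+ 2 <= 4^-1 by rewrite sqr_ge0/=; nra.
    have c4 : 0 <= c ^+ 4 by rewrite exprn_ge0.
    move: c4 (w x ^+ 2) (sqr_ge0 (w x)).
    by move: ((1 - Q) ^+ 2) (c ^+ 4) (r x) => E C r0 C0 W W0 *; nra.
  apply: le_trans; rewrite invfM; move: (dl^-1) i1 iw => D D1 Dw.
  have : (D / 8) ^+ 2 <= w x ^+ 2 by rewrite ler_sqr ?nnegrE//; lra.
  nra.
- move=> eta x eta0 yx.
  have pk : p x <= kap eta.
    apply: singular_riccati_nonincreasing => //.
    by apply: le_trans (g_ge x); lra.
  have k0 : 0 <= kap eta by exact: le_trans (p_ge0 x) pk.
  have wk : w x <= 3 / 2 * kap eta ^+ 2.
    have : p x ^+ 2 <= kap eta ^+ 2 by rewrite ler_sqr ?nnegrE.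
    by rewrite /w; have := sqr_ge0 c; lra.
  apply: (conj wk); apply: (le_trans (phi_le x)); rewrite -addrA lerD2l.
  have qe := q_le eta0 yx.
  have qd0 : 0 <= q x / dl by rewrite divr_ge0// ltW.
  apply: (@le_trans _ _ ((9 * kap eta ^+ 4 + 3 / 2 * kap eta ^+ 3) * (q x / dl))).
    rewrite [leRHS]mulrDl; apply: lerD.
      (* A factor [dl <= 1] is given away here, and [4 (3/2 kap^2)^2 = 9 kap^4] explains the
         coefficient 9. *)
      have -> : 4 * w x ^+ 2 * q x = 4 * w x ^+ 2 * dl * (q x / dl).
        by field; exact: lt0r_neq0.
      rewrite ler_wpM2r//.
      have : w x ^+ 2 <= (3 / 2 * kap eta ^+ 2) ^+ 2.
        by rewrite ler_sqr ?nnegrE// mulr_ge0 ?sqr_ge0//; lra.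
      have -> : (3 / 2 * kap eta ^+ 2) ^+ 2 = 9 / 4 * kap eta ^+ 4 by field.
      case/andP: dl01 => _ dl1; have := sqr_ge0 (w x).
      by move: (w x ^+ 2) (kap eta ^+ 4) => W K *; nra.
    rewrite ler_wpM2r//.
    apply: (@le_trans _ _ (3 / 2 * (p x * p x ^+ 2))).
      rewrite -mulrA; apply: ler_wpM2l; first lra.
      by apply: ler_wpM2l => //; rewrite gerBl sqr_ge0.
    apply: ler_wpM2l; first lra.
    by rewrite -exprS; apply: lerXn2r; rewrite ?nnegrE.
  apply: ler_wpM2l => //.
  by rewrite addr_ge0 ?mulr_ge0 ?exprn_ge0//; lra.
- move=> x yx; rewrite /w !lerD2r.
  have H1 : p x <= kap (x - y).
    by apply: singular_riccati_nonincreasing; [lra|exact: g_ge].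
  have H2 : kap (x - y + 2 * dl) <= p x.
    by apply: singular_riccati_nonincreasing => //; apply: g_le_ge; exact: ltW.
  have H3 : 0 <= kap (x - y + 2 * dl).
    apply: (le_trans c0); case: kapP => _ _ + _; apply; have := dl0; lra.
  apply/andP; split.
    by rewrite ler_pM2l; [rewrite ler_sqr ?nnegrE|lra].
  rewrite ler_pM2l; [rewrite ler_sqr ?nnegrE//|lra].
  exact: le_trans (p_ge0 x) H1.
Qed.

End singular_solutions.

(** * Pairings and expectations *)

Section pairing_theory.
Context {R : realType}.
Implicit Types (m : finmeas R) (f g : R -> R).

Definition bounded_measurable f : Prop :=
  measurable_fun [set: measurableTypeR R] (f : measurableTypeR R -> R) /\
  exists M, forall x, `|f x| <= M.

Lemma bounded_measurable_cst (c : R) : bounded_measurable (fun=> c).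
Proof. by split; [exact: measurable_cst|exists `|c|]. Qed.

Lemma continuous_bounded_measurable f : continuous f ->
  (exists M, forall x, `|f x| <= M) -> bounded_measurable f.
Proof. by move=> cf bf; split=> //; exact: continuous_measurable_fun. Qed.

Lemma bounded_measurableD f g : bounded_measurable f -> bounded_measurable g ->
  bounded_measurable (fun x => f x + g x).
Proof.
move=> [mf [M fM]] [mg [N gN]]; split; first exact: measurable_funD.
by exists (M + N) => x; apply: le_trans (ler_normD _ _) _; exact: lerD.
Qed.

Lemma bounded_measurableZ (c : R) f : bounded_measurable f ->
  bounded_measurable (fun x => c * f x).
Proof.
move=> [mf [M fM]]; split; first exact: measurable_funM.
by exists (`|c| * M) => x; rewrite normrM ler_wpM2l.
Qed.

Definition rpairing m f : R := fine (pairing m f).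

Lemma bounded_measurable_integrable m f : bounded_measurable f ->
  m.-integrable setT (EFin \o f).
Proof.
move=> [mf [M fM]]; apply: measurable_bounded_integrable => //.
  exact: fin_num_fun_lty (fin_num_measure m).
exists M; split; first exact: num_real.
by move=> N MN x _; exact: le_trans (fM x) (ltW MN).
Qed.

Lemma pairingE m f : bounded_measurable f -> pairing m f = (rpairing m f)%:E.
Proof.
move=> bf; rewrite /rpairing fineK//.
exact: integrable_fin_num (bounded_measurable_integrable m bf).
Qed.

Lemma rpairing_ge0 m f : (forall x, 0 <= f x) -> 0 <= rpairing m f.
Proof. by move=> f0; rewrite fine_ge0// integral_ge0// => x _; rewrite lee_fin. Qed.

Lemma rpairingD m f g : bounded_measurable f -> bounded_measurable g ->
  rpairing m (fun x => f x + g x) = rpairing m f + rpairing m g.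
Proof. by move=> bf bg; apply: RintegralD => //; exact: bounded_measurable_integrable. Qed.

Lemma rpairingZ m (c : R) f : bounded_measurable f ->
  rpairing m (fun x => c * f x) = c * rpairing m f.
Proof. by move=> bf; apply: RintegralZl => //; exact: bounded_measurable_integrable. Qed.

Lemma le_rpairing m f g : bounded_measurable f -> bounded_measurable g ->
  (forall x, f x <= g x) -> rpairing m f <= rpairing m g.
Proof.
by move=> bf bg fg; apply: le_Rintegral => //; exact: bounded_measurable_integrable.
Qed.

Lemma rpairing_cst m (c : R) : rpairing m (fun=> c) = c * rpairing m (fun=> 1).
Proof.
rewrite -(rpairingZ m c (bounded_measurable_cst 1)); congr rpairing.
by apply/funext => x; rewrite mulr1.
Qed.

Lemma rpairing_dist m f g (e : R) : bounded_measurable f -> bounded_measurable g ->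
  (forall x, `|f x - g x| <= e) ->
  `|rpairing m f - rpairing m g| <= e * rpairing m (fun=> 1).
Proof.
move=> bf bg fge; rewrite -rpairing_cst ler_norml.
have be := bounded_measurable_cst e.
have : rpairing m f <= rpairing m (fun x => g x + e).
  apply: le_rpairing => //; first exact: bounded_measurableD.
  by move=> x; have := fge x; rewrite ler_norml; lra.
have : rpairing m g <= rpairing m (fun x => f x + e).
  apply: le_rpairing => //; first exact: bounded_measurableD.
  by move=> x; have := fge x; rewrite ler_norml; lra.
rewrite !rpairingD//; lra.
Qed.

Lemma measurable_rpairing d (T : measurableType d) (m : T -> finmeas R) f :
  (forall B : set (measurableTypeR R), measurable B ->
    measurable_fun [set: T] (fun w => m w B)) ->
  bounded_measurable f -> (forall x, 0 <= f x) ->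
  measurable_fun [set: T] (fun w => rpairing (m w) f).
Proof.
move=> mm [mf _] f0; apply: measurableT_comp => //.
apply: (measurable_fun_integral_kernel mm) => [x|]; first by rewrite lee_fin.
exact/measurable_EFinP.
Qed.

Lemma rpairing_dirac m (r : {nonneg R}) (a : R) f : bounded_measurable f ->
  (forall B, measurable B ->
    m B = mscale r (@dirac _ (measurableTypeR R) a R) B) ->
  (forall x, 0 <= f x) -> rpairing m f = r%:num * f a.
Proof.
move=> [mf _] mE f0; rewrite /rpairing /pairing.
have mfE : measurable_fun [set: measurableTypeR R] (EFin \o f).
  exact/measurable_EFinP.
rewrite (@eq_measure_integral _ _ _ _
  (mscale r (@dirac _ (measurableTypeR R) a R))); last by move=> A mA _; exact: mE.
rewrite ge0_integral_mscale//; last by move=> x _; rewrite lee_fin.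
by rewrite integral_dirac// diracT mul1e.
Qed.

End pairing_theory.

(** * Expectations of variables with values in [0, 1] *)

Section expectation.
Context {R : realType} {d : measure_display} {Omega : measurableType d}.
Variable P : probability Omega R.
Implicit Types Y Z : Omega -> R.

(** All discount factors and indicators fall in this class. It is stable under products and
    dominated by the constant 1, so pointwise limits always pass through the expectation. *)
Definition unit_rv Y : Prop :=
  measurable_fun [set: Omega] Y /\ forall w, 0 <= Y w <= 1.

Definition E Y : R := Rintegral P [set: Omega] Y.

Lemma unit_rv_integrable Y : unit_rv Y -> P.-integrable setT (EFin \o Y).
Proof.
move=> [mY Y01]; apply: measurable_bounded_integrable => //.
  by rewrite (le_lt_trans (probability_le1 _ _))// ltry.
exists 1; split; first exact: num_real.
move=> N N1 w _; have /andP[Y0 Y1] := Y01 w.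
have Yn : `|Y w| <= 1 by rewrite ger0_norm.
exact: le_trans Yn (ltW N1).
Qed.

Lemma unit_rvM Y Z : unit_rv Y -> unit_rv Z -> unit_rv (fun w => Y w * Z w).
Proof.
move=> [mY Y01] [mZ Z01]; split; first exact: measurable_funM.
move=> w; have /andP[Y0 Y1] := Y01 w; have /andP[Z0 Z1] := Z01 w.
by rewrite mulr_ge0//= mulr_ile1.
Qed.

Lemma unit_rvC Y : unit_rv Y -> unit_rv (fun w => 1 - Y w).
Proof.
move=> [mY Y01]; split; first exact: measurable_funB.
by move=> w; have := Y01 w; lra.
Qed.

Lemma unit_rv_cst (c : R) : 0 <= c <= 1 -> unit_rv (fun=> c).
Proof. by move=> c01; split=> //; exact: measurable_cst. Qed.

Lemma unit_rv_expN Y : measurable_fun [set: Omega] Y -> (forall w, 0 <= Y w) ->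
  unit_rv (fun w => expR (- Y w)).
Proof.
move=> mY Y0; split.
  by apply: measurableT_comp => //; exact: measurableT_comp.
by move=> w; rewrite expR_ge0/= -expR0 ler_expR oppr_le0.
Qed.

Lemma unit_rv_indic (A : set Omega) : measurable A ->
  unit_rv (\1_A : Omega -> R).
Proof.
move=> mA; split; first exact: measurable_indic.
by move=> w; rewrite indicE; case: (_ \in _); rewrite /= ?lexx ?ler01.
Qed.

Lemma E_le Y Z : unit_rv Y -> unit_rv Z -> (forall w, Y w <= Z w) -> E Y <= E Z.
Proof. by move=> uY uZ YZ; apply: le_Rintegral => //; exact: unit_rv_integrable. Qed.

Lemma E_cst (c : R) : E (fun=> c) = c.
Proof. rewrite /E Rintegral_cst// (_ : fine _ = 1) ?mulr1//.
by have /= -> := @probability_setT _ _ _ P. Qed.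

Lemma E_B Y Z : unit_rv Y -> unit_rv Z ->
  E (fun w => Y w - Z w) = E Y - E Z.
Proof. by move=> uY uZ; apply: RintegralB => //; exact: unit_rv_integrable. Qed.

Lemma E_dist Y Z W : unit_rv Y -> unit_rv Z -> unit_rv W ->
  (forall w, `|Y w - Z w| <= W w) -> `|E Y - E Z| <= E W.
Proof.
move=> uY uZ uW YZW; rewrite -E_B//.
have iYZ : P.-integrable setT (EFin \o (fun w => Y w - Z w)).
  exact: (integrableB measurableT (unit_rv_integrable uY) (unit_rv_integrable uZ)).
apply: le_trans (le_normr_Rintegral measurableT iYZ) _.
apply: le_Rintegral => //; last exact: unit_rv_integrable.
exact: (integrable_norm iYZ).
Qed.

Lemma E_cvg (Y_ : nat -> Omega -> R) Y : (forall n, unit_rv (Y_ n)) ->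
  (forall w, Y_ n w @[n --> \oo] --> Y w) ->
  unit_rv Y /\ E (Y_ n) @[n --> \oo] --> E Y.
Proof.
move=> uY YY.
have mY : measurable_fun [set: Omega] Y.
  apply: (@measurable_fun_cvg _ _ _ _ Y_) => [n|w _]; first by case: (uY n).
  exact: YY.
have Y01 w : 0 <= Y w <= 1.
  apply/andP; split.
    rewrite -(cvg_lim _ (YY w))//; apply: limr_ge; first exact: cvgP (YY w).
    by apply: nearW => n; have [_ /(_ w)/andP[]] := uY n.
  rewrite -(cvg_lim _ (YY w))//; apply: limr_le; first exact: cvgP (YY w).
  by apply: nearW => n; have [_ /(_ w)/andP[]] := uY n.
split=> //.
have [|||||_ _ H] := @dominated_convergence _ _ _ P _ measurableT
    (fun n w => (Y_ n w)%:E) (fun w => (Y w)%:E) (cst 1%E).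
- by move=> n; apply/measurable_EFinP; case: (uY n).
- exact/measurable_EFinP.
- by apply: aeW => w _; apply: cvg_EFin; [exact: nearW|exact: YY].
- by have := unit_rv_integrable (@unit_rv_cst 1 _); apply; rewrite ler01 lexx.
- apply: aeW => w n _; have [_ /(_ w)/andP[Y0 Y1]] := uY n.
  by rewrite lee_fin ger0_norm.
have uYl : unit_rv Y by [].
have fY := integrable_fin_num measurableT (unit_rv_integrable uYl).
apply: fine_cvg; rewrite fineK//; exact: H.
Qed.

Lemma E_ae_eq Y Z : measurable_fun [set: Omega] Y ->
  measurable_fun [set: Omega] Z ->
  {ae P, forall w, Y w = Z w} -> E Y = E Z.
Proof.
move=> mY mZ YZ; rewrite /E /Rintegral; congr fine.
apply: ae_eq_integral => //; try exact/measurable_EFinP.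
by apply: filterS YZ => w /= ->.
Qed.

End expectation.

Section bounded_random_variables.
Context {R : realType} {d : measure_display} {Omega : measurableType d}.
Variable P : probability Omega R.
Implicit Types Y Z : Omega -> R.

Definition bounded_rv Y : Prop :=
  measurable_fun [set: Omega] Y /\ exists M, forall w, `|Y w| <= M.

Lemma unit_rv_bounded Y : unit_rv Y -> bounded_rv Y.
Proof.
by move=> [mY Y01]; split=> //; exists 1 => w; have /andP[? ?] := Y01 w;
  rewrite ger0_norm.
Qed.

Lemma bounded_rv_integrable Y : bounded_rv Y -> P.-integrable setT (EFin \o Y).
Proof.
move=> [mY [M YM]]; apply: measurable_bounded_integrable => //.
  by rewrite (le_lt_trans (probability_le1 _ _))// ltry.
exists M; split; first exact: num_real.
by move=> N MN x _; exact: le_trans (YM x) (ltW MN).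
Qed.

Lemma bounded_rvD Y Z : bounded_rv Y -> bounded_rv Z ->
  bounded_rv (fun w => Y w + Z w).
Proof.
move=> [mf [M fM]] [mg [N gN]]; split; first exact: measurable_funD.
by exists (M + N) => x; apply: le_trans (ler_normD _ _) _; exact: lerD.
Qed.

Lemma bounded_rvZ (c : R) Y : bounded_rv Y -> bounded_rv (fun w => c * Y w).
Proof.
move=> [mf [M fM]]; split; first exact: measurable_funM.
by exists (`|c| * M) => x; rewrite normrM ler_wpM2l.
Qed.

Lemma bounded_rv0 : bounded_rv (fun=> 0 : R).
Proof. by split; [exact: measurable_cst|exists 0 => w; rewrite normr0]. Qed.

Lemma bounded_rv_sum n (Y_ : nat -> Omega -> R) :
  (forall i, bounded_rv (Y_ i)) ->
  bounded_rv (fun w => \sum_(i < n) Y_ i w).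
Proof.
move=> bY; elim: n => [|n IH].
  by under eq_fun do rewrite big_ord0; exact: bounded_rv0.
under eq_fun do rewrite big_ord_recr/=.
exact: bounded_rvD.
Qed.

Lemma E_D Y Z : bounded_rv Y -> bounded_rv Z ->
  E P (fun w => Y w + Z w) = E P Y + E P Z.
Proof. by move=> bY bZ; apply: RintegralD => //; exact: bounded_rv_integrable. Qed.

Lemma E_Z (c : R) Y : bounded_rv Y -> E P (fun w => c * Y w) = c * E P Y.
Proof. by move=> bY; apply: RintegralZl => //; exact: bounded_rv_integrable. Qed.

Lemma E_sum n (Y_ : nat -> Omega -> R) : (forall i, bounded_rv (Y_ i)) ->
  E P (fun w => \sum_(i < n) Y_ i w) = \sum_(i < n) E P (Y_ i).
Proof.
move=> bY; elim: n => [|n IH].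
  by under eq_fun do rewrite big_ord0; rewrite big_ord0 E_cst.
under eq_fun do rewrite big_ord_recr/=.
by rewrite E_D// ?IH ?big_ord_recr//; exact: bounded_rv_sum.
Qed.

(** For [x <= n] the sum is the integer part of [x]. The induction has to treat [x >= n] separately,
    since there the sum is saturated at [n]. *)
Lemma count_le_dist (n : nat) (x : R) : 0 <= x <= n%:R ->
  `|x - \sum_(i < n) (i.+1%:R <= x)%R%:R| <= 1.
Proof.
move=> /andP[x0 xn].
suff [H1 H2] : (n%:R <= x -> \sum_(i < n) (i.+1%:R <= x)%R%:R = n%:R :> R) /\
    (x < n%:R -> x - 1 <= \sum_(i < n) (i.+1%:R <= x)%R%:R <= x).
  rewrite ler_norml; have [nx|nx] := leP n%:R x.
    by rewrite H1//; lra.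
  by have := H2 nx; lra.
elim: n {xn} => [|n [IH1 IH2]]; first by rewrite big_ord0; split=> //; lra.
rewrite big_ord_recr/= -natr1; split=> H.
  by rewrite H IH1//; lra.
have [nx|xn] := leP n%:R x.
  by rewrite IH1//; case: (leP (n%:R + 1) x) => /=; lra.
by have := IH2 xn; case: (leP (n%:R + 1) x) => /=; lra.
Qed.

(* [Z] is within [1/n] of [n^-1 \sum_(i < n) 1_(Z >= i.+1/n)]; this extends the
   Markov property from events to [0, 1]-valued variables. *)
Lemma E_eq_layers Y1 Y2 Z : unit_rv Y1 -> unit_rv Y2 -> unit_rv Z ->
  (forall c, E P (fun w => \1_[set w | c <= Z w] w * Y1 w) =
             E P (fun w => \1_[set w | c <= Z w] w * Y2 w)) ->
  E P (fun w => Z w * Y1 w) = E P (fun w => Z w * Y2 w).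
Proof.
move=> uY1 uY2 uZ ZY.
have mZ c : measurable [set w | c <= Z w].
  have := (proj1 uZ) measurableT `[c, +oo[%classic (measurable_itv _).
  rewrite setTI; congr (measurable _); apply/seteqP.
  by split=> w /=; rewrite in_itv/= andbT.
pose S n Y := n.+1%:R^-1 *
  \sum_(i < n.+1) E P (fun w => \1_[set w | i.+1%:R / n.+1%:R <= Z w] w * Y w).
have approx n Y : unit_rv Y ->
    `|E P (fun w => Z w * Y w) - S n Y| <= n.+1%:R^-1.
  move=> uY.
  have n0 : 0 < n.+1%:R :> R by rewrite ltr0n.
  have bI i : bounded_rv
      (fun w => \1_[set w | i.+1%:R / n.+1%:R <= Z w] w * Y w).
    exact/unit_rv_bounded/unit_rvM/uY/unit_rv_indic.
  rewrite /S -(E_sum _ bI) -E_Z; last exact: (bounded_rv_sum _ bI).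
  have bZY : bounded_rv (fun w => Z w * Y w) by exact/unit_rv_bounded/unit_rvM.
  set W := (fun w => n.+1%:R^-1 * _).
  have bW : bounded_rv W by exact: bounded_rvZ (bounded_rv_sum _ bI).
  have bD : bounded_rv (fun w => Z w * Y w + -1 * W w).
    by apply: bounded_rvD => //; exact: bounded_rvZ.
  have -> : E P (fun w => Z w * Y w) - E P W =
      E P (fun w => Z w * Y w + -1 * W w).
    by rewrite (E_D bZY (bounded_rvZ (-1) bW)) (E_Z (-1) bW) mulN1r.
  apply: le_trans (le_normr_Rintegral measurableT (bounded_rv_integrable bD)) _.
  rewrite -[leRHS](@E_cst _ _ _ P); apply: le_Rintegral => //.
  - exact: (integrable_norm (bounded_rv_integrable bD)).
  - apply: bounded_rv_integrable; split; first exact: measurable_cst.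
    by exists n.+1%:R^-1 => w; rewrite ger0_norm// invr_ge0 ltW.
  move=> w _; rewrite mulN1r /W.
  have -> : \sum_(i < n.+1) \1_[set w | i.+1%:R / n.+1%:R <= Z w] w * Y w =
      (\sum_(i < n.+1) (i.+1%:R <= n.+1%:R * Z w)%R%:R) * Y w.
    rewrite mulr_suml; apply: eq_bigr => i _; congr (_ * _).
    rewrite indicE; congr ((nat_of_bool _)%:R); apply/idP/idP.
      by rewrite inE/= ler_pdivrMr// mulrC.
    by rewrite mulrC -ler_pdivrMr// => h; rewrite inE.
  have -> : Z w * Y w - n.+1%:R^-1 *
      ((\sum_(i < n.+1) (i.+1%:R <= n.+1%:R * Z w)%R%:R) * Y w) =
      n.+1%:R^-1 * (Y w * (n.+1%:R * Z w -
       \sum_(i < n.+1) (i.+1%:R <= n.+1%:R * Z w)%R%:R)).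
    by field; rewrite lt0r_neq0.
  rewrite normrM ger0_norm ?invr_ge0 ?(ltW n0)// ger_pMr ?invr_gt0//.
  have [_ /(_ w)/andP[Y0 Y1w]] := uY; have [_ /(_ w)/andP[Z0 Z1]] := uZ.
  rewrite normrM; apply: mulr_ile1 => //; first by rewrite ger0_norm.
  by apply: count_le_dist; rewrite mulr_ge0 ?(ltW n0)//= ger_pMr.
apply/eqP; rewrite -subr_eq0 -normr_eq0 eq_le normr_ge0 andbT.
apply/ler_addgt0Pr => e e0; rewrite add0r.
have [n _ en] : \forall n \near \oo, n.+1%:R^-1 < e / 2 :> R.
  have e2 : 0 < e / 2 by rewrite divr_gt0.
  exact: (near_infty_natSinv_lt (PosNum e2)).
have SS : S n Y1 = S n Y2 by rewrite /S; congr (_ * _); apply: eq_bigr => i _.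
have tri (a b s k : R) : k < e / 2 -> `|a - s| <= k -> `|b - s| <= k ->
    `|a - b| <= e.
  by rewrite !ler_norml; lra.
apply: (tri _ _ (S n Y2) _ (en n (leqnn n))); last exact: approx.
by rewrite -SS; exact: approx.
Qed.

End bounded_random_variables.

(** * Discrete Feynman-Kac formula *)

Section markov.
Context {R : realType} {d : measure_display} {Omega : measurableType d}.
Variables (P : probability Omega R) (r : {nonneg R}) (a : R).
Variable X : R -> Omega -> finmeas R.
Hypothesis sbmX : is_sbm P (mscale r (@dirac _ (measurableTypeR R) a R)) X.

Implicit Types (f g : R -> R) (v : R -> R -> R) (M : R).

Let generators (t : R) : set_system Omega := \bigcup_(u in `[0, t])
  \bigcup_(B in measurable)
    preimage_set_system [set: Omega] (fun w => X u w B) measurable.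

(** Making the past a measurable type of its own turns adaptedness into plain measurability, so
    sums, products and compositions of adapted variables need no separate theory. *)
Let past (t : R) := g_sigma_algebraType (generators t).

Definition adapted (t : R) (Z : Omega -> R) : Prop :=
  measurable_fun [set: past t] (Z : past t -> R).

Lemma measurable_rpairing_X (t : R) f : 0 <= t -> bounded_measurable f ->
  (forall x, 0 <= f x) ->
  measurable_fun [set: Omega] (fun w => rpairing (X t w) f).
Proof.
by move=> t0; apply: measurable_rpairing => B mB; exact: (sbm_measurable sbmX t0 mB).
Qed.

Lemma adapted_rpairing_X (t u : R) f : 0 <= u <= t -> bounded_measurable f ->
  (forall x, 0 <= f x) -> adapted t (fun w => rpairing (X u w) f).
Proof.
move=> ut; apply: (@measurable_rpairing _ _ (past t) (X u)) => B mB.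
move=> _ C mC; apply: sub_sigma_algebra; exists u; first by rewrite /= in_itv.
by exists B => //; exists C.
Qed.

Let bounded_itv f M : (forall x, 0 <= f x <= M) ->
  exists M, forall x : R, `|f x| <= M :> R.
Proof. by move=> fM; exists M => x; have /andP[f0 f1] := fM x; rewrite ger0_norm. Qed.

Lemma log_laplace_solution_bounds f v M : log_laplace_solution f v ->
  continuous f -> (forall x, 0 <= f x <= M) -> forall t : R, 0 <= t ->
  [/\ continuous (v t), bounded_measurable (v t) & forall x, 0 <= v t x <= M].
Proof.
move=> vsol cf fM t t0; have [v0 _ vf vd] := vsol.
have M0 : 0 <= M by have := fM 0; lra.
have vM x : 0 <= v t x <= M.
  rewrite v0//=; apply: (log_laplace_solution_le vsol) => // y.
  by have /andP[] := fM y.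
have cv : continuous (v t).
  move: t0; rewrite le_eqVlt => /predU1P[<-|t0].
    by have -> : v 0 = f by apply/funext.
  move=> x; have [_ dv _ _] := vd t x t0.
  by apply: differentiable_continuous; exact/derivable1_diffP.
by split=> //; apply: continuous_bounded_measurable => //; exact: bounded_itv vM.
Qed.

(** The event form of the Markov property is applied to the level sets of [Z], which lie in the past
    because [Z] is adapted; [E_eq_layers] then recovers [Z]. The solution [v] is chosen before [s],
    [t] and [Z], so a single [v] serves all steps of a partition. *)
Lemma markov_E f M : continuous f -> (forall x, 0 <= f x <= M) ->
  exists2 v, log_laplace_solution f v & forall (s t : R) Z, 0 <= s -> 0 <= t ->
    adapted t Z -> unit_rv Z ->
    E P (fun w => Z w * expR (- rpairing (X (t + s) w) f)) =
    E P (fun w => Z w * expR (- rpairing (X t w) (v s))).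
Proof.
move=> cf fM.
have bf : bounded_measurable f.
  by apply: continuous_bounded_measurable => //; exact: bounded_itv fM.
have f0 x : 0 <= f x by case/andP: (fM x).
have [|v vsol vmarkov] := sbm_markov sbmX (f := f) _ f0.
  split=> //; have [N fN] := bounded_itv fM.
  exists N; split; first exact: num_real.
  by move=> K NK x _; exact: le_trans (fN x) (ltW NK).
exists v; first exact: vsol.
move=> s t Z s0 t0 aZ uZ.
have [cv bv vM] := log_laplace_solution_bounds vsol cf fM s0.
have v0 x : 0 <= v s x by case/andP: (vM x).
have ts0 : 0 <= t + s by exact: addr_ge0.
apply: E_eq_layers.
- apply: unit_rv_expN; first exact: measurable_rpairing_X.
  by move=> w; exact: rpairing_ge0.
- apply: unit_rv_expN; first exact: measurable_rpairing_X.
  by move=> w; exact: rpairing_ge0.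
- exact: uZ.
move=> c.
pose A := [set w | c <= Z w].
have Ac : natural_filtration X t A.
  have := aZ measurableT `[c, +oo[%classic (measurable_itv _).
  rewrite setTI; congr (_ _); apply/seteqP.
  by split=> w /=; rewrite in_itv/= andbT.
have := vmarkov s t _ s0 t0 Ac.
have toE g (u : R) : bounded_measurable g ->
    fine (\int[P]_(w in A) expeR (- pairing (X u w) g))%E =
    E P (fun w => \1_A w * expR (- rpairing (X u w) g)).
  move=> bg; rewrite /E /Rintegral; congr fine; rewrite [LHS]integral_mkcond.
  apply: eq_integral => w _; rewrite patchE indicE.
  case: ifPn => wA; last by rewrite mul0r.
  by rewrite mul1r pairingE.
by move=> /(congr1 fine); rewrite !toE.
Qed.

Lemma rpairing_X0 f M : continuous f -> (forall x, 0 <= f x <= M) ->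
  E P (fun w => expR (- rpairing (X 0 w) f)) = expR (- (r%:num * f a)).
Proof.
move=> cf fM.
have bf : bounded_measurable f.
  by apply: continuous_bounded_measurable => //; exact: bounded_itv fM.
have f0 x : 0 <= f x by case/andP: (fM x).
rewrite -[RHS](E_cst P); apply: E_ae_eq.
- by case: (unit_rv_expN (measurable_rpairing_X (lexx 0) bf f0)
    (fun w => rpairing_ge0 (X 0 w) f0)).
- exact: measurable_cst.
apply: filterS (sbm_start sbmX) => w wE.
by rewrite (rpairing_dirac bf wE f0).
Qed.

Lemma laplace_X f M : continuous f -> (forall x, 0 <= f x <= M) ->
  exists2 v, log_laplace_solution f v & forall t : R, 0 <= t ->
    E P (fun w => expR (- rpairing (X t w) f)) = expR (- (r%:num * v t a)).
Proof.
move=> cf fM; have [v vsol vm] := markov_E cf fM.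
exists v; first exact: vsol.
move=> t t0.
have [cv bv vM] := log_laplace_solution_bounds vsol cf fM t0.
have u1 : unit_rv (fun _ : Omega => 1 : R) by apply: unit_rv_cst; rewrite ler01 lexx.
have := vm t 0 (fun=> 1) t0 (lexx 0) (measurable_cst _) u1.
rewrite add0r; under eq_fun do rewrite mul1r.
under [in RHS]eq_fun do rewrite mul1r.
move=> ->; exact: (rpairing_X0 cv vM).
Qed.

Definition mass (t : R) (w : Omega) : R := rpairing (X t w) (fun=> 1).

Lemma mass_ge0 t w : 0 <= mass t w. Proof. exact: rpairing_ge0. Qed.

Lemma measurable_mass t : 0 <= t -> measurable_fun [set: Omega] (mass t).
Proof. by move=> t0; apply: measurable_rpairing_X => //; exact: bounded_measurable_cst. Qed.

Lemma unit_rv_exp_mass (l t : R) : 0 <= l -> 0 <= t ->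
  unit_rv (fun w => expR (- (l * mass t w))).
Proof.
move=> l0 t0; apply: unit_rv_expN.
  by apply: measurable_funM => //; exact: measurable_mass.
by move=> w; rewrite mulr_ge0// mass_ge0.
Qed.

Lemma E_exp_mass (l t : R) : 0 <= l -> 0 <= t ->
  expR (- (r%:num * (l / (1 + 2 * l * t)))) <=
  E P (fun w => expR (- (l * mass t w))).
Proof.
move=> l0 t0.
have cl : continuous (fun _ : R => l) by move=> x; exact: cvg_cst.
have lM (x : R) : 0 <= l <= l by rewrite l0 lexx.
have [v vsol vE] := laplace_X cl lM.
have := vE t t0; rewrite /mass; under eq_fun do rewrite rpairing_cst.
move=> ->; rewrite ler_expR lerN2 ler_wpM2l//.
exact: (log_laplace_solution_decay vsol l0).
Qed.

Lemma E_exp_massC (l t : R) : 0 <= l -> 0 <= t ->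
  E P (fun w => 1 - expR (- (l * mass t w))) <=
  r%:num * (l / (1 + 2 * l * t)).
Proof.
move=> l0 t0; rewrite E_B; last 2 first.
- exact: unit_rv_cst (introT andP (conj ler01 (lexx 1))).
- exact: unit_rv_exp_mass.
rewrite E_cst; have := E_exp_mass l0 t0.
have := expR_ge1Dx (- (r%:num * (l / (1 + 2 * l * t)))).
lra.
Qed.

(** Uniformity in [t] allows this bound to be paid once per step of the partition. *)
Lemma E_exp_massC_linear (l t : R) : 0 <= l -> 0 <= t ->
  E P (fun w => 1 - expR (- (l * mass t w))) <= r%:num * l.
Proof.
move=> l0 t0; apply: le_trans (E_exp_massC l0 t0) _; rewrite ler_wpM2l//.
have p : 0 <= l * t by rewrite mulr_ge0.
rewrite ler_pdivrMr; last by lra.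
by rewrite ler_peMr//; lra.
Qed.

(** Uniformity in [l] is the point: even a heavily weighted mass is negligible at large times. This
    expresses extinction. *)
Lemma E_exp_massC_decay (l t : R) : 0 <= l -> 0 < t ->
  E P (fun w => 1 - expR (- (l * mass t w))) <= r%:num / (2 * t).
Proof.
move=> l0 t0; apply: le_trans (E_exp_massC l0 (ltW t0)) _; rewrite ler_wpM2l//.
have p : 0 <= l * t by rewrite mulr_ge0// ltW.
have t20 : 0 < 2 * t by rewrite mulr_gt0.
rewrite ler_pdivrMr; last by lra.
rewrite -(ler_pM2l t20) mulrA divff ?lt0r_neq0//; lra.
Qed.

Lemma expN_dist (x y : R) : 0 <= x -> 0 <= y ->
  `|expR (- x) - expR (- y)| <= 1 - expR (- `|x - y|).
Proof.
wlog xy : x y / x <= y.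
  move=> H x0 y0; have [xy|/ltW yx] := leP x y; first exact: H.
  by rewrite distrC [`|x - y|]distrC; exact: H.
move=> x0 y0.
have e1 : expR (- y) <= expR (- x) by rewrite ler_expR lerN2.
have d1 : expR (- (y - x)) <= 1 by rewrite -expR0 ler_expR; lra.
rewrite ger0_norm ?subr_ge0// [`|x - y|]distrC ger0_norm ?subr_ge0//.
have -> : expR (- y) = expR (- x) * expR (- (y - x)).
  by rewrite -expRD; congr expR; lra.
have -> : expR (- x) - expR (- x) * expR (- (y - x)) =
  expR (- x) * (1 - expR (- (y - x))) by ring.
apply: ler_piMl; first by rewrite subr_ge0.
by rewrite -expR0 ler_expR; lra.
Qed.

Let sum_rpairing (phi : R -> R) (h : R) (k : nat) (w : Omega) : R :=
  \sum_(j < k) rpairing (X (h * j%:R) w) phi.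

Lemma sum_rpairing_ge0 phi h k w : (forall x, 0 <= phi x) ->
  0 <= sum_rpairing phi h k w.
Proof. by move=> phi0; apply: sumr_ge0 => j _; exact: rpairing_ge0. Qed.

Lemma adapted_sum_rpairing phi h k t : 0 <= h -> bounded_measurable phi ->
  (forall x, 0 <= phi x) -> (forall j, (j < k)%N -> h * j%:R <= t) ->
  adapted t (sum_rpairing phi h k).
Proof.
move=> h0 bphi phi0 ht; apply: measurable_sum => j.
by apply: adapted_rpairing_X => //; rewrite mulr_ge0//= ht.
Qed.

Lemma measurable_sum_rpairing phi h k : 0 <= h -> bounded_measurable phi ->
  (forall x, 0 <= phi x) -> measurable_fun [set: Omega] (sum_rpairing phi h k).
Proof.
move=> h0 bphi phi0; apply: measurable_sum => j.
by apply: measurable_rpairing_X => //; rewrite mulr_ge0.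
Qed.

Lemma unit_rv_exp_sum_rpairing phi h k : 0 <= h -> bounded_measurable phi ->
  (forall x, 0 <= phi x) ->
  unit_rv (fun w => expR (- (h * sum_rpairing phi h k w))).
Proof.
move=> h0 bphi phi0; apply: unit_rv_expN.
  by apply: measurable_funM => //; exact: measurable_sum_rpairing.
by move=> w; rewrite mulr_ge0// sum_rpairing_ge0.
Qed.

(* Since [|e^-p - e^-q| <= 1 - e^-|p - q|], the error made in one step is
   controlled by the Laplace transform of the total mass; no moments are
   needed. *)
Lemma discrete_step (w phi : R -> R) v M (h e : R)
    (A : nat -> R) (k : nat) :
  continuous w -> continuous phi ->
  (forall x, 0 <= w x <= M /\ 0 <= phi x <= M) ->
  log_laplace_solution w v ->
  (forall (s t : R) Z, 0 <= s -> 0 <= t -> adapted t Z -> unit_rv Z ->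
    E P (fun o => Z o * expR (- rpairing (X (t + s) o) w)) =
    E P (fun o => Z o * expR (- rpairing (X t o) (v s)))) ->
  0 < h -> 0 < e ->
  (forall x, `|v h x - (w x - h * phi x)| <= e * h) ->
  (forall k, A k = E P (fun o => expR (- (h * sum_rpairing phi h k o)) *
    expR (- rpairing (X (h * k%:R) o) w))) ->
  `|A k.+1 - A k| <= r%:num * (e * h).
Proof.
move=> cw cphi wphiM vsol vm h0 e0 vh AE.
have wM x : 0 <= w x <= M by case: (wphiM x).
have phiM x : 0 <= phi x <= M by case: (wphiM x).
have phi0 x : 0 <= phi x by case/andP: (phiM x).
have bw : bounded_measurable w.
  by apply: continuous_bounded_measurable => //; exact: bounded_itv wM.
have bphi : bounded_measurable phi.
  by apply: continuous_bounded_measurable => //; exact: bounded_itv phiM.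
have [cv bv vM] := log_laplace_solution_bounds vsol cw wM (ltW h0).
have w0 x : 0 <= w x by case/andP: (wM x).
have v0 x : 0 <= v h x by case/andP: (vM x).
have hk0 j : 0 <= h * j%:R by rewrite mulr_ge0// ltW.
have uX j f : bounded_measurable f -> (forall x, 0 <= f x) ->
    unit_rv (fun o => expR (- rpairing (X (h * j%:R) o) f)).
  move=> bf f0; apply: unit_rv_expN; first exact: measurable_rpairing_X.
  by move=> o; exact: rpairing_ge0.
have uS j := unit_rv_exp_sum_rpairing j (ltW h0) bphi phi0.
(* The first [k.+1] left endpoints end with time [h * k], so the weight is adapted at that time, and
   the Markov property over one step of length [h] replaces [w] by [v h]. *)
have -> : A k.+1 = E P (fun o => expR (- (h * sum_rpairing phi h k.+1 o)) *
    expR (- rpairing (X (h * k%:R) o) (v h))).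
  rewrite AE -natr1 mulrDr mulr1; apply: vm => //; first exact: ltW.
  apply: measurableT_comp => //; apply: measurableT_comp => //.
  apply: measurable_funM => //; apply: adapted_sum_rpairing => //; first exact: ltW.
  by move=> j jk; rewrite ler_wpM2l ?(ltW h0)// ler_nat.
rewrite AE; apply: le_trans (E_exp_massC_linear (mulr_ge0 (ltW e0) (ltW h0)) (hk0 k)).
apply: E_dist.
- by apply: unit_rvM; [exact: uS|exact: uX].
- by apply: unit_rvM; [exact: uS|exact: uX].
- by apply: unit_rvC; apply: unit_rv_exp_mass; rewrite ?mulr_ge0// ltW.
move=> o; rewrite /sum_rpairing big_ord_recr/= -/(sum_rpairing phi h k o) mulrDr opprD expRD.
rewrite -mulrA -mulrBr normrM ger0_norm ?expR_ge0//.
have S1 : expR (- (h * sum_rpairing phi h k o)) <= 1 by have [_ /(_ o)/andP[]] := uS k.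
apply: (@le_trans _ _ (1 - expR (- `|(h * rpairing (X (h * k%:R) o) phi +
    rpairing (X (h * k%:R) o) (v h)) - rpairing (X (h * k%:R) o) w|))).
  rewrite -expRD -opprD; apply: le_trans (expN_dist _ _).
  - by rewrite ler_piMl.
  - by rewrite addr_ge0 ?rpairing_ge0// mulr_ge0 ?rpairing_ge0// ltW.
  - exact: rpairing_ge0.
rewrite lerD2l lerN2 ler_expR lerN2.
have bhphi := bounded_measurableZ h bphi.
rewrite -rpairingZ// -rpairingD//; apply: rpairing_dist => //; first exact: bounded_measurableD.
move=> x; have := vh x; congr (_ <= _); congr (`|_|); ring.
Qed.

(** Telescoping: the quantity at index 0 is the deterministic limit, and [n.+1] steps of length
    [T / n.+1] with error proportional to the length cost an amount proportional to [T], with an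
    arbitrarily small factor. *)
Lemma discrete_log_laplace (w phi : R -> R) (T : R) :
  expandable w phi -> 0 < T ->
  E P (fun o => expR (- (T / n.+1%:R * \sum_(j < n.+1)
      rpairing (X (T / n.+1%:R * j%:R) o) phi)) * expR (- rpairing (X T o) w))
    @[n --> \oo] --> expR (- (r%:num * w a)).
Proof.
move=> [cw cphi [M wphiM] wphi] T0.
have wM x : 0 <= w x <= M by case: (wphiM x).
have [v vsol vm] := markov_E cw wM.
apply/cvgrPdist_le => e e0.
(* The total error is [r T] times this precision; [r + 1] replaces [r] because [r] may be 0 here. *)
have re0 : 0 < e / ((r%:num + 1) * T) by rewrite divr_gt0// mulr_gt0// ltr_wpDl.
have [h0 h00 vh] := wphi _ re0.
have [N _ HN] : \forall n \near \oo, n.+1%:R^-1 < h0 / T :> R.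
  have hT : 0 < h0 / T by rewrite divr_gt0.
  exact: (near_infty_natSinv_lt (PosNum hT)).
exists N => // n /HN /= nh.
have n0 : 0 < n.+1%:R :> R by rewrite ltr0n.
pose h := T / n.+1%:R.
have hpos : 0 < h by rewrite divr_gt0.
have hh0 : h <= h0 by move: nh; rewrite ltr_pdivlMr// mulrC => /ltW.
have [A AE] : exists A : nat -> R, forall k, A k =
    E P (fun o => expR (- (h * sum_rpairing phi h k o)) *
      expR (- rpairing (X (h * k%:R) o) w)) by eexists => k; reflexivity.
have step k : `|A k.+1 - A k| <= r%:num * (e / ((r%:num + 1) * T) * h).
  apply: (discrete_step k cw cphi wphiM vsol vm hpos re0 _ AE) => x.
  by apply: vh => //; rewrite (ltW hpos).
have total k : `|A k - A 0%N| <= k%:R * (r%:num * (e / ((r%:num + 1) * T) * h)).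
  elim: k => [|k IH]; first by rewrite subrr normr0 mul0r.
  have -> : A k.+1 - A 0%N = (A k.+1 - A k) + (A k - A 0%N) by ring.
  by apply: le_trans (ler_normD _ _) _; rewrite -natr1 mulrDl mul1r addrC lerD.
have A0 : A 0%N = expR (- (r%:num * w a)).
  rewrite -(rpairing_X0 cw wM) AE; congr (E P _); apply/funext => o.
  by rewrite /sum_rpairing big_ord0 !mulr0 oppr0 expR0 mul1r.
have hn : h * n.+1%:R = T by rewrite /h divfK// lt0r_neq0.
have An : A n.+1 = E P (fun o => expR (- (T / n.+1%:R * \sum_(j < n.+1)
      rpairing (X (T / n.+1%:R * j%:R) o) phi)) * expR (- rpairing (X T o) w)).
  by rewrite AE hn.
rewrite -An -A0 distrC; apply: le_trans (total n.+1) _.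
have -> : n.+1%:R * (r%:num * (e / ((r%:num + 1) * T) * h)) =
   (r%:num / (r%:num + 1)) * e * ((h * n.+1%:R) / T).
  by field; rewrite !lt0r_neq0//= ltr_wpDl.
rewrite hn divff ?lt0r_neq0// mulr1 ler_piMl ?(ltW e0)//.
by rewrite ler_pdivrMr ?mul1r ?lerDl// ltr_wpDl.
Qed.

End markov.

(** * Time integrals of cadlag paths *)

Section riemann_sums.
Context {R : realType}.
Implicit Types (G : R -> R) (T : R).

Definition cadlag G : Prop :=
  (forall t : R, 0 <= t -> G s @[s --> t^'+] --> G t) /\
  (forall t : R, 0 < t -> exists l : R, G s @[s --> t^'-] --> l).

(** One-sided limits make [G] bounded near each point of the segment, and compactness extracts a
    common bound. *)
Lemma cadlag_bounded G T : cadlag G ->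
  exists M, forall t : R, 0 <= t <= T -> `|G t| <= M.
Proof.
move=> [Gr Gl].
suff cover (x : R) : `[0, T]%classic x ->
    \forall x' \near x & M \near +oo, 0 <= x' -> `|G x'| <= M.
  have /compact_near_coveringP/(_ R (pinfty_nbhs R)
    (fun M x => 0 <= x -> `|G x| <= M) _ cover) := @segment_compact R 0 T.
  move=> [N [_ HN]]; exists (N + 1) => t tT.
  apply: (HN (N + 1)); first by rewrite ltrDl.
    by rewrite /= in_itv.
  by case/andP: tT.
rewrite /= in_itv/= => /andP[x0 xT].
  have [K [K0 [e e0 He]]] : exists K : R, 0 <= K /\ exists2 e : R, 0 < e &
      forall y, `|x - y| < e -> 0 <= y -> `|G y| <= K.
    have /cvgrPdist_lt/(_ 1 ltr01)/nbhs_ballP[e1 /= e10 H1] := Gr _ x0.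
    have near1 y : `|x - y| < e1 -> x <= y -> `|G y| <= `|G x| + 1.
      move=> xy; rewrite le_eqVlt => /predU1P[<-|xy']; first by lra.
      have := H1 y xy xy'; rewrite distrC => h.
      have -> : G y = G x + (G y - G x) by ring.
      by apply: le_trans (ler_normD _ _) _; rewrite lerD2l ltW.
    move: x0; rewrite le_eqVlt => /predU1P[x0|x0].
      exists (`|G x| + 1); split; first by have := normr_ge0 (G x); lra.
      by exists e1 => // y xy y0; apply: near1 => //; rewrite -x0.
    have [l /cvgrPdist_lt/(_ 1 ltr01)/nbhs_ballP[e2 /= e20 H2]] := Gl _ x0.
    exists (`|G x| + `|l| + 1); split.
      by have := normr_ge0 (G x); have := normr_ge0 l; lra.
    exists (Num.min e1 e2); first by rewrite lt_min e10.
    move=> y; rewrite lt_min => /andP[xy1 xy2] y0.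
    have [xy|yx] := leP x y.
      by have := near1 y xy1 xy; have := normr_ge0 l; lra.
    have := H2 y xy2 yx; rewrite distrC => h.
    have : `|G y| <= `|l| + `|G y - l|.
      by rewrite (le_trans _ (ler_normD _ _))// addrC subrK.
    by have := normr_ge0 (G x); lra.
  exists ([set y | `|x - y| < e], [set M | K <= M]) => /=.
    split; first by apply/nbhs_ballP; exists e.
    by exists K; split; [exact: num_real|move=> M /= /ltW].
  move=> [y M] [/= yx KM] y0; exact: le_trans (He y yx y0) KM.
Qed.

(** Cells carry the value at their right endpoint: the sampling time lies strictly after [t] and
    tends to [t], so right continuity gives convergence at every [t]. Left endpoints would only see
    [G] before a jump. *)
Let step G T (n : nat) (t : R) : R :=
  \sum_(j < n.+1) G (T / n.+1%:R * j.+1%:R) *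
    \1_(`[T / n.+1%:R * j%:R, T / n.+1%:R * j.+1%:R[%classic) t.

Let step_eval G T n t : 0 <= t < T -> exists s : R,
  [/\ t < s <= t + T / n.+1%:R, s <= T & step G T n t = G s].
Proof.
move=> /andP[t0 tT]; have T0 : 0 < T by exact: le_lt_trans tT.
have n0 : 0 < n.+1%:R :> R by rewrite ltr0n.
set h := T / n.+1%:R; have h0 : 0 < h by rewrite divr_gt0.
have hn : h * n.+1%:R = T by rewrite /h divfK// lt0r_neq0.
have th0 : 0 <= t / h by rewrite divr_ge0// ltW.
have := Num.Theory.truncn_itv th0; set k := Num.Def.trunc _ => /andP[k1 k2].
have hk1 : h * k%:R <= t by rewrite mulrC -ler_pdivlMr.
have hk2 : t < h * k.+1%:R by rewrite mulrC -ltr_pdivrMr.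
have kn : (k < n.+1)%N.
  by rewrite -(ltr_nat R) -(ltr_pM2l h0) hn (le_lt_trans hk1).
exists (h * k.+1%:R); split.
- by rewrite hk2/= -natr1 mulrDr mulr1 lerD2r.
- by rewrite -hn ler_pM2l// ler_nat.
rewrite /step -/h (bigD1 (Ordinal kn))//= big1 ?addr0.
  by rewrite indicE mem_set ?mulr1//= in_itv/= hk1.
move=> j; rewrite -val_eqE/= => jk; rewrite indicE memNset ?mulr0//=.
rewrite in_itv/= => /andP[j1 j2]; move/eqP: jk; apply.
have : (j < k.+1)%N by rewrite -(ltr_nat R) -(ltr_pM2l h0) (le_lt_trans j1).
have : (k < j.+1)%N by rewrite -(ltr_nat R) -(ltr_pM2l h0) (le_lt_trans hk1).
by rewrite !ltnS => kj jk; apply/eqP; rewrite eqn_leq jk.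
Qed.

Let measurable_step G T n : measurable_fun [set: measurableTypeR R]
  (step G T n : measurableTypeR R -> R).
Proof.
by apply: measurable_sum => j; apply: measurable_funM.
Qed.

Let step_cvg G T t : cadlag G -> 0 <= t < T ->
  step G T n t @[n --> \oo] --> G t.
Proof.
move=> [Gr _] tT; have /andP[t0 tT'] := tT.
have T0 : 0 < T by exact: le_lt_trans tT'.
apply/cvgrPdist_lt => e e0.
have /cvgrPdist_lt/(_ e e0)/nbhs_ballP[e1 /= e10 H1] := Gr _ t0.
have eT : 0 < e1 / T by rewrite divr_gt0.
have [N _ HN] := near_infty_natSinv_lt (PosNum eT).
exists N => // n /HN /= nh.
have [s [/andP[ts st] _ ->]] := step_eval G n tT.
apply: H1 => //.
rewrite /ball/= distrC gtr0_norm ?subr_gt0// ltrBlDl (le_lt_trans st)// ltrD2l.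
by rewrite mulrC -ltr_pdivlMr.
Qed.

Lemma measurable_cadlag G T : cadlag G ->
  measurable_fun (`[0, T[%classic : set (measurableTypeR R))
    (G : measurableTypeR R -> R).
Proof.
move=> cG; apply: (@measurable_fun_cvg _ _ _ _ (step G T)).
  by move=> n; apply: measurable_funTS; exact: measurable_step.
by move=> t /=; rewrite in_itv/= => tT; exact: step_cvg.
Qed.

Definition time_integral G T : R :=
  \int[lebesgue_measure]_(t in `[0, T[) G t.

Let integral_step G T n : 0 < T -> (forall t : R, 0 <= G t) ->
  (\int[lebesgue_measure]_(t in `[0%R, T[) (step G T n t)%:E)%E =
  (T / n.+1%:R * \sum_(j < n.+1) G (T / n.+1%:R * j.+1%:R))%:E.
Proof.
move=> T0 G0.
have n0 : 0 < n.+1%:R :> R by rewrite ltr0n.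
set h := T / n.+1%:R; have h0 : 0 < h by rewrite divr_gt0.
have hn : h * n.+1%:R = T by rewrite /h divfK// lt0r_neq0.
under eq_integral do rewrite /step -/h -sumEFin.
rewrite ge0_integral_sum//=; last 2 first.
- by move=> j; apply/measurable_EFinP; apply: measurable_funM.
- by move=> j t _; rewrite lee_fin mulr_ge0.
rewrite mulr_sumr -sumEFin; apply: eq_bigr => j _.
under eq_integral do rewrite EFinM.
rewrite ge0_integralZl_EFin//=; last first.
  by apply/measurable_EFinP; apply: measurable_indic; exact: measurable_itv.
rewrite integral_indic//= setIidl.
  rewrite lebesgue_measure_itv/= lte_fin ltr_pM2l// ltr_nat ltnSn -EFinB.
  by rewrite -EFinM -natr1; congr EFin; ring.
move=> t /=; rewrite !in_itv/= => /andP[t1 t2].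
apply/andP; split; first by apply: le_trans t1; rewrite mulr_ge0// ltW.
by apply: (lt_le_trans t2); rewrite -hn ler_pM2l// ler_nat.
Qed.

Lemma cadlag_integrable G T : cadlag G ->
  lebesgue_measure.-integrable `[0, T[ (EFin \o G).
Proof.
move=> cG; have [M GM] := cadlag_bounded T cG.
apply: measurable_bounded_integrable => //.
- rewrite /= lebesgue_measure_itv/=; case: ifP => _; last by [].
  by rewrite -EFinB ltry.
- exact: measurable_cadlag.
exists M; split; first exact: num_real.
move=> N MN t /=; rewrite in_itv/= => /andP[t0 tT].
by apply: le_trans (GM t _) (ltW MN); rewrite t0 ltW.
Qed.

Lemma right_riemann_sum_cvg G T :
  cadlag G -> 0 < T -> (forall t : R, 0 <= G t) ->
  T / n.+1%:R * (\sum_(j < n.+1) G (T / n.+1%:R * j.+1%:R)) @[n --> \oo]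
    --> time_integral G T.
Proof.
move=> cG T0 G0; have [M GM] := cadlag_bounded T cG.
have mD : measurable (`[0, T[%classic : set (measurableTypeR R)).
  exact: measurable_itv.
have [|||||_ _ H] := @dominated_convergence _ _ _
    (@lebesgue_measure R) _ mD
    (fun n t => (step G T n t)%:E) (fun t => (G t)%:E) (cst M%:E).
- by move=> n; apply/measurable_EFinP; apply: measurable_funTS; exact: measurable_step.
- by apply/measurable_EFinP; exact: measurable_cadlag.
- apply: aeW => t /=; rewrite in_itv/= => tT.
  by apply: cvg_EFin; [exact: nearW|exact: step_cvg].
- apply: measurable_bounded_integrable => //.
    rewrite /= lebesgue_measure_itv/=; case: ifP => _; last by [].
    by rewrite -EFinB ltry.
  exists `|M|; split; first exact: num_real.
  by move=> N MN t _; exact: ltW.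
- apply: aeW => t n /=; rewrite in_itv/= => tT.
  have [s [ts sT ->]] := step_eval G n tT.
  by rewrite lee_fin GM//; lra.
have fG := integrable_fin_num mD (cadlag_integrable T cG).
have -> : (fun n => T / n.+1%:R * (\sum_(j < n.+1) G (T / n.+1%:R * j.+1%:R))) =
    (fun n => fine (\int[lebesgue_measure]_(t in `[0%R, T[) (step G T n t)%:E)%E).
  by apply/funext => n; rewrite integral_step.
by rewrite /time_integral /Rintegral; apply: fine_cvg; rewrite fineK//; exact: H.
Qed.

(** The Markov property produces left endpoints. Left and right sums differ only by their extreme
    terms, that is by [T (G 0 - G T) / n.+1]. *)
Lemma left_riemann_sum_cvg G T :
  cadlag G -> 0 < T -> (forall t : R, 0 <= G t) ->
  T / n.+1%:R * (\sum_(j < n.+1) G (T / n.+1%:R * j%:R)) @[n --> \oo]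
    --> time_integral G T.
Proof.
move=> cG T0 G0.
have -> : (fun n => T / n.+1%:R * (\sum_(j < n.+1) G (T / n.+1%:R * j%:R))) =
    (fun n => T / n.+1%:R * (\sum_(j < n.+1) G (T / n.+1%:R * j.+1%:R)) +
      T * (G 0 - G T) * n.+1%:R^-1).
  apply/funext => n; rewrite big_ord_recl big_ord_recr/= !mulr0.
  rewrite (_ : T / n.+1%:R * n.+1%:R = T) ?divfK ?pnatr_eq0//.
  under eq_bigr do rewrite /bump /= add1n.
  by ring.
rewrite -[X in _ --> X]addr0; apply: cvgD; first exact: right_riemann_sum_cvg.
rewrite -[X in _ --> X](mulr0 (T * (G 0 - G T))).
by apply: cvgM; [exact: cvg_cst|exact: cvg_harmonic].
Qed.

End riemann_sums.

(** * Detecting mass to the left of a point *)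

Section cutoff.
Context {R : realType}.
Implicit Types (m : finmeas R) (z : R).

(** A continuous stand-in for the indicator of the open half-line left of [z]: it is positive
    exactly there, and its pairings with the process are cadlag in time, as weak convergence is
    tested on continuous functions. *)
Definition cutoff z (x : R) : R := Num.min 1 (Num.max 0 (z - x)).

Lemma cutoff01 z x : 0 <= cutoff z x <= 1.
Proof. by rewrite /cutoff le_min ler01 le_max lexx/= ge_min lexx. Qed.

Lemma cutoff_eq0 z x : z <= x -> cutoff z x = 0.
Proof. by move=> zx; rewrite /cutoff max_l ?subr_le0// min_r. Qed.

Lemma cutoff_gt0 z x : x < z -> 0 < cutoff z x.
Proof. by move=> xz; rewrite /cutoff lt_min ltr01 lt_max subr_gt0 xz orbT. Qed.

Lemma continuous_cutoff z : continuous (cutoff z).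
Proof.
move=> x; apply: (@continuous_min _ _ (fun=> 1) (fun x => Num.max 0 (z - x))).
  exact: cvg_cst.
apply: (@continuous_max _ _ (fun=> 0) (fun x => z - x)); first exact: cvg_cst.
by apply: cvgB; [exact: cvg_cst|exact: cvg_id].
Qed.

Lemma bounded_measurable_cutoff z : bounded_measurable (cutoff z).
Proof.
apply: continuous_bounded_measurable; first exact: continuous_cutoff.
by exists 1 => x; have /andP[c0 c1] := cutoff01 z x; rewrite ger0_norm.
Qed.

Let mz z : measurable (`]-oo, z[%classic : set (measurableTypeR R)).
Proof. exact: measurable_itv. Qed.

Lemma le_rpairing_on m z (f g : R -> R) : (m `]-oo, z[%classic = 0)%E ->
  bounded_measurable f -> bounded_measurable g ->
  (forall x, z <= x -> f x <= g x) -> rpairing m f <= rpairing m g.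
Proof.
move=> m0 bf bg fg.
have off h : bounded_measurable h ->
    rpairing m h = \int[m]_(x in setT `\` `]-oo, z[%classic) h x.
  move=> bh; rewrite /rpairing /pairing /Rintegral; congr fine.
  exact: negligible_integral (mz z) measurableT (bounded_measurable_integrable m bh) m0.
have mD : measurable (setT `\` (`]-oo, z[%classic : set (measurableTypeR R))).
  exact: measurableD.
rewrite !off//; apply: le_Rintegral => //.
- by apply: (integrableS measurableT) => //; exact: bounded_measurable_integrable.
- by apply: (integrableS measurableT) => //; exact: bounded_measurable_integrable.
by move=> x [_ /= xz]; apply: fg; move: xz; rewrite in_itv/= => /negP; rewrite -leNgt.
Qed.

Lemma rpairing_cutoff_eq0 m z :
  (rpairing m (cutoff z) = 0) <-> (m `]-oo, z[%classic = 0)%E.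
Proof.
have bc := bounded_measurable_cutoff z.
split=> [c0|m0].
  have mc : measurable_fun [set: measurableTypeR R] (EFin \o cutoff z).
    by apply/measurable_EFinP; case: bc.
  have : (\int[m]_x `|(cutoff z x)%:E| = 0)%E.
    rewrite -[RHS]/(0%:E) -c0 -pairingE//; apply: eq_integral => x _.
    by rewrite gee0_abs// lee_fin; case/andP: (cutoff01 z x).
  move=> /(ae_eq_integral_abs m measurableT mc)[A [mA A0 sA]].
  apply: (@subset_measure0 _ _ _ m _ A) => //.
  move=> x /=; rewrite in_itv/= => xz; apply: sA => /= /(_ Logic.I) [] c.
  by have := cutoff_gt0 xz; rewrite c ltxx.
apply/eqP; rewrite eq_le rpairing_ge0 ?andbT; last first.
  by move=> x; case/andP: (cutoff01 z x).
have -> : 0 = rpairing m (fun=> 0) by rewrite rpairing_cst mul0r.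
apply: (le_rpairing_on m0) => //; first exact: bounded_measurable_cst.
by move=> x zx; rewrite cutoff_eq0.
Qed.

End cutoff.

(** * Integrals along the paths of the process *)

Section path_integrals.
Context {R : realType} {d : measure_display} {Omega : measurableType d}.
Variables (P : probability Omega R) (r : {nonneg R}) (a : R).
Variable X : R -> Omega -> finmeas R.
Hypothesis sbmX : is_sbm P (mscale r (@dirac _ (measurableTypeR R) a R)) X.

Definition unit_continuous (f : R -> R) : Prop :=
  continuous f /\ forall x, 0 <= f x <= 1.

Lemma unit_continuous_cst1 : unit_continuous (fun=> 1).
Proof. by split=> [x|x]; [exact: cvg_cst|rewrite ler01 lexx]. Qed.

Lemma unit_continuous_cutoff z : unit_continuous (cutoff z).
Proof. by split; [exact: continuous_cutoff|exact: cutoff01]. Qed.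

Lemma unit_continuous_bounded f : unit_continuous f -> bounded_measurable f.
Proof.
move=> [cf f01]; apply: continuous_bounded_measurable => //.
by exists 1 => x; have /andP[? ?] := f01 x; rewrite ger0_norm.
Qed.

Lemma unit_continuous_ge0 f : unit_continuous f -> forall x, 0 <= f x.
Proof. by move=> [_ f01] x; case/andP: (f01 x). Qed.

Lemma cadlag_rpairing f w : unit_continuous f ->
  cadlag (fun t => rpairing (X t w) f).
Proof.
move=> uf; have bf := unit_continuous_bounded uf.
have bcf : bounded_continuous f.
  split; first by case: uf.
  exists 1; split; first exact: num_real.
  move=> N N1 x _; case: uf => _ /(_ x) /andP[f0 f1].
  have fx : `|f x| <= 1 by rewrite ger0_norm.
  exact: le_trans fx (ltW N1).
split=> [t t0|t t0].
  have := @sbm_rcont _ _ _ _ _ _ sbmX w t t0 f bcf; rewrite [X in _ --> X -> _]pairingE//.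
  exact: fine_cvg.
have [l /(_ f bcf)] := @sbm_llim _ _ _ _ _ _ sbmX w t t0.
rewrite [X in _ --> X -> _]pairingE// => lf.
by exists (rpairing l f); exact: fine_cvg.
Qed.

Definition path_integral (f : R -> R) (T : R) (w : Omega) : R :=
  time_integral (fun t => rpairing (X t w) f) T.

Lemma path_integral_ge0 f T w : unit_continuous f -> 0 <= path_integral f T w.
Proof.
by move=> uf; apply: Rintegral_ge0 => t _; apply: rpairing_ge0; exact: unit_continuous_ge0.
Qed.

Lemma path_riemann_cvg f T w : unit_continuous f -> 0 < T ->
  T / n.+1%:R * (\sum_(j < n.+1) rpairing (X (T / n.+1%:R * j%:R) w) f)
    @[n --> \oo] --> path_integral f T w.
Proof.
move=> uf T0; apply: left_riemann_sum_cvg => //; first exact: cadlag_rpairing.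
by move=> t; apply: rpairing_ge0; exact: unit_continuous_ge0.
Qed.

Lemma measurable_path_integral f T : unit_continuous f -> 0 < T ->
  measurable_fun [set: Omega] (path_integral f T).
Proof.
move=> uf T0; apply: (@measurable_fun_cvg _ _ _ _
  (fun n w => T / n.+1%:R * (\sum_(j < n.+1) rpairing (X (T / n.+1%:R * j%:R) w) f))).
  move=> n; apply: measurable_funM => //; apply: measurable_sum => j.
  apply: (measurable_rpairing_X sbmX).
  - by rewrite mulr_ge0// divr_ge0// ltW.
  - exact: unit_continuous_bounded.
  - exact: unit_continuous_ge0.
by move=> w _; exact: path_riemann_cvg.
Qed.

Lemma path_integral_le f S T w : unit_continuous f -> S <= T ->
  path_integral f S w <= path_integral f T w.
Proof.
move=> uf ST.
have c := cadlag_rpairing w uf.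
have mI U : measurable (`[0, U[%classic : set (measurableTypeR R)).
  exact: measurable_itv.
have fin U := integrable_fin_num (mI U) (cadlag_integrable U c).
apply: fine_le; [exact: fin|exact: fin|apply: ge0_subset_integral => //=].
- by apply/measurable_EFinP; exact: measurable_cadlag.
- by move=> t _; rewrite lee_fin; apply: rpairing_ge0; exact: unit_continuous_ge0.
- by move=> t /=; rewrite !in_itv/= => /andP[-> tS]; exact: lt_le_trans ST.
Qed.

(** By right continuity a positive value at [t < T] persists on a short interval after [t], which
    would make the integral of a nonnegative function positive. *)
Lemma path_integral_eq0 f T w : unit_continuous f -> path_integral f T w = 0 ->
  forall t, 0 <= t < T -> rpairing (X t w) f = 0.
Proof.
move=> uf I0 t tT; have f0 := unit_continuous_ge0 uf.
apply/eqP/negPn/negP => ft0.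
have c := cadlag_rpairing w uf.
have ft : 0 < rpairing (X t w) f by rewrite lt_neqAle eq_sym ft0 rpairing_ge0.
have /andP[t0 t1] := tT.
have e2 : 0 < rpairing (X t w) f / 2 by rewrite divr_gt0.
have [/(_ t t0)/cvgrPdist_lt/(_ _ e2)/nbhs_ballP[e /= e0 He] _] := c.
pose e' := Num.min e (T - t) / 2.
have m0 : 0 < Num.min e (T - t) by rewrite lt_min e0 subr_gt0.
have me : Num.min e (T - t) <= e by rewrite ge_min lexx.
have mT : Num.min e (T - t) <= T - t by rewrite ge_min lexx orbT.
have e'0 : 0 < e' by rewrite divr_gt0.
have low s : t <= s < t + e' -> rpairing (X t w) f / 2 <= rpairing (X s w) f.
  move=> /andP[]; rewrite le_eqVlt => /predU1P[<- _|ts se]; first by lra.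
  have bs : ball t e s.
    by rewrite /ball/= distrC gtr0_norm ?subr_gt0//; move: se; rewrite /e'; lra.
  by have /= := He s bs ts; rewrite ltr_norml; lra.
have mI U : measurable (`[0, U[%classic : set (measurableTypeR R)).
  exact: measurable_itv.
have fin U := integrable_fin_num (mI U) (cadlag_integrable U c).
have : (\int[lebesgue_measure]_(s in `[t, (t + e')%R[) (rpairing (X t w) f / 2)%R%:E <=
    \int[lebesgue_measure]_(s in `[0%R, T[) (rpairing (X s w) f)%:E)%E.
  have sub : `[t, t + e'[ `<=` `[0, T[.
    move=> s /=; rewrite !in_itv/= /e' => /andP[s1 s2].
    by rewrite (le_trans t0)//=; lra.
  have mf : measurable_fun (`[0, T[%classic : set (measurableTypeR R))
      (fun s => (rpairing (X s w) f)%:E).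
    by apply/measurable_EFinP; exact: measurable_cadlag.
  apply: (@le_trans _ _ (\int[lebesgue_measure]_(s in `[t, (t + e')%R[)
      (rpairing (X s w) f)%:E)%E).
    apply: ge0_le_integral => //=.
    - by move=> s _; rewrite lee_fin ltW.
    - by apply: measurable_funS mf => //; exact: measurable_itv.
  by apply: ge0_subset_integral => //= s _; rewrite lee_fin rpairing_ge0.
rewrite integral_cst//= lebesgue_measure_itv/= lte_fin ltrDl e'0.
have -> : (\int[lebesgue_measure]_(s in `[0%R, T[) (rpairing (X s w) f)%:E = 0)%E.
  by rewrite -[LHS]fineK ?fin// -[X in X%:E]/(path_integral f T w) I0.
rewrite -EFinB -EFinM lee_fin leNgt => /negP; apply.
by rewrite mulr_gt0//; lra.
Qed.

End path_integrals.

(** * The total mass when the range avoids a half-line *)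

Lemma cvg_expN (R : realType) (u : nat -> R) (l : R) : u @ \oo --> l ->
  expR (- u n) @[n --> \oo] --> expR (- l).
Proof.
move=> ul; have H : (fun n => - u n) @ \oo --> - l by exact: cvgN.
exact: (cvg_comp _ _ H (@continuous_expR R _)).
Qed.

Section discounted_survival.
Context {R : realType} {d : measure_display} {Omega : measurableType d}.
Variables (P : probability Omega R) (r : {nonneg R}) (a : R).
Variable X : R -> Omega -> finmeas R.
Hypothesis sbmX : is_sbm P (mscale r (@dirac _ (measurableTypeR R) a R)) X.

Let one : R -> R := fun=> 1.

(** No mass is ever charged left of [z]. Phrasing this with pairings gives access to measurability;
    [alive_range] translates it back to the range. *)
Definition alive (z : R) : set Omega :=
  [set o | forall t : R, 0 <= t -> rpairing (X t o) (cutoff z) = 0].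

(** The total mass is not known to be finite. Where it is infinite the value is 0 for [mu > 0], and
    1 for [mu = 0] because 0 times [+oo] is 0. *)
Definition discount (mu : R) (o : Omega) : R :=
  fine (expeR (- (mu%:E * total_mass X o)))%E.

(** Uncountably many times are reduced to countably many path integrals, from which measurability
    follows. *)
Lemma aliveE z : alive z =
  \bigcap_n [set o | path_integral X (cutoff z) n.+1%:R o = 0].
Proof.
apply/seteqP; split=> o.
  move=> ao n _ /=; rewrite /path_integral /time_integral.
  rewrite (@eq_Rintegral _ _ _ _ _ (fun=> 0)); last first.
    by move=> t; rewrite inE/= in_itv/= => /andP[t0 _]; rewrite ao.
  by rewrite /Rintegral integral0.
move=> H t t0.
have [n tn] : exists n : nat, t < n.+1%:R.
  by exists (Num.Def.trunc t); have /andP[] := Num.Theory.truncn_itv t0.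
apply: (path_integral_eq0 sbmX (unit_continuous_cutoff z) (H n Logic.I)).
by rewrite t0.
Qed.

Let pi_level_measurable z n :
  measurable [set o | path_integral X (cutoff z) n.+1%:R o = 0].
Proof.
have n0 : 0 < n.+1%:R :> R by rewrite ltr0n.
have := measurable_path_integral sbmX (unit_continuous_cutoff z) n0
  measurableT (@measurable_set1 R 0).
by rewrite setTI.
Qed.

Lemma measurable_alive z : measurable (alive z).
Proof. by rewrite aliveE; apply: bigcap_measurable => [|n _]; [exists 0%N|]. Qed.

Lemma total_mass_cvg o :
  (path_integral X one n.+1%:R o)%:E @[n --> \oo] --> total_mass X o.
Proof.
have c := cadlag_rpairing sbmX o unit_continuous_cst1.
have mI U : measurable (`[0, U[%classic : set (measurableTypeR R)).
  exact: measurable_itv.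
have fin U := integrable_fin_num (mI U) (cadlag_integrable U c).
have -> : (fun n => (path_integral X one n.+1%:R o)%:E) = (fun n : nat =>
    \int[lebesgue_measure]_(t in `[0%R, n.+1%:R[) (rpairing (X t o) one)%:E)%E.
  by apply/funext => n; rewrite /path_integral /time_integral /Rintegral fineK.
have -> : total_mass X o = (\int[lebesgue_measure]_(t in
    \bigcup_n `[0%R, n.+1%:R[%classic) (rpairing (X t o) one)%:E)%E.
  rewrite /total_mass; have -> : `[0, +oo[%classic =
      \bigcup_n (`[0%R, n.+1%:R[%classic : set R).
    apply/seteqP; split=> t /=; rewrite in_itv/= ?andbT.
      move=> t0; exists (Num.Def.trunc t) => //=.
      by rewrite in_itv/= t0; have /andP[] := Num.Theory.truncn_itv t0.
    by move=> [n _] /=; rewrite in_itv/= => /andP[].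
  apply: eq_integral => t _.
  by rewrite (@pairingE _ (X t o) one)//; exact: bounded_measurable_cst.
apply: ge0_nondecreasing_set_cvg_integral.
- apply/nondecreasing_seqP => n; apply/subsetPset => t /=.
  rewrite !in_itv/= => /andP[-> tn]; apply: lt_trans tn _.
  by rewrite ltr_nat.
- by move=> n; exact: measurable_itv.
- by move=> n; apply/measurable_EFinP; exact: measurable_cadlag.
- by move=> n t _; rewrite lee_fin rpairing_ge0.
Qed.

Lemma total_mass_ge0 o : (0 <= total_mass X o)%E.
Proof.
apply: integral_ge0 => t _; apply: integral_ge0 => x _.
by rewrite lee_fin.
Qed.

Lemma discount_cvg mu o : 0 <= mu ->
  expR (- (mu * path_integral X one n.+1%:R o)) @[n --> \oo] --> discount mu o.
Proof.
move=> mu0; rewrite /discount; have := @total_mass_cvg o.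
have := total_mass_ge0 o; case: (total_mass X o) => [l|_|//].
  move=> _ /fine_cvg Il.
  have H : (fun n => - (mu * path_integral X one n.+1%:R o)) @ \oo --> - (mu * l).
    by apply: cvgN; apply: cvgM; [exact: cvg_cst|exact: Il].
  exact: (cvg_comp _ _ H (@continuous_expR R _)).
move=> /cvgeryP Iy.
(* The total mass is infinite from here on; for [mu = 0] both the sequence and its limit are 1. *)
move: mu0; rewrite le_eqVlt => /predU1P[<-|mu0].
  rewrite mul0e oppe0 expeR0 /=.
  under eq_fun do rewrite mul0r oppr0 expR0.
  exact: cvg_cst.
rewrite gt0_muley ?lte_fin//=.
have muIy : mu * path_integral X one n.+1%:R o @[n --> \oo] --> +oo.
  move/cvgryPge : Iy => Iy; apply/cvgryPge => A.
  by apply: filterS (Iy (A / mu)) => n; rewrite ler_pdivrMr// mulrC.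
exact: (cvg_comp _ _ muIy (@cvgr_expR R)).
Qed.

Lemma discount_le mu n o : 0 <= mu ->
  discount mu o <= expR (- (mu * path_integral X one n.+1%:R o)).
Proof.
move=> mu0; rewrite -(cvg_lim _ (@discount_cvg mu o mu0))//.
apply: limr_le; first exact: cvgP (@discount_cvg mu o mu0).
exists n => // m /= nm; rewrite ler_expR lerN2 ler_wpM2l//.
apply: path_integral_le; first exact: sbmX.
  exact: unit_continuous_cst1.
by rewrite ler_nat ltnS.
Qed.

Let riemann (f : R -> R) (T : R) (n : nat) (o : Omega) : R :=
  T / n.+1%:R * \sum_(j < n.+1) rpairing (X (T / n.+1%:R * j%:R) o) f.

Let riemann_ge0 f T n o : 0 < T -> (forall x, 0 <= f x) -> 0 <= riemann f T n o.
Proof.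
move=> T0 f0; apply: mulr_ge0; first by rewrite divr_ge0// ltW.
by apply: sumr_ge0 => j _; exact: rpairing_ge0.
Qed.

Let measurable_riemann f T n : 0 < T -> bounded_measurable f ->
  (forall x, 0 <= f x) -> measurable_fun [set: Omega] (riemann f T n).
Proof.
move=> T0 bf f0; apply: measurable_funM => //; apply: measurable_sum => j.
apply: (measurable_rpairing_X sbmX) => //.
by rewrite mulr_ge0// divr_ge0// ltW.
Qed.

Let le_riemann f g T n o : 0 < T ->
  (forall t : R, 0 <= t -> rpairing (X t o) f <= rpairing (X t o) g) ->
  riemann f T n o <= riemann g T n o.
Proof.
move=> T0 fg; apply: ler_wpM2l; first by rewrite divr_ge0// ltW.
by apply: ler_sum => j _; apply: fg; rewrite mulr_ge0// divr_ge0// ltW.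
Qed.

Let riemannZ (c : R) f T n o : bounded_measurable f ->
  riemann (fun x => c * f x) T n o = c * riemann f T n o.
Proof.
move=> bf; rewrite /riemann.
under eq_bigr do rewrite rpairingZ//.
by rewrite -mulr_sumr mulrCA.
Qed.

Let riemannD f g T n o : bounded_measurable f -> bounded_measurable g ->
  riemann (fun x => f x + g x) T n o = riemann f T n o + riemann g T n o.
Proof.
move=> bf bg; rewrite /riemann.
under eq_bigr do rewrite rpairingD//.
by rewrite big_split/= mulrDr.
Qed.

Let expandable_bm (w phi : R -> R) : expandable w phi ->
  [/\ bounded_measurable w, bounded_measurable phi,
      forall x, 0 <= w x & forall x, 0 <= phi x].
Proof.
move=> [cw cphi [M wphiM] _].
have w0 x : 0 <= w x by case: (wphiM x) => /andP[].
have phi0 x : 0 <= phi x by case: (wphiM x) => _ /andP[].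
split=> //; apply: continuous_bounded_measurable => //; exists M => x;
  rewrite ger0_norm//; by case: (wphiM x) => /andP[? ?] /andP[].
Qed.

Let unit_rv_log_laplace (w phi : R -> R) T n : expandable w phi -> 0 < T ->
  unit_rv (fun o => expR (- riemann phi T n o) * expR (- rpairing (X T o) w)).
Proof.
move=> /expandable_bm[bw bphi w0 phi0] T0.
apply: unit_rvM; apply: unit_rv_expN.
- exact: measurable_riemann.
- by move=> o; exact: riemann_ge0.
- exact: (measurable_rpairing_X sbmX (ltW T0)).
- by move=> o; exact: rpairing_ge0.
Qed.

Let path_cvg f T o : unit_continuous f -> 0 < T ->
  riemann f T n o @[n --> \oo] --> path_integral X f T o.
Proof.
by move=> uf T0; have := @path_riemann_cvg _ _ _ _ _ _ _ sbmX f T o uf T0; apply.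
Qed.

(** On [alive z] every [X t] is carried by the half-line from [z] on, so the bounds on [w] and [phi]
    are needed only there; this is what makes singular profiles usable. *)
Lemma survival_upper_test (w phi : R -> R) (B K z T : R) : expandable w phi ->
  0 <= B -> 0 <= K -> (forall x, z <= x -> w x <= B /\ phi x <= K) -> 0 < T ->
  E P (fun o => \1_(alive z) o * (expR (- (K * path_integral X one T o)) *
    expR (- (B * mass X T o)))) <= expR (- (r%:num * w a)).
Proof.
move=> wphi B0 K0 wphiz T0.
have [bw bphi w0 phi0] := expandable_bm wphi.
have b1 : bounded_measurable one by exact: bounded_measurable_cst.
have one0 x : 0 <= one x by exact: ler01.
have uu n : unit_rv (fun o => \1_(alive z) o *
    (expR (- (K * riemann one T n o)) * expR (- (B * mass X T o)))).
  apply: unit_rvM; first exact/unit_rv_indic/measurable_alive.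
  apply: unit_rvM; last exact: (unit_rv_exp_mass sbmX B0 (ltW T0)).
  apply: unit_rv_expN.
    by apply: measurable_funM; [exact: measurable_cst|exact: measurable_riemann].
  by move=> o; apply: mulr_ge0 => //; exact: riemann_ge0.
have [|_ cvgE] := E_cvg P (Y := fun o => \1_(alive z) o *
    (expR (- (K * path_integral X one T o)) * expR (- (B * mass X T o)))) uu.
  move=> o; apply: cvgM; first exact: cvg_cst.
  apply: cvgM; last exact: cvg_cst.
  apply: cvg_expN; apply: cvgM; first exact: cvg_cst.
  by apply: path_cvg => //; exact: unit_continuous_cst1.
apply: (ler_cvg_to cvgE (discrete_log_laplace sbmX wphi T0)).
apply: nearW => n; apply: E_le; first exact: uu.
  exact: unit_rv_log_laplace.
move=> o; rewrite indicE; have [ao|ao] := boolP (o \in alive z); last first.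
  by rewrite mul0r mulr_ge0// expR_ge0.
rewrite mul1r; move/set_mem : ao => ao.
have off t : 0 <= t -> (X t o `]-oo, z[%classic = 0)%E.
  by move=> t0; apply/rpairing_cutoff_eq0; exact: ao.
apply: ler_pM; rewrite ?expR_ge0// ler_expR lerN2.
- rewrite -[_ * \sum_(j < _) _]/(riemann phi T n o) -riemannZ//.
  apply: le_riemann => // t t0; apply: (le_rpairing_on (off t t0)) => //.
    exact: bounded_measurableZ.
  by move=> x /wphiz[_]; rewrite mulr1.
- rewrite /mass -rpairing_cst; apply: (le_rpairing_on (off T (ltW T0))) => //.
    exact: bounded_measurable_cst.
  by move=> x /wphiz[].
Qed.

(** The terminal factor is at most 1 and is discarded. Instead of an indicator, the mass left of [z]
    is penalised at rate [L], to be sent to infinity. *)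
Lemma survival_lower_test (w phi : R -> R) (K L z T : R) : expandable w phi ->
  0 <= K -> 0 <= L -> (forall x, K + L * cutoff z x <= phi x) -> 0 < T ->
  expR (- (r%:num * w a)) <=
  E P (fun o => expR (- (K * path_integral X one T o)) *
    expR (- (L * path_integral X (cutoff z) T o))).
Proof.
move=> wphi K0 L0 phiKL T0.
have [bw bphi w0 phi0] := expandable_bm wphi.
have b1 : bounded_measurable one by exact: bounded_measurable_cst.
have one0 x : 0 <= one x by exact: ler01.
have bc := bounded_measurable_cutoff z.
have c0 x : 0 <= cutoff z x by case/andP: (cutoff01 z x).
have uu n : unit_rv (fun o => expR (- (K * riemann one T n o)) *
    expR (- (L * riemann (cutoff z) T n o))).
  apply: unit_rvM; apply: unit_rv_expN.
  - by apply: measurable_funM; [exact: measurable_cst|exact: measurable_riemann].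
  - by move=> o; apply: mulr_ge0 => //; exact: riemann_ge0.
  - by apply: measurable_funM => //; exact: measurable_riemann.
  - by move=> o; apply: mulr_ge0 => //; exact: riemann_ge0.
have [|_ cvgE] := E_cvg P (Y := fun o => expR (- (K * path_integral X one T o)) *
    expR (- (L * path_integral X (cutoff z) T o))) uu.
  move=> o; apply: cvgM; apply: cvg_expN; apply: cvgM; try exact: cvg_cst.
    by apply: path_cvg => //; exact: unit_continuous_cst1.
  by apply: path_cvg => //; exact: unit_continuous_cutoff.
apply: (ler_cvg_to (discrete_log_laplace sbmX wphi T0) cvgE).
apply: nearW => n; apply: E_le; [exact: unit_rv_log_laplace|exact: uu|].
move=> o; apply: (@le_trans _ _ (expR (- riemann phi T n o) * 1)).
  apply: ler_wpM2l; first exact: expR_ge0.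
  by rewrite -expR0 ler_expR oppr_le0 rpairing_ge0.
rewrite mulr1 -expRD -opprD ler_expR lerN2.
rewrite -!riemannZ// -riemannD//; try exact: bounded_measurableZ.
apply: le_riemann => // t t0; apply: le_rpairing => //.
  by apply: bounded_measurableD; exact: bounded_measurableZ.
by move=> x; rewrite mulr1.
Qed.

End discounted_survival.

(** * Removal of the regularisation and of the time horizon *)

Section survival_formula.
Context {R : realType} {d : measure_display} {Omega : measurableType d}.
Variables (P : probability Omega R) (r : {nonneg R}) (a : R).
Variable X : R -> Omega -> finmeas R.
Hypothesis sbmX : is_sbm P (mscale r (@dirac _ (measurableTypeR R) a R)) X.
Variables (c : R) (kap : R -> R).
Hypothesis kapP : singular_riccati c kap.

Let one : R -> R := fun=> 1.
Let mu : R := c ^+ 4 / 2.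
Let U (x : R) : R := 3 / 2 * kap x ^+ 2 - c ^+ 2.
Let dl (m : nat) : R := m.+1%:R^-1.

Let c0 : 0 <= c. Proof. by case: kapP. Qed.

Let mu0 : 0 <= mu. Proof. by rewrite divr_ge0// exprn_ge0. Qed.

Let dl01 m : 0 < dl m <= 1.
Proof. by rewrite invr_gt0 ltr0n/= invf_le1 ?ltr0n// ler1n. Qed.

Let cvg_dl : dl m @[m --> \oo] --> 0.
Proof. exact: cvg_harmonic. Qed.

Let kap_ge0 x : 0 < x -> 0 <= kap x.
Proof. by move=> x0; apply: (le_trans c0); case: kapP => _ _ + _; exact. Qed.

Let continuous_U x : 0 < x -> {for x, continuous U}.
Proof.
move=> x0; have [_ dk _ _] := kapP.
by apply: der_continuous; apply: derB; [apply: derZ; apply: derX; exact: dk|exact: der_cst].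
Qed.

Lemma unit_rv_discount : unit_rv (discount X mu).
Proof.
have uu n : unit_rv (fun o => expR (- (mu * path_integral X one n.+1%:R o))).
  apply: unit_rv_expN.
    apply: measurable_funM => //; apply: measurable_path_integral; first exact: sbmX.
      exact: unit_continuous_cst1.
    by rewrite ltr0n.
  by move=> o; rewrite mulr_ge0// path_integral_ge0//; exact: unit_continuous_cst1.
have [|//] := E_cvg P (Y := discount X mu) uu.
by move=> o; exact: (discount_cvg sbmX mu0).
Qed.

Let unit_rv_exp_path (K T : R) f : 0 <= K -> 0 < T -> unit_continuous f ->
  unit_rv (fun o => expR (- (K * path_integral X f T o))).
Proof.
move=> K0 T0 uf; apply: unit_rv_expN.
  by apply: measurable_funM => //; exact: (measurable_path_integral sbmX).
by move=> o; rewrite mulr_ge0// path_integral_ge0.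
Qed.

(** The pole is at [y] but mass is forbidden up to [y + eta]: the gap makes the bound [B] on [w]
    independent of [dl] and the excess of [phi] over [mu] vanish with [dl]. The limit in [dl] is
    taken at fixed [T], before [T] grows. *)
Lemma survival_upper (y eta : R) : y < a -> 0 < eta ->
  E P (fun o => \1_(alive X (y + eta)) o * discount X mu o) <=
  expR (- (r%:num * U (a - y))).
Proof.
move=> ya eta0.
have ay0 : 0 < a - y by rewrite subr_gt0.
pose B := 3 / 2 * kap eta ^+ 2.
have B0 : 0 <= B by rewrite mulr_ge0 ?sqr_ge0//; lra.
pose A := 9 * kap eta ^+ 4 + 3 / 2 * kap eta ^+ 3.
have ke0 : 0 <= kap eta by exact: kap_ge0.
have A0 : 0 <= A by rewrite addr_ge0 ?mulr_ge0 ?exprn_ge0//; lra.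
have u1 : unit_rv (\1_(alive X (y + eta)) : Omega -> R).
  by apply: unit_rv_indic; exact: (measurable_alive sbmX).
pose K m := mu + A * (4 * dl m / eta ^+ 2).
have dl0 m : 0 < dl m by case/andP: (dl01 m).
have K0 m : 0 <= K m.
  by rewrite addr_ge0// mulr_ge0// divr_ge0 ?sqr_ge0// mulr_ge0// ltW.
have cvgK : K m @[m --> \oo] --> mu.
  rewrite -[X in _ --> X]addr0; apply: cvgD; first exact: cvg_cst.
  have -> : (fun m => A * (4 * dl m / eta ^+ 2)) =
      (fun m => A * 4 / eta ^+ 2 * dl m) by apply/funext => m; ring.
  rewrite -[X in _ --> X](mulr0 (A * 4 / eta ^+ 2)).
  by apply: cvgM; [exact: cvg_cst|exact: cvg_dl].
have limT (T : R) : 0 < T ->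
    E P (fun o => \1_(alive X (y + eta)) o * (expR (- (mu * path_integral X one T o)) *
      expR (- (B * mass X T o)))) <= expR (- (r%:num * U (a - y))).
  move=> T0.
  have uu m : unit_rv (fun o => \1_(alive X (y + eta)) o *
      (expR (- (K m * path_integral X one T o)) * expR (- (B * mass X T o)))).
    apply: unit_rvM => //; apply: unit_rvM.
      by apply: unit_rv_exp_path => //; exact: unit_continuous_cst1.
    exact: (unit_rv_exp_mass sbmX B0 (ltW T0)).
  have [|_ cvgE] := E_cvg P (Y := fun o => \1_(alive X (y + eta)) o *
    (expR (- (mu * path_integral X one T o)) * expR (- (B * mass X T o)))) uu.
    move=> o; apply: cvgM; first exact: cvg_cst.
    apply: cvgM; last exact: cvg_cst.
    by apply: cvg_expN; apply: cvgM; [exact: cvgK|exact: cvg_cst].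
  have cvgU : expR (- (r%:num * U (a - y + 2 * dl m))) @[m --> \oo] -->
      expR (- (r%:num * U (a - y))).
    apply: cvg_expN; apply: cvgM; first exact: cvg_cst.
    have H : (fun m => a - y + 2 * dl m) @ \oo --> a - y.
      rewrite -[X in _ --> X]addr0; apply: cvgD; first exact: cvg_cst.
      by rewrite -[X in _ --> X](mulr0 2); apply: cvgM; [exact: cvg_cst|exact: cvg_dl].
    exact: (cvg_comp _ _ H (continuous_U ay0)).
  apply: (ler_cvg_to cvgE cvgU); apply: nearW => m.
  have [w [phi [wphi _ _ H4 H5]]] := singular_test_functions kapP y (dl01 m).
  apply: (le_trans (survival_upper_test sbmX (B := B) (K := K m) (z := y + eta)
    wphi B0 (K0 m) _ T0)).
    by move=> x /(H4 eta x eta0).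
  rewrite ler_expR lerN2 ler_wpM2l//.
  by have /andP[] := H5 a ya.
(* Restoring the terminal factor [expR (- (B * mass))] at time [T = k.+1] costs at most [r / (2 T)],
   whatever [B] is. *)
have step k : E P (fun o => \1_(alive X (y + eta)) o * discount X mu o) <=
    expR (- (r%:num * U (a - y))) + r%:num / 2 * dl k.
  have T0 : 0 < k.+1%:R :> R by rewrite ltr0n.
  have uI := unit_rv_exp_path mu0 T0 unit_continuous_cst1.
  have uB := unit_rv_exp_mass sbmX B0 (ltW T0).
  have uIB := unit_rvM u1 (unit_rvM uI uB).
  apply: (@le_trans _ _ (E P (fun o => \1_(alive X (y + eta)) o *
      expR (- (mu * path_integral X one k.+1%:R o))))).
    apply: E_le; first exact: unit_rvM u1 unit_rv_discount.
      exact: unit_rvM.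
    move=> o; apply: ler_wpM2l; first by have [_ /(_ o)/andP[]] := u1.
    exact: (discount_le sbmX).
  have := limT _ T0; have := E_exp_massC_decay sbmX B0 T0.
  have := E_B P (unit_rvM u1 uI) uIB.
  have : E P (fun o => \1_(alive X (y + eta)) o *
        expR (- (mu * path_integral X one k.+1%:R o)) -
      \1_(alive X (y + eta)) o * (expR (- (mu * path_integral X one k.+1%:R o)) *
        expR (- (B * mass X k.+1%:R o)))) <=
      E P (fun o => 1 - expR (- (B * mass X k.+1%:R o))).
    have -> : (fun o => \1_(alive X (y + eta)) o *
        expR (- (mu * path_integral X one k.+1%:R o)) -
      \1_(alive X (y + eta)) o * (expR (- (mu * path_integral X one k.+1%:R o)) *
        expR (- (B * mass X k.+1%:R o)))) =
      (fun o => (\1_(alive X (y + eta)) o *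
        expR (- (mu * path_integral X one k.+1%:R o))) *
        (1 - expR (- (B * mass X k.+1%:R o)))).
      by apply/funext => o; ring.
    apply: E_le.
    - exact: unit_rvM (unit_rvM u1 uI) (unit_rvC uB).
    - exact: unit_rvC uB.
    - move=> o; have [_ /(_ o)/andP[b0 b1]] := unit_rvC uB.
      have [_ /(_ o)/andP[? ?]] := unit_rvM u1 uI.
      exact: ler_piMl.
  have -> : r%:num / (2 * k.+1%:R) = r%:num / 2 * dl k by rewrite invfM mulrA.
  by move=> H1 H2 H3 H4; rewrite H2 in H1; lra.
have cvgr : expR (- (r%:num * U (a - y))) + r%:num / 2 * dl k @[k --> \oo] -->
    expR (- (r%:num * U (a - y))).
  rewrite -[X in _ --> X]addr0; apply: cvgD; first exact: cvg_cst.
  rewrite -[X in _ --> X](mulr0 (r%:num / 2)).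
  by apply: cvgM; [exact: cvg_cst|exact: cvg_dl].
rewrite -(cvg_lim _ cvgr)//; apply: limr_ge; first exact: cvgP cvgr.
by apply: nearW => k; exact: step.
Qed.

(** As [L m] tends to infinity, the penalty tends to the indicator that no mass is charged left of
    [y] before [T]; these events decrease to [alive X y] as [T] grows. Since [w a] lies below
    [U (a - y)], the left side is already in final form. *)
Lemma survival_lower (y : R) : y < a ->
  expR (- (r%:num * U (a - y))) <=
  E P (fun o => \1_(alive X y) o * discount X mu o).
Proof.
move=> ya.
have uc := unit_continuous_cutoff y.
(* Left of [y], [phi] exceeds both [mu] and [(64 dl)^-1], and [cutoff] is at most 1, so
   [mu + L m * cutoff y] stays below [phi]. The maximum with 0 keeps the rate nonnegative. *)
pose L m := Num.max 0 ((64 * dl m)^-1 - mu).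
have L0 m : 0 <= L m by rewrite le_max lexx.
pose Z (T : R) := [set o | path_integral X (cutoff y) T o = 0].
have mZ (T : R) : 0 < T -> measurable (Z T).
  move=> T0; have := measurable_path_integral sbmX uc T0
    measurableT (@measurable_set1 R 0).
  by rewrite setTI.
have step (T : R) : 0 < T -> expR (- (r%:num * U (a - y))) <=
    E P (fun o => expR (- (mu * path_integral X one T o)) * \1_(Z T) o).
  move=> T0.
  have uu m : unit_rv (fun o => expR (- (mu * path_integral X one T o)) *
      expR (- (L m * path_integral X (cutoff y) T o))).
    by apply: unit_rvM; apply: unit_rv_exp_path => //; exact: unit_continuous_cst1.
  have [|_ cvgE] := E_cvg P (Y := fun o => expR (- (mu * path_integral X one T o)) *
      \1_(Z T) o) uu.
    move=> o; apply: cvgM; first exact: cvg_cst.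
    rewrite indicE; have [oZ|oZ] := boolP (o \in Z T).
      move/set_mem : oZ => /= ->.
      by under eq_fun do rewrite mulr0 oppr0 expR0; exact: cvg_cst.
    have pos : 0 < path_integral X (cutoff y) T o.
      rewrite lt_neqAle path_integral_ge0// andbT eq_sym.
      by apply: contra oZ => /eqP oZ; rewrite inE.
    have Ly : L m * path_integral X (cutoff y) T o @[m --> \oo] --> +oo.
      have mr := @cvgr_idn R.
      move/cvgryPge : mr => mr; apply/cvgryPge => A.
      apply: filterS (mr (64 * (A / path_integral X (cutoff y) T o + mu))) => m mA.
      rewrite -ler_pdivrMr// /L le_max; apply/orP; right.
      rewrite /dl invfM invrK lerBrDr.
      by rewrite -(ler_pM2l (_ : 0 < 64))// mulrA divff ?mul1r// (le_trans mA)// ler_nat.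
    exact: (cvg_comp _ _ Ly (@cvgr_expR R)).
  rewrite -(cvg_lim _ cvgE)//; apply: limr_ge; first exact: cvgP cvgE.
  apply: nearW => m.
  have [w [phi [wphi H2 H3 _ H5]]] := singular_test_functions kapP y (dl01 m).
  apply: le_trans (survival_lower_test sbmX (K := mu) (L := L m) (z := y)
    wphi mu0 (L0 m) _ T0).
    rewrite ler_expR lerN2 ler_wpM2l//.
    by have /andP[] := H5 a ya.
  move=> x; have [yx|xy] := leP y x.
    by rewrite cutoff_eq0// mulr0 addr0; exact: H2.
  have /andP[k0 k1] := cutoff01 y x.
  have : L m * cutoff y x <= L m by rewrite ler_piMr.
  have := H3 x (ltW xy); have := H2 x; rewrite -/mu /L.
  by case: (leP 0 ((64 * dl m)^-1 - mu)) => _; lra.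
have uu k : unit_rv (fun o => expR (- (mu * path_integral X one k.+1%:R o)) *
    \1_(Z k.+1%:R) o).
  apply: unit_rvM; last by apply: unit_rv_indic; apply: mZ; rewrite ltr0n.
  by apply: unit_rv_exp_path => //; exact: unit_continuous_cst1.
have [|_ cvgE] := E_cvg P
    (Y := fun o => \1_(alive X y) o * discount X mu o) uu.
  move=> o; rewrite mulrC; apply: cvgM; first exact: (discount_cvg sbmX mu0).
  have aE := aliveE sbmX y.
  rewrite indicE; have [ao|ao] := boolP (o \in alive X y).
    have Zo k : o \in Z k.+1%:R.
      by rewrite inE; move: ao; rewrite inE aE => /(_ k Logic.I).
    by under eq_fun do rewrite indicE Zo; exact: cvg_cst.
  have [n Zn] : exists n, ~ Z n.+1%:R o.
    apply/existsNP => H; move/negP : ao; apply; rewrite inE aE => n _; exact: H.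
  (* The path integral of the cutoff is nondecreasing in [T]: once positive it stays so, and the
     indicator is 0 from then on. *)
  apply: (@cvg_near_cst _ _ _ _ _ _).
  exists n => // k /= nk; rewrite indicE memNset//= => Zk; apply: Zn => /=.
  apply/eqP; rewrite eq_le path_integral_ge0 ?andbT//.
  rewrite -Zk; apply: (path_integral_le sbmX) => //.
  by rewrite ler_nat ltnS.
rewrite -(cvg_lim _ cvgE)//; apply: limr_ge; first exact: cvgP cvgE.
by apply: nearW => k; apply: step; rewrite ltr0n.
Qed.

(** The upper bound is used with pole [y - dl] and gap [dl], so that its event is the right one;
    continuity of [U] removes the shift. *)
Lemma survival_formula (y : R) : y < a ->
  E P (fun o => \1_(alive X y) o * discount X mu o) =
  expR (- (r%:num * U (a - y))).
Proof.
move=> ya; apply/eqP; rewrite eq_le survival_lower// andbT.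
have H : (fun m => a - y + dl m) @ \oo --> a - y.
  by rewrite -[X in _ --> X]addr0; apply: cvgD; [exact: cvg_cst|exact: cvg_dl].
have ay0 : 0 < a - y by rewrite subr_gt0.
have cvgU : expR (- (r%:num * U (a - y + dl m))) @[m --> \oo] -->
    expR (- (r%:num * U (a - y))).
  apply: cvg_expN; apply: cvgM; first exact: cvg_cst.
  exact: (cvg_comp _ _ H (continuous_U ay0)).
rewrite -(cvg_lim _ cvgU)//; apply: limr_ge; first exact: cvgP cvgU.
apply: nearW => m; have /andP[dl0 _] := dl01 m.
have := @survival_upper (y - dl m) (dl m) _ dl0.
rewrite subrK opprB addrA addrAC; apply; lra.
Qed.

End survival_formula.

(** * The minimum of the range *)

Section range_event.
Context {R : realType} {d : measure_display} {Omega : measurableType d}.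
Variables (P : probability Omega R) (r : {nonneg R}) (a : R).
Variable X : R -> Omega -> finmeas R.
Hypothesis sbmX : is_sbm P (mscale r (@dirac _ (measurableTypeR R) a R)) X.

(** From support to measure this is a Lindelöf argument: each point below [z] has a null
    neighbourhood, hence lies in a null interval with rational ends, and there are countably many of
    those. *)
Lemma supp_ge (m : finmeas R) (z : R) :
  (m `]-oo, z[%classic = 0)%E <-> (forall x, supp m x -> z <= x).
Proof.
split=> [m0 x xm|msupp].
  rewrite leNgt; apply/negP => xz.
  have oz : open (`]-oo, z[%classic : set R) by exact: interval_open.
  have xz' : (`]-oo, z[%classic : set R) x by rewrite /= in_itv.
  by have := xm _ oz xz'; rewrite m0 ltxx.
(* [F] enumerates the null rational intervals through codes of pairs; every other index gives the
   empty set. *)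
pose F (n : nat) : set (measurableTypeR R) :=
  if @unpickle (rat * rat)%type n is Some (p, q) then
    if m `]ratr p, ratr q[%classic == 0%E then `]ratr p, ratr q[%classic
    else set0
  else set0.
have mF n : measurable (F n) /\ m (F n) = 0%E.
  rewrite /F; case: unpickle => [[p q]|]; last by rewrite measure0.
  by case: eqP => [->//|_]; rewrite measure0.
have : m.-negligible (\bigcup_n F n).
  by apply: negligible_bigcup => n; have [mFn Fn0] := mF n; exists (F n); split.
move=> [A [mA A0 FA]].
apply: (@subset_measure0 _ _ _ m _ A) => //.
move=> x /=; rewrite in_itv/= => xz; apply: FA.
have : ~ supp m x by move=> /msupp; rewrite leNgt xz.
move=> /existsNP[V] /not_implyP[oV] /not_implyP[Vx /negP]; rewrite -leNgt => mV.
have [e /= e0 xV] : exists2 e : R, 0 < e & ball x e `<=` V.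
  by move: oV; rewrite openE => /(_ x Vx)/nbhs_ballP.
have xe : x - e < x by lra.
have ex : x < x + e by lra.
have [p] := rat_in_itvoo xe.
have [q] := rat_in_itvoo ex.
rewrite !in_itv/= => /andP[q1 q2] /andP[p1 p2].
exists (pickle (p, q)); first exact: Logic.I.
rewrite /F pickleK.
have -> : m `]ratr p, ratr q[%classic = 0%E.
  apply/eqP; rewrite eq_le measure_ge0 andbT; apply: le_trans mV.
  apply: le_measure; rewrite ?inE//; first exact: open_measurable.
  move=> s /=; rewrite in_itv/= => /andP[s1 s2]; apply: xV.
  by rewrite /ball/= ltr_norml; lra.
by rewrite eqxx /= in_itv/= p2.
Qed.

(** The half-line is closed, so taking the closure of the union of supports does not leave it. *)
Lemma alive_range z o : alive X z o <-> (forall x, sbm_range X o x -> z <= x).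
Proof.
have ac : closed [set x : R | z <= x] by exact: closed_ge.
split=> [az x|H t t0].
  rewrite /sbm_range => xS.
  have : closure [set x : R | z <= x] x.
    apply: closureS xS => s [t /=]; rewrite in_itv/= andbT => t0.
    by apply: (supp_ge _ _).1; apply/rpairing_cutoff_eq0; exact: az.
  by rewrite -(proj1 (closure_id _) ac).
apply/rpairing_cutoff_eq0/supp_ge => x xs; apply: H.
by apply: subset_closure; exists t => //=; rewrite in_itv/= t0.
Qed.

(** The infimum of the range is strictly above [y], with the convention that an empty range has
    infimum [+oo]. The strict form matches the interval open on the left in the conditioning. *)
Definition range_gt (y : R) : set Omega :=
  \bigcup_n alive X (y + n.+1%:R^-1).

Lemma measurable_range_gt y : measurable (range_gt y).
Proof. by apply: bigcup_measurable => n _; exact: (measurable_alive sbmX). Qed.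

Lemma range_gt_alive y : range_gt y `<=` alive X y.
Proof.
move=> o [n _ /alive_range H]; apply/alive_range => x /H.
by apply: le_trans; rewrite lerDl invr_ge0.
Qed.

Let small_inv (e : R) : 0 < e -> exists n : nat, n.+1%:R^-1 <= e.
Proof.
move=> e0; have [N _ HN] := near_infty_natSinv_lt (PosNum e0).
by exists N; have /= /ltW := HN N (leqnn N).
Qed.

(** An empty range belongs to [range_gt 0], so the difference forces the range to be nonempty; being
    closed and bounded below, it contains its infimum. *)
Lemma min_range_inE (eps : R) :
  min_range_in X `]- eps, 0] = range_gt (- eps) `\` range_gt 0.
Proof.
apply/seteqP; split=> o.
  move=> [m [mS mlb]] /=; rewrite in_itv/= => /andP[me m0].
  have am : alive X m o by apply/alive_range => x; exact: mlb.
  split.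
    have [n ne] := @small_inv (m + eps) ltac:(lra).
    exists n => //; apply/alive_range => x /mlb; apply: le_trans.
    by rewrite addrC -lerBrDr opprK.
  move=> [n _ /alive_range/(_ m mS)]; rewrite add0r => /le_trans/(_ m0).
  by rewrite leNgt invr_gt0 ltr0n.
move=> [[n _ /alive_range lb] n0].
have n1 : 0 < n.+1%:R^-1 :> R by rewrite invr_gt0 ltr0n.
have S0 : sbm_range X o !=set0.
  apply/set0P/negP => /eqP S0; apply: n0; exists 0%N => //.
  by apply/alive_range => x; rewrite S0.
have hS : has_inf (sbm_range X o) by split=> //; exists (- eps + n.+1%:R^-1).
have mlb : lbound (sbm_range X o) (inf (sbm_range X o)).
  by apply: inf_lbound; case: hS.
have mS : sbm_range X o (inf (sbm_range X o)).
  have cS : closed (sbm_range X o) by exact: closed_closure.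
  rewrite {1}(proj1 (closure_id _) cS) => B /nbhs_ballP[e /= e0 eB].
  have [s sS se] := inf_adherent e0 hS.
  exists s; split=> //; apply: eB; rewrite /ball/= distrC ger0_norm.
    by rewrite ltrBlDl.
  by rewrite subr_ge0; exact: mlb.
exists (inf (sbm_range X o)) => //=; rewrite in_itv/=.
apply/andP; split; first by apply: lt_le_trans (lb _ mS); rewrite ltrDl.
rewrite leNgt; apply/negP => m0; apply: n0.
have [k ke] := small_inv m0.
by exists k => //; apply/alive_range => x /mlb; rewrite add0r; exact: le_trans.
Qed.

(** [range_gt y] is squeezed between [alive X (y + n.+1%:R^-1)] and [alive X y], and the formula is
    continuous in [y]: the infimum puts no weight on the single point [y]. *)
Lemma range_gt_formula (c : R) (kap : R -> R) y :
  singular_riccati c kap -> y < a ->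
  E P (fun o => \1_(range_gt y) o * discount X (c ^+ 4 / 2) o) =
  expR (- (r%:num * (3 / 2 * kap (a - y) ^+ 2 - c ^+ 2))).
Proof.
move=> kapP ya; have ay0 : 0 < a - y by rewrite subr_gt0.
have ud := unit_rv_discount sbmX kapP.
have uG := unit_rv_indic (R := R) (measurable_range_gt y).
have uA z := unit_rv_indic (R := R) (measurable_alive sbmX z).
apply/eqP; rewrite eq_le; apply/andP; split.
  rewrite -(survival_formula sbmX kapP ya); apply: E_le; try exact: unit_rvM.
  move=> o; apply: ler_wpM2r; first by have [_ /(_ o)/andP[]] := ud.
  rewrite !indicE ler_nat; have [oG|//] := boolP (o \in range_gt y).
  by rewrite mem_set//; apply: range_gt_alive; exact: set_mem.
pose U x := 3 / 2 * kap x ^+ 2 - c ^+ 2.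
have cU : {for (a - y), continuous U}.
  have [_ dk _ _] := kapP.
  by apply: der_continuous; apply: derB;
    [apply: derZ; apply: derX; exact: dk|exact: der_cst].
have H : (fun m : nat => - (r%:num * U (a - (y + m.+1%:R^-1)))) @ \oo -->
    - (r%:num * U (a - y)).
  apply: cvgN; apply: cvgM; first exact: cvg_cst.
  have h : (fun m : nat => a - (y + m.+1%:R^-1)) @ \oo --> a - y.
    apply: cvgB; first exact: cvg_cst.
    rewrite -[X in _ --> X]addr0; apply: cvgD; first exact: cvg_cst.
    exact: cvg_harmonic.
  exact: (cvg_comp _ _ h cU).
have {}H := cvg_comp _ _ H (@continuous_expR R _).
rewrite -(cvg_lim _ H)//; apply: limr_le; first exact: cvgP H.
have [N _ HN] := near_infty_natSinv_lt (PosNum ay0).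
exists N => // m /HN /= mN.
have ym : y + m.+1%:R^-1 < a by rewrite addrC -ltrBrDr.
rewrite -(survival_formula sbmX kapP ym); apply: E_le; try exact: unit_rvM.
move=> o; apply: ler_wpM2r; first by have [_ /(_ o)/andP[]] := ud.
rewrite !indicE ler_nat; have [oA|//] := boolP (o \in alive X _).
by rewrite mem_set//; exists m => //; exact: set_mem.
Qed.

End range_event.

(** * The two Riccati solutions in use *)

Section hyperbolic_solution.
Context {R : realType}.

(** The limit of [c coth(c x)] as [c] tends to 0; it corresponds to [mu = 0] and yields the
    probability of the conditioning event. *)
Lemma singular_riccati_inv : singular_riccati (0 : R) (fun x => x^-1).
Proof.
split=> [//|x x0|x x0|//]; last by rewrite invr_ge0 ltW.
apply: der_eq; first by apply: derV; [exact: lt0r_neq0|exact: der_id].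
by rewrite expr0n/= sub0r exprVn mul1r.
Qed.

Lemma sinh_gt0 (x : R) : 0 < x -> 0 < sinh x.
Proof. by move=> x0; rewrite divr_gt0// subr_gt0 ltr_expR; lra. Qed.

Lemma cosh2_sinh2 (x : R) : cosh x ^+ 2 - sinh x ^+ 2 = 1.
Proof.
rewrite /cosh /sinh expRN; field; exact: lt0r_neq0 (expR_gt0 _).
Qed.

Lemma der_expRN (x : R) : der (fun x => expR (- x)) x (- expR (- x)).
Proof.
apply: der_eq.
  apply: (@der_comp R expR (fun x => - x)); first exact: is_derive_expR.
  by apply: derN; exact: der_id.
by rewrite mulrN1.
Qed.

Lemma der_cosh (x : R) : der cosh x (sinh x).
Proof.
apply: der_eq.
  apply: derM; last exact: der_cst.
  by apply: derD; [exact: is_derive_expR|exact: der_expRN].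
by rewrite /sinh /=; lra.
Qed.

Lemma der_sinh (x : R) : der sinh x (cosh x).
Proof.
apply: der_eq.
  apply: derM; last exact: der_cst.
  by apply: derB; [exact: is_derive_expR|exact: der_expRN].
by rewrite /cosh /=; lra.
Qed.

(** By the mean value theorem [sinh y = y cosh z] with [z < y], and [cosh] increases on positive
    numbers. It gives the bound [x^-1 <= c coth(c x)]. *)
Lemma sinh_le_cosh (y : R) : 0 < y -> sinh y <= y * cosh y.
Proof.
move=> y0.
have [z|x|z] := @MVT R sinh cosh 0 y y0.
- by move=> _; exact: der_sinh.
- by apply: continuous_subspaceT => z; exact: der_continuous (der_sinh z).
rewrite in_itv/= => /andP[z0 zy].
have -> : sinh 0 = 0 :> R by rewrite /sinh oppr0 subrr mul0r.
rewrite !subr0 => ->; rewrite mulrC ler_pM2l//.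
have H0 : 1 <= expR z by rewrite -expR0 ler_expR ltW.
have H1 : expR z <= expR y by rewrite ler_expR ltW.
have H2 : expR y * expR (- y) = 1 by rewrite expRN divff// lt0r_neq0 ?expR_gt0.
have H3 : expR z * expR (- z) = 1 by rewrite expRN divff// lt0r_neq0 ?expR_gt0.
have H4 : 0 < expR (- y) by exact: expR_gt0.
have H5 : expR (- z) <= 1 by rewrite -expR0 ler_expR; lra.
rewrite /cosh ler_pM2r ?invr_gt0//.
move: (expR z) (expR y) (expR (- y)) (expR (- z)) H0 H1 H2 H3 H4 H5.
move=> A B B' A' A1 AB BB AA B'0 A'1.
(* Monotonicity of [cosh] in the form [(B + B') - (A + A') = (B - A) (1 - A' B')], where both
   factors are nonnegative. *)
have -> : B = A + (B - A) by ring.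
have B'E : B' = A' - (B - A) * A' * B'.
  have -> : (B - A) * A' * B' = A' * (B * B') - (A * A') * B' by ring.
  by rewrite BB AA; ring.
have B'1 : B' <= 1 by nra.
have : 0 <= (B - A) * (1 - A' * B').
  by apply: mulr_ge0; [lra|rewrite subr_ge0; nra].
rewrite mulrBr mulr1 mulrA; lra.
Qed.

Lemma singular_riccati_coth (c : R) : 0 < c ->
  singular_riccati c (fun x => c * coth (c * x)).
Proof.
move=> c0.
have s0 x : 0 < x -> 0 < sinh (c * x) by move=> x0; rewrite sinh_gt0// mulr_gt0.
split=> [|x x0|x x0|x x0]; first exact: ltW.
- have nz := lt0r_neq0 (s0 x x0).
  have dc : der (fun x => c * x) x c.
    by apply: der_eq; [apply: derZ; exact: der_id|rewrite mulr1].
  apply: der_eq.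
    apply: derZ; apply: derM.
      by apply: (@der_comp R cosh (fun x => c * x)); [exact: der_cosh|exact: dc].
    apply: derV; first exact: nz.
    by apply: (@der_comp R sinh (fun x => c * x)); [exact: der_sinh|exact: dc].
  by rewrite /coth /=; field.
- rewrite ler_peMr ?(ltW c0)// /coth ler_pdivlMr ?s0// mul1r.
  rewrite /sinh /cosh ler_pM2r ?invr_gt0//.
  by rewrite lerD2l (le_trans _ (expR_ge0 _))// oppr_le0 expR_ge0.
- have := sinh_le_cosh (mulr_gt0 c0 x0).
  rewrite /coth; move: (sinh (c * x)) (cosh (c * x)) (s0 x x0) => S C S0 h.
  rewrite mulrA ler_pdivlMr// [x^-1 * _]mulrC ler_pdivrMr//.
  by apply: (le_trans h); rewrite mulrAC.
Qed.

End hyperbolic_solution.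

(** * Conditioning as a limit of difference quotients *)

Section conditional_expectation.
Context {R : realType} {d : measure_display} {Omega : measurableType d}.
Variables (P : probability Omega R) (r : {nonneg R}) (a : R).
Variable X : R -> Omega -> finmeas R.
Hypothesis sbmX : is_sbm P (mscale r (@dirac _ (measurableTypeR R) a R)) X.
Hypothesis a_gt0 : 0 < a.

Let F (c : R) (kap : R -> R) (x : R) : R :=
  expR (- (r%:num * (3 / 2 * kap x ^+ 2 - c ^+ 2))).

Let F_quotient (c : R) (kap : R -> R) : singular_riccati c kap ->
  e^-1 * (F c kap (e + a) - F c kap a) @[e --> 0^'+] -->
  - (r%:num * (3 * kap a * (c ^+ 2 - kap a ^+ 2))) * F c kap a.
Proof.
move=> [_ dk _ _].
have dF : is_derive a 1 (F c kap)
    (- (r%:num * (3 * kap a * (c ^+ 2 - kap a ^+ 2))) * F c kap a).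
  apply: der_eq.
    apply: (@der_comp R expR (fun x => - (r%:num * (3 / 2 * kap x ^+ 2 - c ^+ 2)))).
      exact: is_derive_expR.
    apply: derN; apply: derZ; apply: derB; last exact: der_cst.
    by apply: derZ; apply: derX; exact: (dk a a_gt0).
  by rewrite /F /=; field.
apply: cvg_trans (is_derive_quotient dF); apply: cvg_app.
move=> A /nbhs_ballP[e /= e0 eA]; apply/nbhs_ballP; exists e => // x xe x0.
by apply: eA => //; rewrite gt_eqF.
Qed.

(** [range_gt 0] is contained in [range_gt (- e)], so the indicator of the difference is the
    difference of the indicators, and [range_gt_formula] applies to each. *)
Let E_range_diff (c : R) (kap : R -> R) (e : R) :
  singular_riccati c kap -> 0 < e ->
  E P (fun o => \1_(min_range_in X `]- e, 0]) o * discount X (c ^+ 4 / 2) o) =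
  F c kap (e + a) - F c kap a.
Proof.
move=> kapP e0.
have ea : - e < a by have := a_gt0; lra.
have := range_gt_formula sbmX kapP ea; rewrite opprK [a + e]addrC => H1.
have := range_gt_formula sbmX kapP a_gt0; rewrite subr0 => H2.
rewrite /F -H1 -H2 -E_B; last 2 first.
- apply: unit_rvM; last exact: (unit_rv_discount sbmX kapP).
  exact: unit_rv_indic (measurable_range_gt sbmX _).
- apply: unit_rvM; last exact: (unit_rv_discount sbmX kapP).
  exact: unit_rv_indic (measurable_range_gt sbmX _).
congr (E P _); apply/funext => o; rewrite -mulrBl; congr (_ * _).
rewrite min_range_inE !indicE.
have [zo|zo] := boolP (o \in range_gt X 0).
  have oe : o \in range_gt X (- e).
    move/set_mem : zo => [n _ /alive_range oA]; rewrite inE.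
    exists n => //; apply/alive_range => x /oA; apply: le_trans.
    by rewrite lerD2r oppr_le0 ltW.
  by rewrite oe memNset ?subrr// => -[_]; apply; exact: set_mem.
rewrite subr0; congr ((nat_of_bool _)%:R); apply/idP/idP.
  by rewrite inE => -[+ _]; rewrite inE.
by rewrite !inE => oe; split=> // oo; move/negP : zo; apply; rewrite inE.
Qed.

Let measurable_event (e : R) : measurable (min_range_in X `]- e, 0]).
Proof. by rewrite min_range_inE; apply: measurableD; exact: measurable_range_gt sbmX _. Qed.

Let discountE mu o : 0 <= mu ->
  (discount X mu o)%:E = expeR (- (mu%:E * total_mass X o))%E.
Proof.
move=> mu0; rewrite /discount fineK// ge0_fin_numE ?expeR_ge0//.
apply: (@le_lt_trans _ _ (expeR 0)); last by rewrite expeR0 ltry.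
by rewrite lee_expeR oppe_le0 mule_ge0 ?lee_fin ?total_mass_ge0.
Qed.

Lemma cond_expectation_quotient (c : R) (kap : R -> R) (e : R) :
  singular_riccati c kap -> 0 < e ->
  cond_expectation P (min_range_in X `]- e, 0])
    (fun w => expeR (- ((c ^+ 4 / 2)%:E * total_mass X w))%E) =
  (e^-1 * (F c kap (e + a) - F c kap a)) /
  (e^-1 * (F 0 (fun x => x^-1) (e + a) - F 0 (fun x => x^-1) a)).
Proof.
move=> kapP e0.
have c40 : 0 <= c ^+ 4 / 2.
  by rewrite divr_ge0// exprn_ge0//; case: kapP.
rewrite -(E_range_diff kapP e0) -(E_range_diff singular_riccati_inv e0).
rewrite invfM mulrACA divff ?mul1r ?invr_neq0 ?lt0r_neq0//.
rewrite /cond_expectation; congr (_ / _).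
  rewrite /E /Rintegral; congr fine; rewrite [LHS]integral_mkcond.
  apply: eq_integral => w _; rewrite patchE indicE.
  case: ifPn => wA; last by rewrite mul0r.
  by rewrite mul1r discountE.
rewrite /E /Rintegral; congr fine.
transitivity (\int[P]_w (\1_(min_range_in X `]- e, 0%R]) w)%:E)%E.
  by rewrite integral_indic// setIT.
(* With rate 0 the discount is 1 even on paths of infinite total mass, so the denominator is the
   exact probability. *)
apply: eq_integral => w _; congr EFin.
by rewrite /discount expr0n/= mul0r mul0e oppe0 expeR0 mulr1.
Qed.

(** Numerator and denominator have derivatives proportional to [3 r], which cancels; [kap = 1/x]
    contributes [a^-3] below, hence the factor [a ^+ 3]. Positivity of [r] makes the derivative in
    the denominator nonzero. *)
Lemma cond_expectation_cvg (c : R) (kap : R -> R) :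
  0 < r%:num -> singular_riccati c kap ->
  cond_expectation P (min_range_in X `]- e, 0])
    (fun w => expeR (- ((c ^+ 4 / 2)%:E * total_mass X w))%E) @[e --> 0^'+] -->
  a ^+ 3 * (kap a * (kap a ^+ 2 - c ^+ 2)) *
    expR (- (r%:num * (3 / 2 * kap a ^+ 2 - c ^+ 2 - 3 / (2 * a ^+ 2)))).
Proof.
move=> r0 kapP.
have an0 := lt0r_neq0 a_gt0.
pose D0 := - (r%:num * (3 * a^-1 * (0 ^+ 2 - a^-1 ^+ 2))) * F 0 (fun x => x^-1) a.
have D00 : D0 != 0.
  rewrite /D0 mulf_neq0 ?lt0r_neq0 ?expR_gt0// expr0n/= sub0r mulrN mulrN opprK.
  by rewrite !mulr_gt0 ?exprn_gt0 ?invr_gt0.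
have H : (e^-1 * (F c kap (e + a) - F c kap a)) /
    (e^-1 * (F 0 (fun x => x^-1) (e + a) - F 0 (fun x => x^-1) a))
    @[e --> 0^'+] -->
    - (r%:num * (3 * kap a * (c ^+ 2 - kap a ^+ 2))) * F c kap a / D0.
  apply: cvgM; first exact: F_quotient.
  by apply: cvgV => //; exact: F_quotient singular_riccati_inv.
have -> : a ^+ 3 * (kap a * (kap a ^+ 2 - c ^+ 2)) *
    expR (- (r%:num * (3 / 2 * kap a ^+ 2 - c ^+ 2 - 3 / (2 * a ^+ 2)))) =
    - (r%:num * (3 * kap a * (c ^+ 2 - kap a ^+ 2))) * F c kap a / D0.
  have -> : expR (- (r%:num * (3 / 2 * kap a ^+ 2 - c ^+ 2 - 3 / (2 * a ^+ 2)))) =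
      F c kap a / F 0 (fun x => x^-1) a.
    rewrite /F -expRN -expRD; congr expR; rewrite expr0n/= exprVn.
    by field.
  rewrite /D0 expr0n/=.
  have := lt0r_neq0 (expR_gt0 (- (r%:num * (3 / 2 * a^-1 ^+ 2 - 0 ^+ 2)))).
  rewrite -/(F 0 (fun x => x^-1) a) => F0n.
  field; apply/and3P; split; [exact: an0|exact: F0n|exact: (lt0r_neq0 r0)].
(* The quotient formula holds only for [e > 0], so the limit is transferred along the right-hand
   filter rather than by an equality of functions. *)
apply/cvgrPdist_lt => eps eps0.
move: H => /cvgrPdist_lt/(_ eps eps0).
have := @nbhs_right_gt R 0; apply: filterS2 => e e0.
by rewrite (cond_expectation_quotient kapP e0).
Qed.

End conditional_expectation.

Theorem corollary4p7 (R : realType) (d : measure_display)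
    (Omega : measurableType d) (P : probability Omega R)
    (a r : R) (a_gt0 : 0 < a) (r_gt0 : 0 < r)
    (X : R -> Omega -> finmeas R)
    (sbmX : is_sbm P
       (mscale (NngNum (ltW r_gt0)) (@dirac _ (measurableTypeR R) a R)) X)
    (mu : R) (mu_gt0 : 0 < mu) :
  cond_expectation P (min_range_in X `]- eps, 0])
      (fun w => expeR (- (mu%:E * total_mass X w))%E) @[eps --> 0^'+] -->
  a ^+ 3 * (2 * mu) `^ (3 / 4) *
    (cosh ((2 * mu) `^ (1 / 4) * a) / sinh ((2 * mu) `^ (1 / 4) * a) ^+ 3) *
    expR (- (r * (Num.sqrt (mu / 2) *
                    (3 * coth ((2 * mu) `^ (1 / 4) * a) ^+ 2 - 2) -
                  3 / (2 * a ^+ 2)))).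
Proof.
have mu2 : 0 < 2 * mu by rewrite mulr_gt0.
(* This [c] satisfies [c^4 / 2 = mu]; all powers of [2 mu] in the statement, and the square root,
   then become powers of [c]. *)
set c := (2 * mu) `^ (1 / 4).
have c0 : 0 < c by exact: powR_gt0.
have c4 : c ^+ 4 = 2 * mu.
  by rewrite -powR_mulrn ?powR_ge0// -powRrM divfK// powRr1// ltW.
have c3 : (2 * mu) `^ (3 / 4) = c ^+ 3.
  by rewrite -powR_mulrn ?powR_ge0// -powRrM; congr powR; rewrite mul1r mulrC.
have cmu : mu = c ^+ 4 / 2 by rewrite c4 mulrC mulKf.
have c2 : Num.sqrt (mu / 2) = c ^+ 2 / 2.
  have -> : mu / 2 = (c ^+ 2 / 2) ^+ 2 by rewrite cmu; field.
  by rewrite sqrtr_sqr ger0_norm// divr_ge0// sqr_ge0.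
have s0 : 0 < sinh (c * a) by rewrite sinh_gt0// mulr_gt0.
rewrite c3 c2 cmu.
(* By [cosh^2 - sinh^2 = 1], the difference [(c coth)^2 - c^2] equals [c^2 / sinh^2], which accounts
   for the third power of [sinh]. *)
have -> : a ^+ 3 * c ^+ 3 * (cosh (c * a) / sinh (c * a) ^+ 3) =
    a ^+ 3 * (c * coth (c * a) * ((c * coth (c * a)) ^+ 2 - c ^+ 2)).
  rewrite /coth.
  have -> : (c * (cosh (c * a) / sinh (c * a))) ^+ 2 - c ^+ 2 =
      c ^+ 2 * (cosh (c * a) ^+ 2 - sinh (c * a) ^+ 2) / sinh (c * a) ^+ 2.
    by field; exact: lt0r_neq0.
  by rewrite cosh2_sinh2; field; exact: lt0r_neq0.
have -> : c ^+ 2 / 2 * (3 * coth (c * a) ^+ 2 - 2) =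
    3 / 2 * (c * coth (c * a)) ^+ 2 - c ^+ 2 by field.
have := cond_expectation_cvg sbmX a_gt0 r_gt0 (singular_riccati_coth c0).
exact.
Qed.
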